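(* Let $\Gamma=\{g_1,\ldots,g_k\}$ be a family of homeomorphisms of the circle $\mathbf S^1$ which acts minimally and such that there is no Borel probability measure on $\mathbf S^1$ invariant by $\Gamma$. Let $\mathbf p=(p_1,\ldots,p_k)$ be any probability vector with all $p_i>0$, and let $\mu_*$ be an invariant probability measure for the iterated function system $(\Gamma,\mathbf p)$. Let $\varphi:\mathbf S^1\to\mathbb R$ be an arbitrary Lipschitz continuous function with $\int_{\mathbf S^1}\varphi\,d\mu_*=0$. Then $(\Gamma,\mathbf p)$ satisfies the Central Limit Theorem for the function $\varphi$: if $(X_n)_{n\ge0}$ is the stationary Markov chain corresponding to $(\Gamma,\mathbf p)$ with $X_0$ distributed according to $\mu_*$, and $$S_n^*=\frac{\varphi(X_0)+\cdots+\varphi(X_n)}{\sqrt n},\qquad n\ge1,$$ then the limit $\sigma^2=\lim_{n\to\infty}\mathbb E\big((S_n^* )^2\big)$ exists and is finite, and $S_n^*$ converges in distribution, as $n\to\infty$, to the normal law with mean $0$ and variance $\sigma^2$.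
   Context: $\mathbf S^1$ is the circle; the distance $d(x,y)$ is the length of the shorter of the two arcs joining $x$ and $y$, and ''Lipschitz'' is with respect to $d$. The family $\Gamma$ acts minimally if for every $x\in\mathbf S^1$ the orbit $\{g_{i_n}\circ\cdots\circ g_{i_1}(x): n\ge 1,\ (i_1,\ldots,i_n)\in\{1,\ldots,k\}^n\}$ is dense in $\mathbf S^1$ (only forward compositions are used). A Borel probability measure $\mu$ is invariant by $\Gamma$ if $\mu(g_i^{-1}(A))=\mu(A)$ for every Borel set $A$ and every $i=1,\ldots,k$ (i.e. it is invariant under each map individually). The Markov operator corresponding to $(\Gamma,\mathbf p)$ is $P\mu=\sum_{i=1}^k p_i\,\mu\circ g_i^{-1}$, where $(\mu\circ g_i^{-1})(A)=\mu(g_i^{-1}(A))$; a probability measure $\mu_*$ is invariant for $(\Gamma,\mathbf p)$ if $P\mu_*=\mu_*$. The Markov chain corresponding to $(\Gamma,\mathbf p)$ has transition probabilities $P\delta_x=\sum_{i=1}^k p_i\delta_{g_i(x)}$, i.e. $X_{n+1}=g_{i_{n+1}}(X_n)$, where $i_1,i_2,\ldots$ are independent, take value $j$ with probability $p_j$, and are independent of $X_0$. When $\sigma^2=0$, the normal law with mean $0$ and variance $0$ is the Dirac measure at $0$. *)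

(* Defs.v *)
From HB Require Import structures.
From mathcomp Require Import all_boot all_order all_algebra finmap.
From mathcomp Require Import all_classical all_reals all_analysis.
From mathcomp Require Import lra.

Set Implicit Arguments.
Unset Strict Implicit.
Unset Printing Implicit Defensive.

Import Order.TTheory GRing.Theory Num.Theory.
Import numFieldNormedType.Exports.

Local Open Scope classical_set_scope.
Local Open Scope ring_scope.

(* The circle R/Z, of total length 1; a point is represented by its unique
   representative in [0, 1[. *)
Record circle (R : realType) := Circle {
  cval :> R;
  cval_itv : 0 <= cval < 1 }.

Section circle_structure.
Variable R : realType.

HB.instance Definition _ := [isSub for @cval R].
HB.instance Definition _ := [Choice of circle R by <:].

Lemma circle0_itv : 0 <= (0 : R) < 1. Proof. by rewrite lexx ltr01. Qed.

HB.instance Definition _ := isPointed.Build (circle R) (Circle circle0_itv).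

(* The two arcs joining x and y have lengths `|x - y| and 1 - `|x - y|. *)
Definition arc_dist (x y : circle R) : R :=
  Num.min `|cval x - cval y| (1 - `|cval x - cval y|).

Let arc_distxx x : arc_dist x x = 0.
Proof. by rewrite /arc_dist subrr normr0 subr0 minEle ler01. Qed.

Let arc_dist_positivity x y : arc_dist x y = 0 -> x = y.
Proof.
rewrite /arc_dist => xy0; apply: val_inj => /=; move: xy0.
have /andP[x0 x1] := cval_itv x; have /andP[y0 y1] := cval_itv y.
by case: (ler0P (cval x - cval y)) => ?; rewrite minElt; case: ifP => _; lra.
Qed.

Let arc_dist_sym x y : arc_dist x y = arc_dist y x.
Proof. by rewrite /arc_dist distrC. Qed.

Let arc_dist_triangle y x z : arc_dist x z <= arc_dist x y + arc_dist y z.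
Proof.
rewrite /arc_dist.
have /andP[x0 x1] := cval_itv x; have /andP[y0 y1] := cval_itv y.
have /andP[z0 z1] := cval_itv z.
case: (ler0P (cval x - cval y)) => ?; case: (ler0P (cval y - cval z)) => ?;
case: (ler0P (cval x - cval z)) => ?; rewrite !minEle;
do 3! (case: ifPn; rewrite -?ltNge => ?); lra.
Qed.

HB.instance Definition _ := @isMetric.Build R (circle R) arc_dist
  arc_distxx arc_dist_positivity arc_dist_sym arc_dist_triangle.

HB.instance Definition _ := @isMeasurable.Build
  (sigma_display (@open (circle R))) (circle R) <<s @open (circle R) >>
  (@sigma_algebra0 _ setT _) (@sigma_algebraC _ _)
  (@sigma_algebra_bigcup _ setT _).

End circle_structure.

Lemma mdist_circleE (R : realType) (x y : circle R) : mdist x y = arc_dist x y.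
Proof. by []. Qed.

Lemma measurable_circleE (R : realType) :
  @measurable _ (circle R) = <<s @open (circle R) >>.
Proof. by []. Qed.

Definition homeomorphism (T : topologicalType) (f : T -> T) : Prop :=
  continuous f /\
  exists h : T -> T, [/\ continuous h, cancel f h & cancel h f].

Definition lipschitz_continuous (R : realType) (T : metricType R) (phi : T -> R) : Prop :=
  exists L : R, forall x y, `|phi x - phi y| <= L * mdist x y.

Section iterated_function_system.
Variables (R : realType) (k : nat).

Section orbits.
Variables (T : topologicalType) (g : 'I_k -> T -> T).

(* w = [:: i_1; ...; i_n] is sent to g_(i_n) (... (g_(i_1) x)). *)
Definition iter_word (w : seq 'I_k) (x : T) : T :=
  foldl (fun y i => g i y) x w.

Definition forward_orbit (x : T) : set T :=
  [set y | exists w : seq 'I_k, (1 <= size w)%N /\ y = iter_word w x].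

Definition acts_minimally : Prop := forall x, dense (forward_orbit x).

End orbits.

Section measures.
Variables (d : measure_display) (T : measurableType d) (g : 'I_k -> T -> T).

Definition invariant_by_family (mu : probability T R) : Prop :=
  forall (i : 'I_k) (A : set T), measurable A -> mu (g i @^-1` A) = mu A.

Definition markov_operator (p : 'I_k -> R) (mu : set T -> \bar R) :
    set T -> \bar R :=
  fun A => (\sum_(i < k) (p i)%:E * pushforward mu (g i) A)%E.

Definition invariant_for_ifs (p : 'I_k -> R) (mu : probability T R) : Prop :=
  forall A : set T, measurable A -> markov_operator p mu A = mu A.

End measures.

End iterated_function_system.

Section independence.
Variables (R : realType) (d : measure_display) (Omega : measurableType d).
Variable P : probability Omega R.

Definition mutually_independent (I : choiceType) (F : I -> set_system Omega)
    : Prop :=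
  forall (J : {fset I}) (E : I -> set Omega),
    (forall i, i \in J -> F i (E i)) ->
    P (\bigcap_(i in [set` J]) E i) = (\prod_(i <- J) P (E i))%E.

Definition independent_systems (F G : set_system Omega) : Prop :=
  forall A B, F A -> G B -> P (A `&` B) = (P A * P B)%E.

End independence.

Section markov_chain.
Variables (R : realType) (k : nat).
Variables (d' : measure_display) (T : measurableType d').
Variables (g : 'I_k -> T -> T) (p : 'I_k -> R) (mu : probability T R).
Variables (d : measure_display) (Omega : measurableType d).
Variable P : probability Omega R.

(* The sigma-algebra generated by a random index; 'I_k is discrete. *)
Definition index_sigma (i : Omega -> 'I_k) : set_system Omega :=
  preimage_set_system setT i setT.

(* The random index i_(n+1) is encoded as [idx n]. *)
Definition driving_sequence (idx : nat -> Omega -> 'I_k) : Prop :=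
  [/\ forall n j, measurable (idx n @^-1` [set j]),
      forall n j, P (idx n @^-1` [set j]) = (p j)%:E
    & mutually_independent P (fun n => index_sigma (idx n))].

Definition stationary_chain (X : nat -> Omega -> T) : Prop :=
  [/\ measurable_fun setT (X 0%N),
      forall A, measurable A -> P (X 0%N @^-1` A) = mu A
    & exists idx : nat -> Omega -> 'I_k,
      [/\ driving_sequence idx,
          independent_systems P (preimage_set_system setT (X 0%N) measurable)
            <<s \bigcup_n index_sigma (idx n) >>
        & forall n w, X n.+1 w = g (idx n w) (X n w)]].

(* (phi (X_0) + ... + phi (X_n)) / sqrt n; there are n + 1 summands. *)
Definition normalized_sum (phi : T -> R) (X : nat -> Omega -> T) (n : nat)
    (w : Omega) : R :=
  (\sum_(0 <= j < n.+1) phi (X j w)) / Num.sqrt n%:R.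

End markov_chain.

Section normal_law.
Variable R : realType.

(* [normal_prob] takes the standard deviation as its parameter, and its value
   at 0 is not a Dirac measure. *)
Definition normal_law (v : R) : probability (measurableTypeR R) R :=
  if v == 0 then (\d_(0 : measurableTypeR R) : probability _ R)
  else normal_prob 0 (Num.sqrt v).

Definition cvg_in_distribution (d : measure_display)
    (Omega : measurableType d) (P : probability Omega R)
    (Y : nat -> Omega -> R) (nu : probability (measurableTypeR R) R) : Prop :=
  forall f : R -> R, continuous f -> (exists M, forall x, `|f x| <= M) ->
    'E_P[fun w => f (Y n w)]%E @[n --> \oo] --> (\int[nu]_x (f x)%:E)%E.

End normal_law.

(* Main.v *)
Require Import Defs.
From HB Require Import structures.
From mathcomp Require Import all_boot all_order all_algebra.
From mathcomp Require Import all_classical all_reals all_analysis.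
From mathcomp Require Import measurable_realfun ring lra.

Set Implicit Arguments.
Unset Strict Implicit.
Unset Printing Implicit Defensive.

Import Order.TTheory GRing.Theory Num.Theory.
Import numFieldNormedType.Exports.

Local Open Scope classical_set_scope.
Local Open Scope ring_scope.

(** Let U f (x) = sum_i p_i f (g_i x). If a bounded function h solves the Poisson equation
    h - U h = f, then f (X_0) + ... + f (X_n) differs by a bounded amount from a martingale with
    stationary bounded increments, and the central limit theorem for f is that of the martingale.
    A solution is the series of the iterates U^n f. The maps are only homeomorphisms and need not
    contract anything individually, so the convergence of the series has to come from minimality
    and from the absence of a common invariant measure. There are four steps.

    Singularity. Each map acts on half-densities with respect to the stationary measure mu, that
    is on the functions v that stand for the measures v^2 mu, by an isometry of L^2(mu). The mean
    [Sop] of these isometries has iterates at 1 that decrease to a fixed point. Equality in the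
    triangle inequality shows that the fixed point is fixed by every isometry, so that its square
    is the density of an invariant measure; hence it is 0 ([affinity_to0]). So the images of mu by
    most long words are almost singular to mu ([words_singular]), that is, most long words squeeze
    a set of almost full measure into a set of small measure.

    Contraction. Arcs are measured by a nonatomic measure kappa that dominates mu and length and
    that the words distort boundedly ([reference_measure]). On the circle a finite cover by arcs
    can be thinned out until no point lies in three of them ([connected_three]), which gives a
    weak type inequality ([weak_type]): a word that squeezes a large set contracts the short arcs
    around most points. The logarithm of the contraction factor has negative mean
    ([mean_contraction]), and by the maximal ergodic inequality there is a point around which
    short arcs shrink exponentially, forever, with positive probability ([calm_point]).

    Coupling. By minimality two independent trajectories visit a neighbourhood of that point at the
    same time with probability bounded below, whatever their starting points; periodicity is
    excluded by adding the identity to the maps, which does not affect the solvability of the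
    Poisson equation ([lazy_hitting], [poisson_minimal]). From then on the two trajectories follow
    the same letters. This bounds sum_n |U^n f (x) - U^n f (y)| ([discrepancy_bounded]), and the
    series of the U^n f converges ([poisson]). All this holds for the class [arc_lip] of functions
    that are Lipschitz with respect to kappa, which is stable under products.

    Central limit theorem. Because of this stability the Poisson equation can be solved a second
    time, for the conditional variance of the martingale increments, which is thus a constant up
    to a coboundary q - U q and a small error ([poisson_corrector]). The characteristic function
    of the martingale, with the factor 1 - s^2 q / 2 under the expectation, is then multiplied by
    exp (- s^2 sigma^2 / 2) at each step, up to terms of higher order ([one_step]), and converges
    to that of the normal law ([mart_cos_cvg], [normal_prob_cos]). That the convergence of
    characteristic functions implies convergence in distribution follows from the Bernstein
    approximation by trigonometric polynomials ([levy]). *)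

(** * Integrals of bounded measurable functions *)

Section bounded_measurable.
Context {d : measure_display} {T : measurableType d} {R : realType}.
Implicit Types (f h : T -> R).

(** For every finite measure such a function is integrable on every measurable set, so that its
   real-valued integral is linear and monotone without further side conditions. *)
Definition bmf f := measurable_fun setT f /\ exists M : R, forall x, `|f x| <= M.

Lemma bmf_cst c : bmf (fun=> c).
Proof. by split; [exact: measurable_cst|exists `|c|]. Qed.

Lemma bmfD f h : bmf f -> bmf h -> bmf (fun x => f x + h x).
Proof.
move=> [mf [M fM]] [mh [N hN]]; split; first exact: measurable_funD.
by exists (M + N) => x; rewrite (le_trans (ler_normD _ _))// lerD.
Qed.

Lemma bmfN f : bmf f -> bmf (fun x => - f x).
Proof.
move=> [mf [M fM]]; split; last by exists M => x; rewrite normrN.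
exact: measurableT_comp.
Qed.

Lemma bmfB f h : bmf f -> bmf h -> bmf (fun x => f x - h x).
Proof. by move=> bf bh; apply: bmfD => //; exact: bmfN. Qed.

Lemma bmfM f h : bmf f -> bmf h -> bmf (fun x => f x * h x).
Proof.
move=> [mf [M fM]] [mh [N hN]]; split; first exact: measurable_funM.
by exists (M * N) => x; rewrite normrM ler_pM.
Qed.

Lemma bmfZ c f : bmf f -> bmf (fun x => c * f x).
Proof. by move=> bf; apply: bmfM => //; exact: bmf_cst. Qed.

Lemma bmf_norm f : bmf f -> bmf (fun x => `|f x|).
Proof.
move=> [mf [M fM]]; split; last by exists M => x; rewrite normr_id.
exact: measurableT_comp.
Qed.

Lemma bmf_sum (I : Type) (s : seq I) (F : I -> T -> R) :
  (forall i, bmf (F i)) -> bmf (fun x => \sum_(i <- s) F i x).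
Proof.
move=> bF; elim: s => [|i s IH].
  by under eq_fun do rewrite big_nil; exact: bmf_cst.
by under eq_fun do rewrite big_cons; exact: bmfD.
Qed.

Lemma bmf_indic (A : set T) : measurable A -> bmf (\1_A : T -> R).
Proof.
move=> mA; split; first exact: measurable_indic.
by exists 1 => x; rewrite indicE ger0_norm// lern1 leq_b1.
Qed.

Lemma bmf_max f h : bmf f -> bmf h -> bmf (fun x => Num.max (f x) (h x)).
Proof.
move=> [mf [M fM]] [mh [N hN]]; split; first exact: measurable_maxr.
exists (Num.max M N) => x; rewrite le_max.
by rewrite /Num.max; case: ifP => _; rewrite ?hN ?fM ?orbT.
Qed.

Lemma bmf_lim (F : nat -> T -> R) f (M : R) : (forall n, bmf (F n)) ->
  (forall n x, `|F n x| <= M) ->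
  (forall x, F n x @[n --> \oo] --> f x) -> bmf f /\ forall x, `|f x| <= M.
Proof.
move=> bF FM Ff.
have fM x : `|f x| <= M.
  have nf : `|F n x| @[n --> \oo] --> `|f x| by apply: cvg_norm; exact: Ff.
  rewrite -(cvg_lim (@Rhausdorff R) nf); apply: limr_le.
    by apply/cvg_ex; exists `|f x|.
  exact: nearW.
split=> //; split; last by exists M.
apply: (@measurable_fun_cvg _ _ _ _ F) => [m|x _]; first by case: (bF m).
exact: Ff.
Qed.

End bounded_measurable.

Lemma bmf_comp {d d' : measure_display} {T : measurableType d}
    {T' : measurableType d'} {R : realType} (u : T -> T') (f : T' -> R) :
  measurable_fun setT u -> bmf f -> bmf (fun x => f (u x)).
Proof.
by move=> mu [mf [M fM]]; split; [exact: measurableT_comp|exists M].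
Qed.

Section sublevels.
Context {d : measure_display} {T : measurableType d} {R : realType}.
Variables (f : T -> R) (c : R).
Hypothesis mf : measurable_fun setT f.

Lemma measurable_sublevel : measurable [set x | f x <= c].
Proof.
rewrite -[X in measurable X]setTI.
by apply: measurable_fun_le => //; exact: measurable_cst.
Qed.

Lemma measurable_superlevel : measurable [set x | c <= f x].
Proof.
rewrite -[X in measurable X]setTI.
by apply: measurable_fun_le => //; exact: measurable_cst.
Qed.

Lemma superlevelE : [set x | c < f x] = ~` [set x | f x <= c].
Proof. by apply/seteqP; split=> x /=; rewrite ltNge; move/negP. Qed.

Lemma measurable_strict_superlevel : measurable [set x | c < f x].
Proof. by rewrite superlevelE; apply: measurableC; exact: measurable_sublevel. Qed.

End sublevels.

Section integral_bounded.
Context {d : measure_display} {T : measurableType d} {R : realType}.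
Variable m : {finite_measure set T -> \bar R}.
Implicit Types (f h : T -> R) (A D : set T).

Lemma bmf_integrable D f : measurable D -> bmf f -> m.-integrable D (EFin \o f).
Proof.
move=> mD [mf [M fM]]; apply: measurable_bounded_integrable => //.
- by have := fin_num_measure m _ mD; rewrite ge0_fin_numE.
- exact: measurable_funTS.
- exists M; split; first exact: num_real.
  by move=> N MN x _ /=; rewrite (le_trans (fM x))// ltW.
Qed.

Lemma EFin_int D f : measurable D -> bmf f ->
  (\int[m]_(x in D) f x)%:E = (\int[m]_(x in D) (f x)%:E)%E.
Proof.
by move=> mD bf; rewrite fineK//; apply: integrable_fin_num => //; exact: bmf_integrable.
Qed.

Lemma intD D f h : measurable D -> bmf f -> bmf h ->
  \int[m]_(x in D) (f x + h x) = \int[m]_(x in D) f x + \int[m]_(x in D) h x.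
Proof. by move=> mD bf bh; apply: RintegralD => //; exact: bmf_integrable. Qed.

Lemma intB D f h : measurable D -> bmf f -> bmf h ->
  \int[m]_(x in D) (f x - h x) = \int[m]_(x in D) f x - \int[m]_(x in D) h x.
Proof. by move=> mD bf bh; apply: RintegralB => //; exact: bmf_integrable. Qed.

Lemma intZ D c f : measurable D -> bmf f ->
  \int[m]_(x in D) (c * f x) = c * \int[m]_(x in D) f x.
Proof. by move=> mD bf; apply: RintegralZl => //; exact: bmf_integrable. Qed.

Lemma int_cst D c : measurable D -> \int[m]_(x in D) c = c * fine (m D).
Proof. by move=> mD; rewrite Rintegral_cst. Qed.

Lemma int_sum D (I : Type) (s : seq I) (F : I -> T -> R) : measurable D ->
  (forall i, bmf (F i)) ->
  \int[m]_(x in D) (\sum_(i <- s) F i x) = \sum_(i <- s) \int[m]_(x in D) F i x.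
Proof.
move=> mD bF; elim: s => [|i s IH].
  under [LHS]eq_Rintegral do rewrite big_nil.
  by rewrite int_cst// mul0r big_nil.
under [LHS]eq_Rintegral do rewrite big_cons.
by rewrite intD//; [rewrite big_cons IH|exact: bmf_sum].
Qed.

Lemma int_le D f h : measurable D -> bmf f -> bmf h ->
  (forall x, D x -> f x <= h x) -> \int[m]_(x in D) f x <= \int[m]_(x in D) h x.
Proof. by move=> mD bf bh fh; apply: le_Rintegral => //; exact: bmf_integrable. Qed.

Lemma int_ge0 D f : (forall x, D x -> 0 <= f x) -> 0 <= \int[m]_(x in D) f x.
Proof. exact: Rintegral_ge0. Qed.

Lemma int_norm D f : measurable D -> bmf f ->
  `|\int[m]_(x in D) f x| <= \int[m]_(x in D) `|f x|.
Proof. by move=> mD bf; apply: le_normr_Rintegral => //; exact: bmf_integrable. Qed.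

Lemma int_indic A : measurable A -> \int[m]_x \1_A x = fine (m A).
Proof. by move=> mA; rewrite /Rintegral integral_indic// setIT. Qed.

Lemma int_indicM A f : measurable A ->
  \int[m]_x (f x * \1_A x) = \int[m]_(x in A) f x.
Proof.
move=> mA; rewrite [RHS]Rintegral_mkcond; apply: eq_Rintegral => x _.
by rewrite patchE indicE; case: (x \in A); rewrite ?mulr1 ?mulr0.
Qed.

Lemma int_lim (F : nat -> T -> R) f (M : R) D : measurable D ->
  (forall n, bmf (F n)) -> (forall n x, `|F n x| <= M) ->
  (forall x, F n x @[n --> \oo] --> f x) ->
  \int[m]_(x in D) F n x @[n --> \oo] --> \int[m]_(x in D) f x.
Proof.
move=> mD bF FM Ff; have [bf _] := bmf_lim bF FM Ff.
apply: fine_cvg; rewrite -/(Rintegral m D f) EFin_int//.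
apply: (@dominated_cvg _ _ _ m D mD (fun n x => (F n x)%:E)
  (fun x => (f x)%:E) (fun=> M%:E)) => //.
- by move=> n; apply/measurable_EFinP/measurable_funTS; case: (bF n).
- by move=> x Dx; apply: cvg_EFin; [exact: nearW|exact: Ff].
- by apply: bmf_integrable => //; exact: bmf_cst.
- by move=> n x Dx /=; rewrite lee_fin.
Qed.

Lemma fine_measure_le A B : measurable A -> measurable B -> A `<=` B ->
  fine (m A) <= fine (m B).
Proof.
by move=> mA mB AB; rewrite fine_le ?fin_num_measure// le_measure ?inE.
Qed.

Lemma fine_measureU_le A B : measurable A -> measurable B ->
  fine (m (A `|` B)) <= fine (m A) + fine (m B).
Proof.
move=> mA mB; rewrite -fineD ?fin_num_measure// fine_le ?fin_num_measure//.
- exact: measurableU.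
- by rewrite fin_numD ?fin_num_measure.
- exact: measureU2.
Qed.

Lemma fine_measure_split A B : measurable A -> measurable B ->
  fine (m A) = fine (m (A `&` B)) + fine (m (A `\` B)).
Proof.
move=> mA mB; rewrite -fineD ?fin_num_measure//.
- by rewrite addeC (measureDI m mA mB).
- exact: measurableI.
- exact: measurableD.
Qed.

Lemma markov_ineq f A (t : R) : bmf f -> measurable A -> (forall x, 0 <= f x) ->
  0 < t -> (forall x, A x -> t <= f x) -> t * fine (m A) <= \int[m]_x f x.
Proof.
move=> bf mA f0 t0 tf; rewrite -int_indic// -intZ//; last exact: bmf_indic.
apply: int_le => //; first by apply: bmfZ; exact: bmf_indic.
move=> x _; rewrite indicE; case: (boolP (x \in A)) => xA; rewrite ?mulr1 ?mulr0//.
by apply: tf; move: xA; rewrite inE.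
Qed.

Lemma measure_decr_cvg (F : nat -> set T) : (forall n, measurable (F n)) ->
  (forall n, F n.+1 `<=` F n) -> \bigcap_n F n = set0 ->
  fine (m (F n)) @[n --> \oo] --> (0 : R).
Proof.
move=> mF Fd F0.
have h : m (F n) @[n --> \oo] --> m (\bigcap_n F n).
  apply: nonincreasing_cvg_mu => //.
  - by have := fin_num_measure m _ (mF 0%N); rewrite ge0_fin_numE.
  - exact: bigcap_measurable.
  - by apply/nonincreasing_seqP => n; apply/subsetPset; exact: Fd.
rewrite F0 measure0 in h; exact: (fine_cvg h).
Qed.

End integral_bounded.

Lemma int_prob_cst {d : measure_display} {T : measurableType d} {R : realType}
  (m : probability T R) (c : R) : \int[m]_x c = c.
Proof. by rewrite int_cst// [X in fine X]probability_setT mulr1. Qed.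

(** * The circle as a quotient of the line *)

Section circle_geometry.
Variable R : realType.
Local Notation C := (circle R).
Implicit Types (x y z : C) (r s t : R).

Lemma frac_itv r : 0 <= r - (Num.floor r)%:~R < 1.
Proof.
have := floor_le r; have := floorD1_gt r; rewrite intrD => ? ?.
by apply/andP; split; lra.
Qed.

Definition cproj r : C := Circle (frac_itv r).

Lemma cprojK x : cproj (cval x) = x.
Proof.
have /andP[x0 x1] := cval_itv x; apply: val_inj => /=.
rewrite (_ : Num.floor (cval x) = 0) ?subr0//.
by apply: floor_def; rewrite add0r x0.
Qed.

Lemma cprojDz r (n : int) : cproj (r + n%:~R) = cproj r.
Proof.
apply: val_inj => /=; rewrite floorDrz ?intr_int// intrKfloor intrD; lra.
Qed.

Lemma cprojD1 r : cproj (r + 1) = cproj r.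
Proof. exact: (cprojDz r 1). Qed.

Lemma cval_proj_itv r : 0 <= r < 1 -> cval (cproj r) = r.
Proof.
move=> r01; have := cprojK (Circle r01) => /=.
by move=> /(congr1 (@cval R)).
Qed.

Lemma mdist_proj_le r s : mdist (cproj r) (cproj s) <= `|r - s|.
Proof.
rewrite mdist_circleE /arc_dist.
have /andP[] := cval_itv (cproj r); have /andP[] := cval_itv (cproj s).
rewrite /=; set m := Num.floor r; set n := Num.floor s => s0 s1 r0 r1.
rewrite ge_min.
have [->|mn] := eqVneq m n.
  by apply/orP; left; rewrite opprB addrA subrK.
apply/orP; right.
have : 1 <= `|(m - n)%:~R : R|.
  by rewrite -intr_norm ler1z -gtz0_ge1 normr_gt0 subr_eq0.
rewrite intrD mulrNz; set a := m%:~R : R; set b := n%:~R : R.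
have -> : a - b = (r - s) - (r - a - (s - b)) by ring.
move=> h; have := le_trans h (ler_normB _ _); lra.
Qed.

(** By lifting points one at a time next to a given lift, questions about nearby points of the
   circle become questions about the line. *)
Lemma mdist_proj_lift r y : exists s, cproj s = y /\ `|r - s| = mdist (cproj r) y.
Proof.
have /andP[] := cval_itv (cproj r); have /andP[y0 y1] := cval_itv y.
rewrite mdist_circleE /arc_dist /=; set n := Num.floor r.
set a := r - _ => a0 a1.
have rE : r = a + n%:~R by rewrite /a subrK.
case: (leP `|a - cval y| (1 - `|a - cval y|)) => h.
  exists (cval y + n%:~R); split; first by rewrite cprojDz cprojK.
  by rewrite rE; congr (`|_|); ring.
case: (ltP a (cval y)) => ay.
  exists (cval y + (n - 1)%:~R); split; first by rewrite cprojDz cprojK.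
  rewrite rE intrD (_ : _ - _ = 1 - (cval y - a)); last by rewrite mulrNz; ring.
  by rewrite [in RHS]distrC !gtr0_norm; lra.
exists (cval y + (n + 1)%:~R); split; first by rewrite cprojDz cprojK.
rewrite rE intrD (_ : _ - _ = - (1 - (a - cval y))); last by ring.
by rewrite normrN ger0_norm ?ger0_norm//; lra.
Qed.

Lemma mdist_le_half x y : mdist x y <= 2^-1.
Proof. by rewrite mdist_circleE /arc_dist ge_min; apply/orP; case: (leP `|cval x - cval y| 2^-1) => ?; [left|right; lra]. Qed.

Lemma continuous_proj : continuous cproj.
Proof.
move=> r; apply/cvg_ballP => e e0.
near=> s; rewrite ballEmdist/=; apply: le_lt_trans (mdist_proj_le _ _) _.
near: s; exact: cvgr_dist_lt.
Unshelve. all: by end_near. Qed.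

Lemma open_ballP (U : set C) :
  open U <-> forall x, U x -> exists2 e, 0 < e & forall y, mdist x y < e -> U y.
Proof.
split=> [oU x Ux|H].
  have /nbhs_ballP[e /= e0 He] := open_nbhs_nbhs (conj oU Ux).
  by exists e => // y; have := He y; rewrite ballEmdist.
rewrite openE => x /H[e e0 He]; apply/nbhs_ballP; by exists e.
Qed.

Lemma open_mball x (e : R) : open [set y | mdist x y < e].
Proof.
apply/open_ballP => y /= xy; exists (e - mdist x y) => [|z yz]; first by rewrite subr_gt0.
by rewrite /= (le_lt_trans (metric_triangle _ y _))// -ltrBrDl.
Qed.

Lemma open_proj_itv r s : open (cproj @` `]r, s[%classic).
Proof.
apply/open_ballP => _ [t /= + <-]; rewrite in_itv/= => /andP[rt ts].
exists (Num.min (t - r) (s - t)); first by rewrite lt_min !subr_gt0 rt.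
move=> y; have [u [<- <-]] := mdist_proj_lift t y.
rewrite lt_min => /andP[h1 h2]; exists u => //=; rewrite in_itv/=.
by move: h1 h2; rewrite !ltr_norml => /andP[? ?] /andP[? ?]; apply/andP; split; lra.
Qed.

Lemma connected_proj_itv (i : interval R) : connected (cproj @` [set` i]).
Proof.
apply: connected_continuous_connected; last exact: continuous_subspaceT continuous_proj.
exact/connected_intervalP/interval_is_interval.
Qed.

Lemma mballE x (e : R) : [set y | mdist x y < e] =
  cproj @` `]cval x - e, cval x + e[%classic.
Proof.
apply/seteqP; split=> [y /= xy|_ [t /= + <-]].
  have [s [sy xs]] := mdist_proj_lift (cval x) y.
  exists s => //=; rewrite in_itv/=; move: xs; rewrite cprojK => xs.
  by move: xy; rewrite -xs ltr_norml => /andP[? ?]; apply/andP; split; lra.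
rewrite in_itv/= => /andP[? ?]; rewrite -{1}(cprojK x).
by rewrite (le_lt_trans (mdist_proj_le _ _))// ltr_norml; apply/andP; split; lra.
Qed.

Lemma connected_mball x (e : R) : connected [set y | mdist x y < e].
Proof. rewrite mballE; exact: connected_proj_itv. Qed.

Lemma proj_itv_cover r y : exists2 s, r <= s < r + 1 & cproj s = y.
Proof.
exists (cval y + (- Num.floor (cval y - r))%:~R); last by rewrite cprojDz cprojK.
have /andP[] := frac_itv (cval y - r); rewrite mulrNz => ? ?.
by apply/andP; split; lra.
Qed.

Lemma proj_inj_itv r s t : r <= s < r + 1 -> r <= t < r + 1 -> cproj s = cproj t -> s = t.
Proof.
move=> /andP[? ?] /andP[? ?] /(congr1 (@cval R))/= st.
have : s - t = (Num.floor s - Num.floor t)%:~R by rewrite intrD mulrNz; lra.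
have [->|ne] := eqVneq (Num.floor s) (Num.floor t); first by rewrite subrr; lra.
have : 1 <= `|(Num.floor s - Num.floor t)%:~R : R|.
  by rewrite -intr_norm ler1z -gtz0_ge1 normr_gt0 subr_eq0.
move=> + e; rewrite -e ler_normr => /orP[]; lra.
Qed.

Lemma compact_circle : compact [set: C].
Proof.
have -> : [set: C] = cproj @` `[0, 1]%classic.
  apply/seteqP; split=> [y _|//]; have /andP[? ?] := cval_itv y.
  by exists (cval y); rewrite ?cprojK//= in_itv/=; apply/andP; split => //; exact: ltW.
apply: continuous_compact; last exact: segment_compact.
exact: continuous_subspaceT continuous_proj.
Qed.

(** Removing two points from the circle disconnects it. *)
Lemma connected_arc (J : set C) r s : connected J -> r <= s <= r + 1 ->
  J (cproj r) -> J (cproj s) ->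
  (forall t, r <= t <= s -> J (cproj t)) \/ (forall t, s <= t <= r + 1 -> J (cproj t)).
Proof.
move=> cJ /andP[rs sr] Jr Js; apply: contrapT => /not_orP[].
move=> /existsNP[t1 /not_implyP[/andP[rt1 t1s] nJ1]].
move=> /existsNP[t2 /not_implyP[/andP[st2 t2r] nJ2]].
have nr1 : t1 != r by apply: contra_notN nJ1 => /eqP ->.
have ns1 : t1 != s by apply: contra_notN nJ1 => /eqP ->.
have ns2 : t2 != s by apply: contra_notN nJ2 => /eqP ->.
have nr2 : t2 != r + 1 by apply: contra_notN nJ2 => /eqP ->; rewrite cprojD1.
have lt1r : r < t1 by rewrite lt_neqAle eq_sym nr1.
have lt1s : t1 < s by rewrite lt_neqAle ns1.
have lt2s : s < t2 by rewrite lt_neqAle eq_sym ns2.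
have lt2r : t2 < r + 1 by rewrite lt_neqAle nr2.
pose A := cproj @` `]t1, t2[%classic; pose B := cproj @` `]t2, t1 + 1[%classic.
have AB0 : A `&` B = set0.
  apply/seteqP; split=> [w|//] [[u /=]]; rewrite in_itv/= => /andP[? ?] <-.
  move=> [v /=]; rewrite in_itv/= => /andP[? ?] uv.
  suff : v = u by lra.
  by apply: (@proj_inj_itv t1) => //; apply/andP; split; lra.
have JAB : J `<=` A `|` B.
  move=> y Jy; have [u /andP[u1 u2] uy] := proj_itv_cover t1 y.
  have nu1 : u != t1 by apply: contra_notN nJ1 => /eqP <-; rewrite uy.
  have nu2 : u != t2 by apply: contra_notN nJ2 => /eqP <-; rewrite uy.
  have lu : t1 < u by rewrite lt_neqAle eq_sym nu1.
  case: (ltgtP u t2) nu2 => // ut _; [left|right]; exists u => //=;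
    by rewrite in_itv/=; apply/andP; split.
have JA : J `&` A !=set0.
  by exists (cproj s); split => //; exists s => //=; rewrite in_itv/=; apply/andP; split.
have : J `&` A = J.
  apply: cJ => //; first by exists A => //; exact: open_proj_itv.
  exists (~` B); first by apply: open_closedC; exact: open_proj_itv.
  apply/seteqP; split=> y [Jy Ay]; split=> //.
    by move=> By; have : (A `&` B) y by []; rewrite AB0.
  by have [|] := JAB _ Jy.
move=> /seteqP[_ /(_ _ Jr)[_ [u /=]]]; rewrite in_itv/= => /andP[? ?].
rewrite -(cprojD1 r) => e; suff : u = r + 1 by lra.
by apply: (@proj_inj_itv t1) => //; apply/andP; split; lra.
Qed.

(** By [connected_arc] the set contains one of the two arcs between the points; the longer one
   contains the antipode of an end point, at distance 1/2, which the hypothesis excludes. *)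
Lemma connected_short_arc (J : set C) r t : connected J ->
  (forall x y, J x -> J y -> mdist x y < 2^-1) -> `|t| <= 2^-1 ->
  J (cproj r) -> J (cproj (r + t)) ->
  forall u, 0 <= u <= 1 -> J (cproj (r + u * t)).
Proof.
move=> cJ sJ; have key a b : a <= b <= a + 2^-1 -> J (cproj a) -> J (cproj b) ->
    forall v, a <= v <= b -> J (cproj v).
  move=> /andP[ab ba] Ja Jb; have ab1 : a <= b <= a + 1 by apply/andP; split; lra.
  have [//|H] := connected_arc cJ ab1 Ja Jb.
  have Jh : J (cproj (a + 2^-1)) by apply: H; apply/andP; split; lra.
  have := sJ _ _ Ja Jh.
  suff -> : mdist (cproj a) (cproj (a + 2^-1)) = 2^-1 by rewrite ltxx.
  apply/le_anti; rewrite mdist_le_half/=.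
  have [s [se <-]] := mdist_proj_lift a (cproj (a + 2^-1)).
  rewrite leNgt ltr_norml; apply/negP => /andP[? ?].
  suff : s = a + 2^-1 by lra.
  by apply: (@proj_inj_itv s) se; apply/andP; split; lra.
rewrite ler_norml => /andP[t1 t2] Jr Jt u /andP[u0 u1].
case: (leP 0 t) => t0.
  apply: (key r (r + t)) => //; apply/andP; split; try lra.
  - by rewrite lerDl mulr_ge0.
  - by rewrite lerD2l ler_piMl.
apply: (key (r + t) r) => //; first by apply/andP; split; lra.
  have ut : t <= u * t by rewrite -{1}(mul1r t) ler_wnM2r// ltW.
  have : u * t <= 0 by rewrite mulr_ge0_le0// ltW.
  by move=> ?; apply/andP; split; lra.
Qed.

Lemma circle_displacement x y : exists t, `|t| = mdist x y /\ y = cproj (cval x + t).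
Proof.
have [s [sy xs]] := mdist_proj_lift (cval x) y.
exists (s - cval x); split; first by rewrite distrC xs cprojK.
by rewrite addrC subrK sy.
Qed.

(** If each set had a point outside the two others, two of these three points would lie on the
   same side of [z], and the arc from [z] to the farther one would contain the nearer one. *)
Lemma connected_three (J : 'I_3 -> set C) z :
  (forall i, connected (J i)) ->
  (forall i x y, J i x -> J i y -> mdist x y < 2^-1) ->
  (forall i, J i z) ->
  exists i, J i `<=` \bigcup_(j in [set j | j != i]) J j.
Proof.
move=> cJ sJ Jz; apply: contrapT => /forallNP H.
have /choice[x xP] : forall i, exists x, J i x /\ forall j, j != i -> ~ J j x.
  move=> i; have /existsNP[x /not_implyP[Jx nx]] := H i.
  by exists x; split=> // j ji Jj; apply: nx; exists j.
have /choice[t tP] : forall i, exists t, `|t| = mdist z (x i) /\ x i = cproj (cval z + t).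
  by move=> i; exact: circle_displacement.
have same i j : i != j -> 0 <= t i * t j -> False.
  wlog tij : i j / `|t i| <= `|t j|.
    move=> W ij; case: (leP `|t i| `|t j|) => h; first exact: W.
    by rewrite mulrC; apply: W; rewrite 1?eq_sym// ltW.
  move=> ij tt; have [xi xiN] := xP i; have [xj xjN] := xP j.
  have [ti xti] := tP i; have [tj xtj] := tP j.
  apply: (xiN j); first by rewrite eq_sym.
  have tj12 : `|t j| <= 2^-1 by rewrite tj mdist_le_half.
  have Jjr : J j (cproj (cval z)) by rewrite cprojK.
  have Jjt : J j (cproj (cval z + t j)) by rewrite -xtj.
  have [u u01 uE] : exists2 u, 0 <= u <= 1 & u * t j = t i.
    have [tj0|tj0] := eqVneq (t j) 0.
      exists 0; first by rewrite lexx ler01.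
      by move: tij; rewrite tj0 normr0 normr_le0 => /eqP ->; rewrite mulr0.
    exists (t i / t j); last by rewrite divfK.
    have d0 : 0 <= t i / t j.
      have -> : t i / t j = (t i * t j) / t j ^+ 2 by field.
      by rewrite divr_ge0// sqr_ge0.
    by rewrite d0/= -[leLHS]ger0_norm// normf_div ler_pdivrMr ?normr_gt0// mul1r.
  by rewrite xti -uE; exact: (connected_short_arc (cJ j) (sJ j)).
have := same 0 1 isT; have := same 0 (inord 2).
have := same 1 (inord 2).
have n1 : (0 : 'I_3) != inord 2 by rewrite -val_eqE/= inordK.
have n2 : (1 : 'I_3) != inord 2 by rewrite -val_eqE/= inordK.
move=> /(_ n2) h12 /(_ n1) h02 h01.
case: (leP 0 (t 0)) => t0; case: (leP 0 (t 1)) => t1; case: (leP 0 (t (inord 2))) => t2.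
all: try by apply: h01; nra.
all: try by apply: h02; nra.
all: by apply: h12; nra.
Qed.

End circle_geometry.

(** * Borel measures on the circle *)

(** A set function that is shown to be a finite measure in the middle of a proof is turned into
   one by [finite_measure_of], whose existential form avoids naming the structure. *)
Section finite_measure_of.
Context {d : measure_display} {T : measurableType d} {R : realType}.
Variable f : set T -> \bar R.
Hypothesis f0 : f set0 = 0%E.
Hypothesis f_ge0 : forall A, (0 <= f A)%E.
Hypothesis f_sigma : semi_sigma_additive f.
Hypothesis f_fin : (f setT < +oo)%E.

Definition measure_fun := f.
Local Notation F := measure_fun.
HB.instance Definition _ := isMeasure.Build d T R F f0 f_ge0 f_sigma.

Let F_fin : fin_num_fun F.
Proof.
move=> A mA; rewrite ge0_fin_numE// (le_lt_trans _ f_fin)//.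
by apply: (@le_measure _ _ _ F); rewrite ?inE.
Qed.

HB.instance Definition _ := Measure_isFinite.Build d T R F F_fin.

Lemma finite_measure_of : exists m : {finite_measure set T -> \bar R}, forall A, m A = f A.
Proof. by exists F. Qed.

End finite_measure_of.

Section finite_measures.
Context {d : measure_display} {T : measurableType d} {R : realType}.

Lemma finite_measureP (m : {measure set T -> \bar R}) : (m setT < +oo)%E ->
  exists m' : {finite_measure set T -> \bar R}, forall A, m' A = m A.
Proof.
by apply: finite_measure_of => //; exact: measure_semi_sigma_additive.
Qed.

Lemma fin_ltT (m : {finite_measure set T -> \bar R}) : (m setT < +oo)%E.
Proof. by rewrite -ge0_fin_numE// fin_num_measure. Qed.

Lemma pushforward_ex {d'} {T' : measurableType d'} (u : T -> T')
    (m : {measure set T -> \bar R}) : measurable_fun setT u -> (m setT < +oo)%E ->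
  exists m' : {finite_measure set T' -> \bar R}, forall A, m' A = m (u @^-1` A).
Proof.
move=> mu mT; apply: finite_measure_of.
- by rewrite preimage_set0 measure0.
- by [].
- move=> F mF tF mUF; rewrite preimage_bigcup.
  apply: measure_semi_sigma_additive.
  + by move=> n; rewrite -[X in measurable X]setTI; exact: mu.
  + apply/trivIsetP => /= i j _ _ ij; rewrite -preimage_setI.
    by move/trivIsetP : tF => /(_ _ _ _ _ ij) ->//; rewrite preimage_set0.
  + by rewrite -preimage_bigcup -[X in measurable X]setTI; exact: mu.
- by rewrite preimage_setT.
Qed.

Lemma measure_sum_ex (I : finType) (c : I -> R)
    (m : I -> {finite_measure set T -> \bar R}) : (forall i, 0 <= c i) ->
  exists m' : {finite_measure set T -> \bar R},
    forall A, m' A = (\sum_i (c i)%:E * m i A)%E.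
Proof.
move=> c0; apply: finite_measure_of.
- by rewrite big1// => i _; rewrite measure0 mule0.
- by move=> A; apply: sume_ge0 => i _; rewrite mule_ge0// lee_fin.
- move=> F mF tF mUF.
  rewrite [X in X @ _ --> _](_ : _ =
      fun n => (\sum_i \sum_(0 <= j < n) (c i)%:E * m i (F j))%E); last first.
    by apply/funext => n; rewrite exchange_big.
  apply: cvg_nnesum => i _.
    by apply: nearW => n; apply: sume_ge0 => j _; rewrite mule_ge0// lee_fin.
  rewrite [X in X @ _ --> _](_ : _ =
      fun n => ((c i)%:E * \sum_(0 <= j < n) m i (F j))%E); last first.
    by apply/funext => n; rewrite ge0_sume_distrr.
  apply: cvgeZl => //; exact: measure_semi_sigma_additive.
- by apply/lte_sum_pinfty => i _; rewrite lte_mul_pinfty ?lee_fin ?fin_ltT.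
Qed.

Lemma measure_series_ex (c : nat -> R) (m : nat -> {finite_measure set T -> \bar R}) :
  (forall n, 0 <= c n) -> (\sum_(0 <= n <oo) (c n)%:E * m n setT < +oo)%E ->
  exists m' : {finite_measure set T -> \bar R},
    forall A, m' A = (\sum_(0 <= n <oo) (c n)%:E * m n A)%E.
Proof.
move=> c0 fin; pose M n : {measure set T -> \bar R} := mscale (NngNum (c0 n)) (m n).
by have [|m' m'E] := @finite_measureP (mseries M 0); [exact: fin|exists m'].
Qed.

End finite_measures.

Section circle_measures.
Variable R : realType.
Local Notation C := (circle R).
Implicit Types (x y : C) (U A B : set C).

Lemma open_measurable_circle U : open U -> measurable U.
Proof. by move=> oU; rewrite measurable_circleE; exact: sub_sigma_algebra. Qed.

Lemma closed_measurable_circle U : closed U -> measurable U.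
Proof.
move=> cU; rewrite -[U]setCK; apply: measurableC.
by apply: open_measurable_circle; exact: closed_openC.
Qed.

Lemma measurable_set1_circle x : measurable [set x].
Proof.
apply: closed_measurable_circle; apply: (@accessible_closed_set1 C).
apply: hausdorff_accessible; exact: metric_hausdorff.
Qed.

Lemma continuous_measurable_circle {d} {T : measurableType d} (f : T -> C) :
  (forall U, open U -> measurable (f @^-1` U)) -> measurable_fun setT f.
Proof.
move=> H; apply: (measurability _ (measurable_circleE R)) => _ [U oU <-].
by rewrite setTI; exact: H.
Qed.

Lemma continuous_measurable_map (f : C -> C) : continuous f -> measurable_fun setT f.
Proof.
move=> cf; apply: continuous_measurable_circle => U oU; apply: open_measurable_circle.
by apply: open_comp => // x _; exact: cf.
Qed.

Lemma continuous_bmf (f : C -> R) : continuous f -> bmf f.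
Proof.
move=> cf; split.
  move=> mD; apply: (measurability _ (RGenOInfty.measurableE R)) => // _ [_ [r ->] <-].
  rewrite setTI; apply: open_measurable_circle.
  by apply: open_comp => //; exact: rray_open.
have := @compact_bounded _ _ _ (continuous_compact (continuous_subspaceT cf) (@compact_circle R)).
move=> /pinfty_ex_gt0[M M0 HM]; exists M => x; apply: HM.
by exists x.
Qed.

Lemma measurable_proj : measurable_fun (setT : set (measurableTypeR R)) (@cproj R).
Proof.
apply: (@continuous_measurable_circle _ (measurableTypeR R)) => U oU.
apply: open_measurable; apply: open_comp => // x _; exact: continuous_proj.
Qed.

Lemma leb_ex : exists m : {finite_measure set C -> \bar R},
  forall A, m A = lebesgue_measure (@cproj R @^-1` A `&` `[0, 1[%classic).
Proof.
have mI : measurable (`[0, 1[%classic : set (measurableTypeR R)) by exact: measurable_itv.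
pose mr : {measure set (measurableTypeR R) -> \bar R} := mrestr (@lebesgue_measure R) mI.
have hfin : (mr setT < +oo)%E.
  by rewrite /= /mrestr setTI lebesgue_measure_itv/= lte_fin ltr01 -EFinB ltry.
have [m mE] := pushforward_ex measurable_proj hfin.
by exists m => A; rewrite mE.
Qed.

Definition leb := projT1 (cid leb_ex).

Lemma lebE A : leb A = lebesgue_measure (@cproj R @^-1` A `&` `[0, 1[%classic).
Proof. by rewrite /leb; case: cid. Qed.

Lemma leb1 x : leb [set x] = 0%E.
Proof.
rewrite lebE (_ : _ `&` _ = [set cval x]) ?lebesgue_measure_set1//.
apply/seteqP; split=> [r [/= <-]|_ /= ->].
  by rewrite in_itv/= => /cval_proj_itv.
by rewrite cprojK in_itv/=; split=> //; exact: cval_itv.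
Qed.

(** The set contains an arc between the two points. If this arc passes through the origin, its
   lift to the unit interval consists of two pieces, and bounding each of them by the measure
   costs the factor 2. *)
Lemma leb_connected (J : set C) x y : measurable J -> connected J -> J x -> J y ->
  mdist x y / 2 <= fine (leb J).
Proof.
move=> mJ; wlog xy : x y / cval x <= cval y.
  move=> W cJ Jx Jy; case: (leP (cval x) (cval y)) => h; first exact: W.
  by rewrite metric_sym; apply: W => //; exact: ltW.
have /andP[x0 x1] := cval_itv x; have /andP[y0 y1] := cval_itv y.
have mI (a b : R) : 0 <= a -> b <= 1 -> a <= b ->
    (forall t, a <= t < b -> J (cproj t)) -> b - a <= fine (leb J).
  move=> a0 b1 ab H; rewrite -lee_fin fineK ?fin_num_measure//.
  rewrite lebE; apply: (@le_trans _ _ (lebesgue_measure `[a, b[%classic)).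
    rewrite lebesgue_measure_itv/= lte_fin; case: ltP => h; rewrite -?EFinB lee_fin//; lra.
  apply: le_measure; rewrite ?inE.
  - exact: measurable_itv.
  - apply: (@measurableI _ (measurableTypeR R)); last exact: measurable_itv.
    by rewrite -[X in measurable X]setTI; exact: measurable_proj.
  - move=> t /=; rewrite in_itv/= => /andP[at_ tb]; split; first by apply: H; rewrite at_.
    by rewrite in_itv/=; apply/andP; split; lra.
move=> cJ Jx Jy.
have := @connected_arc R J (cval x) (cval y) cJ; rewrite xy/= !cprojK.
move=> /(_ ltac:(lra) Jx Jy)[H|H].
  have h := mI _ _ x0 (ltW y1) xy.
  have {}h := h (fun t Ht => H t ltac:(move/andP : Ht => [? ?]; apply/andP; split; lra)).
  apply: le_trans h; rewrite mdist_circleE /arc_dist distrC ger0_norm ?subr_ge0//.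
  have : Num.min (cval y - cval x) (1 - (cval y - cval x)) <= cval y - cval x by rewrite ge_min lexx.
  by move=> ?; lra.
have h1 := mI _ _ y0 (lexx 1) (ltW y1).
have {}h1 := h1 (fun t Ht => H t ltac:(move/andP : Ht => [? ?]; apply/andP; split; lra)).
have h2 := mI _ _ (lexx 0) (ltW x1) x0.
have {}h2 : cval x - 0 <= fine (leb J).
  apply: h2 => t /andP[? ?]; rewrite -cprojD1; apply: H; apply/andP; split; lra.
have : mdist x y <= 1 - (cval y - cval x).
  by rewrite mdist_circleE /arc_dist distrC ger0_norm ?subr_ge0// ge_min lexx orbT.
by move=> ?; lra.
Qed.

Lemma lebT : leb setT = 1%E.
Proof. by rewrite lebE preimage_setT setTI lebesgue_measure_itv/= lte_fin ltr01 -EFinB subr0. Qed.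

Definition shrink U (r : R) : set C := [set x | forall y, mdist x y < r -> U y].

Lemma closed_shrink U r : closed (shrink U r).
Proof.
rewrite -[shrink U r]setCK; apply: open_closedC; apply/open_ballP => x /=.
move=> /existsNP[y /not_implyP[xy nUy]].
exists (r - mdist x y) => [|z xz]; first by rewrite subr_gt0.
move=> Hz; apply: nUy; apply: Hz.
rewrite (le_lt_trans (metric_triangle _ x _))// metric_sym.
by rewrite -ltrBrDr.
Qed.

Lemma shrink_sub U r : 0 < r -> shrink U r `<=` U.
Proof. by move=> r0 x; apply; rewrite mdistxx. Qed.

Lemma shrink_approx (m : {finite_measure set C -> \bar R}) U (e : R) : open U -> 0 < e ->
  exists2 r, 0 < r & fine (m (U `\` shrink U r)) < e.
Proof.
move=> oU e0.
have mU := open_measurable_circle oU.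
have mS r : measurable (shrink U r) by apply: closed_measurable_circle; exact: closed_shrink.
pose u (n : nat) := fine (m (U `\` shrink U n.+1%:R^-1)).
have cu : u n @[n --> \oo] --> (0 : R).
  apply: (@measure_decr_cvg _ _ _ m (fun n => U `\` shrink U n.+1%:R^-1)).
- by move=> n; exact: measurableD.
- move=> n x [Ux nS]; split=> // Sx; apply: nS => y xy; apply: Sx.
  by rewrite (lt_le_trans xy)// lef_pV2 ?posrE// ler_nat.
- rewrite -subset0 => x Hx.
  have Ux : U x by have [] := Hx 0%N I.
  have [r r0 Hr] := (open_ballP U).1 oU x Ux.
  have [n nr] : exists n : nat, n.+1%:R^-1 < r.
    have /cvgrPdist_lt/(_ _ r0)[N _ HN] := @cvg_harmonic R.
    by exists N; have := HN N (leqnn N); rewrite /harmonic/= sub0r normrN gtr0_norm.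
  have [_ nS] := Hx n I.
  by apply: nS => y xy; apply: Hr; exact: lt_trans xy nr.
have /cvgrPdist_lt/(_ _ e0)[N _ HN] := cu.
exists N.+1%:R^-1 => //.
have := HN N (leqnn N); rewrite sub0r normrN ger0_norm//.
by rewrite fine_ge0.
Qed.

(** The sets that are approximated in measure by closed sets from inside and by open sets from
   outside form a sigma-algebra, and it contains the open sets by [shrink_approx]. *)
Lemma outer_regular (m : {finite_measure set C -> \bar R}) A (e : R) : measurable A -> 0 < e ->
  exists U, [/\ open U, A `<=` U & fine (m (U `\` A)) < e].
Proof.
pose reg := [set A : set C | measurable A /\ forall e : R, 0 < e -> exists F U : set C,
  [/\ closed F, open U, F `<=` A, A `<=` U & fine (m (U `\` F)) < e]].
have mD F U : closed F -> open U -> measurable (U `\` F).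
  by move=> cF oU; apply: measurableD; [exact: open_measurable_circle|exact: closed_measurable_circle].
suff H : measurable `<=` reg.
  move=> mA e0; have [_ /(_ e e0)[F [U [cF oU FA AU h]]]] := H _ mA.
  exists U; split => //; apply: le_lt_trans h.
  apply: fine_measure_le; [|exact: mD|exact: setDS].
  by apply: measurableD => //; exact: open_measurable_circle.
rewrite measurable_circleE; apply: smallest_sub; last first.
  move=> U oU; split; first exact: open_measurable_circle.
  move=> {}e e0; have [r r0 hr] := shrink_approx m oU e0.
  by exists (shrink U r), U; split => //; [exact: closed_shrink|exact: shrink_sub].
split.
- split=> // {}e e0; exists set0, set0; split => //; [exact: closed0|by rewrite setD0 measure0].
- move=> {}A [mA H]; rewrite setTD; split; first exact: measurableC.
  move=> {}e e0; have [F [U [cF oU FA AU h]]] := H e e0.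
  exists (~` U), (~` F); split; [exact: open_closedC|exact: closed_openC|exact: subsetC|exact: subsetC|].
  by rewrite setDE setCK setIC -setDE.
move=> F H; have mF n : measurable (F n) by have [] := H n.
split; first exact: bigcup_measurable.
move=> {}e e0.
pose eps n : R := e / 2 / (2 ^ n.+1)%:R.
have eps0 n : 0 < eps n by rewrite !divr_gt0// ltr0n expn_gt0.
have /choice[K /choice[U KU]] : forall n, exists K U,
  [/\ closed (K : set C), open (U : set C), K `<=` F n, F n `<=` U & fine (m (U `\` K)) < eps n].
  by move=> n; have [_ /(_ _ (eps0 n))] := H n.
have mK n : measurable (K n) by have [? _ _ _ _] := KU n; exact: closed_measurable_circle.
have oU n : open (U n) by have [] := KU n.
have mU n : measurable (U n) by exact: open_measurable_circle.
pose KK N := \big[setU/set0]_(n < N) K n.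
have mKK N : measurable (KK N) by apply: bigsetU_measurable.
have mUU : measurable (\bigcup_n U n) by exact: bigcup_measurable.
have mKoo : measurable (\bigcup_n K n) by exact: bigcup_measurable.
have c0 := @measure_decr_cvg _ _ _ m (fun N => (\bigcup_n K n) `\` KK N).
have {}c0 : fine (m ((\bigcup_n K n) `\` KK n)) @[n --> \oo] --> (0 : R).
  apply: c0.
  - by move=> n; exact: measurableD.
  - by move=> n x [Kx nx]; split=> // Kn; apply: nx; rewrite /KK big_ord_recr/=; left.
  - rewrite -subset0 => x Hx; have [[n _ Kx] _] := Hx 0%N I.
    by have [_] := Hx n.+1 I; apply; rewrite /KK big_ord_recr/=; right.
have e2 : 0 < e / 2 by rewrite divr_gt0.
have /cvgrPdist_lt/(_ _ e2)[N _ HN] := c0.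
exists (KK N), (\bigcup_n U n); split.
- by apply: closed_bigsetU => n _; have [] := KU n.
- exact: bigcup_open.
- by move=> x; rewrite /KK -bigcup_mkord => -[n _ Kx]; have [_ _ KF _ _] := KU n; exists n => //; exact: KF.
- by apply: subset_bigcup => n _; have [] := KU n.
have := HN N (leqnn N); rewrite sub0r normrN ger0_norm ?fine_ge0// => hN.
have hD : fine (m ((\bigcup_n U n) `\` (\bigcup_n K n))) <= e / 2.
  rewrite -lee_fin fineK ?fin_num_measure//; last exact: measurableD.
  apply: (@le_trans _ _ (m (\bigcup_n (U n `\` K n)))).
    apply: le_measure; rewrite ?inE.
    - exact: measurableD.
    - by apply: bigcup_measurable => n _; exact: measurableD.
    - by move=> x [[n _ Ux] nK]; exists n => //; split=> // Kx; apply: nK; exists n.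
  have mUK n : measurable (U n `\` K n) by exact: measurableD.
  apply: (le_trans (measure_sigma_subadditive _ mUK _ (@subset_refl _ _))).
    by apply: bigcup_measurable => n _.
  apply: (@le_trans _ _ (\sum_(0 <= n <oo) (e / 2 / (2 ^ n.+1)%:R)%:E)%E).
    apply: lee_nneseries => n _ //.
    by have [_ _ _ _ /ltW] := KU n; rewrite -lee_fin fineK ?fin_num_measure.
  by rewrite epsilon_trick0// ltW.
have mUD : measurable ((\bigcup_n U n) `\` (\bigcup_n K n)) by exact: measurableD.
have mKD : measurable ((\bigcup_n K n) `\` KK N) by exact: measurableD.
apply: (@le_lt_trans _ _ (fine (m (((\bigcup_n U n) `\` (\bigcup_n K n)) `|` ((\bigcup_n K n) `\` KK N))))).
  apply: fine_measure_le; [exact: measurableD|exact: measurableU|].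
  move=> x [Ux nK]; have [Kx|nKx] := pselect ((\bigcup_n K n) x); [by right|by left].
by apply: le_lt_trans (fine_measureU_le _ mUD mKD) _; rewrite (splitr e) ler_ltD.
Qed.

End circle_measures.

(** * Expectation along random words *)

Section staircase.
Context {d : measure_display} {T : measurableType d} {R : realType}.
Implicit Types (f h : T -> R).

(* the largest multiple of [e] below [t], truncated at [n * e] *)
Let stair (e t : R) (n : nat) : R := \sum_(j < n) e * ((j.+1%:R * e <= t)%R : nat)%:R.

Let stair_bound (e t : R) n : 0 < e -> 0 <= t ->
  stair e t n <= t /\ (t < stair e t n + e \/ stair e t n = n%:R * e).
Proof.
move=> e0 t0; elim: n => [|n [IH1 IH2]].
  by rewrite /stair big_ord0; split=> //; right; rewrite mul0r.
rewrite {1 2 3}/stair big_ord_recr/= -/(stair e t n).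
case: (leP (n.+1%:R * e) t) => h; rewrite ?mulr1 ?mulr0 ?addr0.
  have -> : stair e t n = n%:R * e.
    case: IH2 => // h2; exfalso; have : stair e t n <= n%:R * e.
      rewrite /stair -[n in leRHS]card_ord -sumr_const mulr_suml.
      by apply: ler_sum => j _; rewrite mul1r; case: (_ <= t); rewrite ?mulr1 ?mulr0// ltW.
    by move: h; rewrite -natr1; lra.
  by move: h; rewrite -natr1 => h; split; [lra|right; lra].
split=> //; left; case: IH2 => // ->; move: h; rewrite -natr1; lra.
Qed.

Lemma bmf_staircase f (e : R) : bmf f -> 0 < e -> exists (n : nat) (c : R) (A : nat -> set T),
  (forall j, measurable (A j)) /\
  forall x, `|f x - (c + \sum_(j < n) e * \1_(A j) x)| <= e.
Proof.
move=> [mf [M fM]] e0.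
pose A j := [set x | - M + j.+1%:R * e <= f x].
have [n nM] : exists n : nat, 2 * M <= n%:R * e.
  exists (Num.bound `|2 * M / e|); rewrite -ler_pdivrMr//.
  by rewrite (le_trans (ler_norm _))// ltW// archi_boundP.
exists n, (- M), A; split.
  by move=> j; exact: measurable_superlevel.
move=> x; have := fM x; rewrite ler_norml => /andP[f1 f2].
have [|s1 s2] := @stair_bound e (f x + M) n e0; first by lra.
rewrite (_ : \sum_(j < n) e * \1_(A j) x = stair e (f x + M) n); last first.
  rewrite /stair; apply: eq_bigr => j _; rewrite indicE; congr (_ * (nat_of_bool _)%:R).
  by apply/idP/idP; rewrite inE /A/= => ?; lra.
rewrite ler_norml; apply/andP; split; first lra.
case: s2 => s2; first lra.
by rewrite s2; lra.
Qed.

(** Bounded measurable functions are uniform limits of step functions; so every change of variables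
   or of measure has to be checked on indicators only. *)
Lemma int_unique (m : {finite_measure set T -> \bar R}) (L : (T -> R) -> R) (K : R) :
  (forall f h, bmf f -> bmf h -> L (fun x => f x + h x) = L f + L h) ->
  (forall c f, bmf f -> L (fun x => c * f x) = c * L f) ->
  (forall f (e : R), bmf f -> (forall x, `|f x| <= e) -> `|L f| <= K * e) ->
  (forall A, measurable A -> L \1_A = fine (m A)) ->
  forall f, bmf f -> L f = \int[m]_x f x.
Proof.
move=> LD LZ LK LA f bf; apply/eqP; rewrite -subr_eq0 -normr_le0; apply/ler_addgt0Pl => e e0.
pose K' := `|K| + fine (m setT) + 1.
have m0 : 0 <= fine (m setT) by rewrite fine_ge0.
have K'0 : 0 < K' by rewrite /K'; have := normr_ge0 K; lra.
pose e' := e / K'; have e'0 : 0 < e' by rewrite divr_gt0.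
have [n [c [A [mA fA]]]] := bmf_staircase bf e'0.
pose s x := c + \sum_(j < n) e' * \1_(A j) x.
have bA j : bmf (fun x => e' * \1_(A j) x : R) by apply: bmfZ; exact: bmf_indic.
have bS (r : seq 'I_n) : bmf (fun x => \sum_(j <- r) e' * \1_(A j) x : R) by exact: bmf_sum.
have bs : bmf s by apply: bmfD; [exact: bmf_cst|exact: bS].
have L1 c' : L (fun=> c') = c' * fine (m setT).
  have -> : (fun=> c') = (fun x => c' * \1_(setT : set T) x :> R).
    by apply/funext => x; rewrite indicT mulr1.
  by rewrite LZ ?LA//; exact: bmf_indic.
have LS (r : seq 'I_n) : L (fun x => \sum_(j <- r) e' * \1_(A j) x) = \sum_(j <- r) e' * fine (m (A j)).
  elim: r => [|j r IH].
    by rewrite big_nil; under eq_fun do rewrite big_nil; rewrite L1 mul0r.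
  rewrite big_cons; under eq_fun do rewrite big_cons.
  by rewrite LD// IH LZ ?LA//; exact: bmf_indic.
have Ls : L s = \int[m]_x s x.
  rewrite /s LD//; last exact: bmf_cst.
  rewrite intD//; last exact: bmf_cst.
  rewrite L1 int_cst// LS int_sum//; congr (_ + _); apply: eq_bigr => j _.
  by rewrite intZ ?int_indic//; exact: bmf_indic.
have -> : L f - \int[m]_x f x = L (fun x => f x - s x) - \int[m]_x (f x - s x).
  rewrite intB// -Ls; have -> : L f = L (fun x => (f x - s x) + s x).
    by congr L; apply/funext => x; rewrite subrK.
  by rewrite LD//; [lra|exact: bmfB].
rewrite addr0 (le_trans (ler_normB _ _))//.
have h1 : `|L (fun x => f x - s x)| <= `|K| * e'.
  apply: le_trans (LK _ e' _ _) _ => //; first exact: bmfB.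
  by apply: ler_wpM2r; [exact: ltW|exact: ler_norm].
have h2 : `|\int[m]_x (f x - s x)| <= e' * fine (m setT).
  rewrite (le_trans (int_norm _ _ _))//; first exact: bmfB.
  rewrite -int_cst//; apply: int_le; [by []| |exact: bmf_cst|by move=> x _; exact: fA].
  by apply: bmf_norm; exact: bmfB.
have : e' * K' = e by rewrite /e' divfK// gt_eqF.
rewrite /K' => {LK}; nra.
Qed.

End staircase.

Section words.
Context {R : realType} {I : finType}.
Variable p : I -> R.
Hypothesis p_ge0 : forall i, 0 <= p i.
Hypothesis p_sum1 : \sum_i p i = 1.
Implicit Types (F G : seq I -> R) (v w : seq I).

(** The recursion on the first letter follows the action of words; [Ew_tuple] is the closed form. *)
Fixpoint Ew (n : nat) F : R :=
  if n is m.+1 then \sum_i p i * Ew m (fun v => F (i :: v)) else F [::].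

Lemma eq_Ew n F G : (forall v, size v = n -> F v = G v) -> Ew n F = Ew n G.
Proof.
elim: n F G => [|n IH] F G FG /=; first exact: FG.
by apply: eq_bigr => i _; congr (_ * _); apply: IH => v sv; apply: FG; rewrite /= sv.
Qed.

Lemma Ew_le n F G : (forall v, size v = n -> F v <= G v) -> Ew n F <= Ew n G.
Proof.
elim: n F G => [|n IH] F G FG /=; first exact: FG.
by apply: ler_sum => i _; rewrite ler_wpM2l// IH// => v sv; apply: FG; rewrite /= sv.
Qed.

Lemma Ew_cst n c : Ew n (fun=> c) = c.
Proof.
by elim: n => [//|n IH] /=; under eq_bigr do rewrite IH; rewrite -mulr_suml p_sum1 mul1r.
Qed.

Lemma EwD n F G : Ew n (fun v => F v + G v) = Ew n F + Ew n G.
Proof.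
elim: n F G => [//|n IH] F G /=; rewrite -big_split/=.
by apply: eq_bigr => i _; rewrite IH mulrDr.
Qed.

Lemma EwZ n c F : Ew n (fun v => c * F v) = c * Ew n F.
Proof.
elim: n F => [//|n IH] F /=; rewrite mulr_sumr.
by apply: eq_bigr => i _; rewrite IH mulrCA.
Qed.

Lemma EwB n F G : Ew n (fun v => F v - G v) = Ew n F - Ew n G.
Proof.
rewrite EwD -[in RHS]mulN1r -EwZ; congr (_ + _).
by apply: eq_Ew => v _; rewrite mulN1r.
Qed.

Lemma Ew_ge0 n F : (forall v, size v = n -> 0 <= F v) -> 0 <= Ew n F.
Proof. by move=> F0; rewrite -(Ew_cst n 0); exact: Ew_le. Qed.

Lemma Ew_norm n F : `|Ew n F| <= Ew n (fun v => `|F v|).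
Proof.
rewrite ler_norml; apply/andP; split.
  rewrite -[leLHS]mulN1r -EwZ; apply: Ew_le => v _.
  by rewrite mulN1r lerNl -normrN ler_norm.
by apply: Ew_le => v _; exact: ler_norm.
Qed.

Lemma Ew_sum n (J : Type) (s : seq J) (F : J -> seq I -> R) :
  Ew n (fun v => \sum_(j <- s) F j v) = \sum_(j <- s) Ew n (F j).
Proof.
elim: s => [|j s IH]; first by under eq_fun do rewrite big_nil; rewrite Ew_cst big_nil.
by under eq_fun do rewrite big_cons; rewrite EwD IH big_cons.
Qed.

Lemma Ew_cat m n F : Ew (m + n) F = Ew m (fun u => Ew n (fun v => F (u ++ v))).
Proof. by elim: m F => [//|m IH] F /=; apply: eq_bigr => i _; rewrite IH. Qed.

Lemma Ew_rcons n F : Ew n.+1 F = Ew n (fun v => \sum_i p i * F (rcons v i)).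
Proof.
rewrite -addn1 Ew_cat; apply: eq_Ew => v _ /=.
by apply: eq_bigr => i _; rewrite cats1.
Qed.

Definition pw v : R := \prod_(i <- v) p i.

Lemma pw_ge0 v : 0 <= pw v.
Proof. exact: prodr_ge0. Qed.

Lemma Ew_word w F : (forall v, 0 <= F v) -> pw w * F w <= Ew (size w) F.
Proof.
elim: w F => [|i w IH] F F0 /=; first by rewrite /pw big_nil mul1r.
rewrite /pw big_cons -/(pw w) (bigD1 i)//= -mulrA.
rewrite (le_trans (ler_wpM2l (p_ge0 i) (IH (fun v => F (i :: v)) _)))// lerDl.
by apply: sumr_ge0 => j _; rewrite mulr_ge0// Ew_ge0.
Qed.

Lemma Ew_tuple n F : Ew n F = \sum_(t : n.-tuple I) pw t * F t.
Proof.
elim: n F => [|n IH] F /=.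
  rewrite (big_pred1 [tuple])/=; first by rewrite /pw big_nil mul1r.
  by move=> t /=; apply/esym/eqP; exact: tuple0.
rewrite (reindex (fun x : I * n.-tuple I => [tuple of x.1 :: x.2]))/=; last first.
  exists (fun t : n.+1.-tuple I => (thead t, [tuple of behead t])) => [[i t] _|t _] /=.
    by rewrite theadE; congr pair; apply: val_inj.
  by rewrite [RHS]tuple_eta.
rewrite -(pair_bigA _ (fun i (t : n.-tuple I) => pw (i :: t) * F (i :: t)))/=.
apply: eq_bigr => i _; rewrite IH mulr_sumr.
by apply: eq_bigr => t _; rewrite /pw big_cons mulrA.
Qed.

Lemma pw_sum1 n : \sum_(t : n.-tuple I) pw t = 1.
Proof.
rewrite -(Ew_cst n 1) Ew_tuple; by apply: eq_bigr => t _; rewrite mulr1.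
Qed.

Section action.
Variables (T : Type) (g : I -> T -> T).

(** The first letter of the word acts first. *)
Definition gw v (x : T) : T := foldl (fun y i => g i y) x v.

Lemma gw_cat u v x : gw (u ++ v) x = gw v (gw u x).
Proof. by rewrite /gw foldl_cat. Qed.

Lemma gw_rcons v i x : gw (rcons v i) x = g i (gw v x).
Proof. by rewrite -cats1 gw_cat. Qed.

Definition Uop (f : T -> R) (x : T) : R := \sum_i p i * f (g i x).

Lemma iter_Uop n f x : iter n Uop f x = Ew n (fun v => f (gw v x)).
Proof.
elim: n f x => [//|n IH] f x.
by rewrite iterS /= /Uop; apply: eq_bigr => i _; rewrite IH.
Qed.

Lemma UopD f h : Uop (fun x => f x + h x) = fun x => Uop f x + Uop h x.
Proof. by apply/funext => x; rewrite /Uop -big_split/=; apply: eq_bigr => i _; rewrite mulrDr. Qed.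

Lemma UopZ c f : Uop (fun x => c * f x) = fun x => c * Uop f x.
Proof. by apply/funext => x; rewrite /Uop mulr_sumr; apply: eq_bigr => i _; rewrite mulrCA. Qed.

Lemma UopB f h : Uop (fun x => f x - h x) = fun x => Uop f x - Uop h x.
Proof.
by apply/funext => x; rewrite /Uop -sumrB; apply: eq_bigr => i _; rewrite mulrBr.
Qed.

Lemma Uop_bound f M : (forall x, `|f x| <= M) -> forall x, `|Uop f x| <= M.
Proof.
move=> fM x; rewrite (le_trans (ler_norm_sum _ _ _))//.
rewrite (@le_trans _ _ (\sum_i p i * M))//; last by rewrite -mulr_suml p_sum1 mul1r.
by apply: ler_sum => i _; rewrite normrM ger0_norm// ler_wpM2l.
Qed.

End action.
End words.

Lemma bmf_Ew {d : measure_display} {T : measurableType d} {R : realType} {I : finType}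
    (p : I -> R) n (F : seq I -> T -> R) :
  (forall v, bmf (F v)) -> bmf (fun x => Ew p n (fun v => F v x)).
Proof.
elim: n F => [|n IH] F bF /=; first exact: bF.
by apply: bmf_sum => i; apply: bmfZ; apply: IH.
Qed.

Lemma int_Ew {d : measure_display} {T : measurableType d} {R : realType} {I : finType}
    (p : I -> R) (m : {finite_measure set T -> \bar R}) n (F : seq I -> T -> R) :
  (forall v, bmf (F v)) ->
  \int[m]_x Ew p n (fun v => F v x) = Ew p n (fun v => \int[m]_x F v x).
Proof.
elim: n F => [//|n IH] F bF /=; rewrite int_sum//; last first.
  by move=> i; apply: bmfZ; exact: bmf_Ew.
by apply: eq_bigr => i _; rewrite intZ ?IH//; exact: bmf_Ew.
Qed.

Section stationary.
Context {d : measure_display} {T : measurableType d} {R : realType} {I : finType}.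
Variables (p : I -> R) (g : I -> T -> T) (mu : probability T R).
Hypothesis p_ge0 : forall i, 0 <= p i.
Hypothesis p_sum1 : \sum_i p i = 1.
Hypothesis mg : forall i, measurable_fun setT (g i).
Hypothesis mu_inv : forall A, measurable A ->
  \sum_i p i * fine (mu (g i @^-1` A)) = fine (mu A).

Lemma probT1 : fine (mu setT) = 1.
Proof. by rewrite probability_setT. Qed.

Lemma mgw v : measurable_fun setT (gw g v).
Proof.
elim: v => [|i v IH]; first exact: measurable_id.
by apply: (measurableT_comp IH); exact: mg.
Qed.

Lemma bmf_Uop f : bmf f -> bmf (Uop p g f).
Proof. by move=> bf; apply: bmf_sum => i; apply: bmfZ; apply: bmf_comp (mg i) bf. Qed.

Lemma int_Uop f : bmf f -> \int[mu]_x Uop p g f x = \int[mu]_x f x.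
Proof.
apply: (@int_unique _ _ _ mu (fun f => \int[mu]_x Uop p g f x) 1).
- by move=> {}f h bf bh; rewrite UopD intD//; exact: bmf_Uop.
- by move=> c {}f bf; rewrite UopZ intZ//; exact: bmf_Uop.
- move=> {}f e bf fe; rewrite mul1r (le_trans (int_norm _ _ _))//; first exact: bmf_Uop.
  apply: (@le_trans _ _ (\int[mu]_x e)); last by rewrite int_cst// probT1 mulr1.
  apply: int_le => //; [by apply: bmf_norm; exact: bmf_Uop|exact: bmf_cst|].
  by move=> x _; exact: Uop_bound.
- move=> A mA; rewrite -mu_inv// /Uop int_sum//; last first.
    by move=> i; apply: bmfZ; apply: bmf_comp (mg i) _; exact: bmf_indic.
  apply: eq_bigr => i _; rewrite intZ//; last by apply: bmf_comp (mg i) _; exact: bmf_indic.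
  rewrite -int_indic//; last by rewrite -[X in measurable X]setTI; exact: mg.
Qed.

Lemma int_iter_Uop n f : bmf f -> \int[mu]_x iter n (Uop p g) f x = \int[mu]_x f x.
Proof.
move=> bf; have bn m : bmf (iter m (Uop p g) f) by elim: m => [//|m IH]; exact: bmf_Uop.
by elim: n => [//|n IH]; rewrite iterS int_Uop.
Qed.

End stationary.

(** * The Hellinger affinity of the stationary measure with its images *)

Lemma indic_pre {T T' : Type} {R : realType} (f : T -> T') (A : set T') x :
  \1_(f @^-1` A) x = \1_A (f x) :> R.
Proof. by []. Qed.

Lemma cvgn_sum {R : realType} (J : Type) (s : seq J) (F : J -> nat -> R) (l : J -> R) :
  (forall j, F j n @[n --> \oo] --> l j) ->
  \sum_(j <- s) F j n @[n --> \oo] --> \sum_(j <- s) l j.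
Proof.
move=> H; elim: s => [|j s IH].
  by rewrite big_nil; under eq_fun do rewrite big_nil; exact: cvg_cst.
by rewrite big_cons; under eq_fun do rewrite big_cons; exact: cvgD.
Qed.

Section densities.
Context {d : measure_display} {T : measurableType d} {R : realType}.
Implicit Types (m nu mu : {finite_measure set T -> \bar R}).

Lemma null_gt m (f : T -> R) (c : R) : m.-integrable setT (EFin \o f) ->
  (forall A, measurable A -> \int[m]_(x in A) f x <= c * fine (m A)) ->
  m [set x | c < f x] = 0%E.
Proof.
move=> intf H; have mf : measurable_fun setT f.
  by apply/measurable_EFinP; exact: measurable_int intf.
pose A (n : nat) := [set x | c + n.+1%:R^-1 <= f x].
have mA n : measurable (A n).
  exact: measurable_superlevel.
have A0 n : m (A n) = 0%E.
  apply/eqP; rewrite -(@fineK _ (m (A n))) ?fin_num_measure// eqe.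
  have h : \int[m]_(x in A n) (c + n.+1%:R^-1) <= \int[m]_(x in A n) f x.
    apply: le_Rintegral => //.
    - exact: (bmf_integrable m (mA n) (bmf_cst _)).
    - exact: integrableS intf.
  rewrite int_cst// in h; have {h} := le_trans h (H _ (mA n)).
  have n0 : 0 < n.+1%:R^-1 :> R by [].
  rewrite mulrDl gerDl pmulr_rle0// => h.
  by rewrite eq_le h fine_ge0.
apply: (@subset_measure0 _ _ _ m _ (\bigcup_n A n)).
- exact: measurable_strict_superlevel.
- exact: bigcup_measurable.
- move=> x /= cx; have fc : 0 < f x - c by rewrite subr_gt0.
  have /cvgrPdist_lt/(_ _ fc)[N _ HN] := @cvg_harmonic R.
  exists N => //; rewrite /A/=; have := HN N (leqnn N).
  by rewrite /harmonic/= sub0r normrN gtr0_norm// => h; rewrite -lerBrDl ltW.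
- apply/eqP; rewrite eq_le measure_ge0 andbT.
  apply: (le_trans (measure_sigma_subadditive _ mA _ (@subset_refl _ _))).
    exact: bigcup_measurable.
  by rewrite eseries0// => n _ _; exact: A0.
Qed.

(** The Radon-Nikodym density exceeds 1 / c only on a null set, on which it is replaced by 0. *)
Lemma density_bounded nu mu (c : R) : 0 < c ->
  (forall A, measurable A -> c * fine (nu A) <= fine (mu A)) ->
  exists J : T -> R, [/\ bmf J, forall x, 0 <= J x &
    forall A, measurable A -> \int[mu]_(x in A) J x = fine (nu A)].
Proof.
move=> c0 H.
have numu : nu `<< mu.
  apply/null_content_dominatesP => A mA muA0.
  apply/eqP; rewrite -(@fineK _ (nu A)) ?fin_num_measure// eqe eq_le fine_ge0// andbT.
  by have := H _ mA; rewrite muA0/= pmulr_rle0.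
pose j x := fine (Radon_Nikodym_SigmaFinite.f nu mu x).
have jE x : (j x)%:E = Radon_Nikodym_SigmaFinite.f nu mu x.
  by rewrite fineK//; exact: Radon_Nikodym_SigmaFinite.f_fin_num.
have j0 x : 0 <= j x by rewrite fine_ge0//; exact: Radon_Nikodym_SigmaFinite.f_ge0.
have ij : mu.-integrable setT (EFin \o j).
  rewrite (_ : EFin \o j = Radon_Nikodym_SigmaFinite.f nu mu).
    exact: Radon_Nikodym_SigmaFinite.f_integrable.
  by apply/funext => x /=; rewrite jE.
have jI A : measurable A -> \int[mu]_(x in A) j x = fine (nu A).
  move=> mA; rewrite /Rintegral (Radon_Nikodym_SigmaFinite.f_integral numu mA).
  by congr fine; apply: eq_integral => x _; rewrite jE.
have mj : measurable_fun setT j by apply/measurable_EFinP; exact: measurable_int ij.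
have nE : mu [set x | c^-1 < j x] = 0%E.
  apply: null_gt => // A mA; rewrite jI// -(ler_pM2l c0) mulrA divff ?gt_eqF// mul1r.
  exact: H.
pose E := [set x | j x <= c^-1].
have mE : measurable E by exact: measurable_sublevel.
have EC : [set x | c^-1 < j x] = ~` E by exact: superlevelE.
exists (fun x => j x * \1_E x); split.
- split; first by apply: measurable_funM => //; exact: measurable_indic.
  exists c^-1 => x; rewrite indicE; case: (boolP (x \in E)) => xE; rewrite ?mulr1 ?mulr0 ?normr0.
    by rewrite ger0_norm//; move: xE; rewrite inE.
  by rewrite invr_ge0 ltW.
- by move=> x; rewrite mulr_ge0.
move=> A mA; rewrite Rintegral_mkcond.
have -> : (fun x => j x * \1_E x) \_ A = j \_ (A `&` E).
  apply/funext => x; rewrite !patchE in_setI indicE.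
  by case: (x \in A); case: (x \in E) => //=; rewrite ?mulr1 ?mulr0.
rewrite -Rintegral_mkcond jI; last exact: measurableI.
rewrite (fine_measure_split nu mA mE).
suff -> : fine (nu (A `\` E)) = 0 by rewrite addr0.
apply/eqP; rewrite eq_le fine_ge0// andbT -(pmulr_rle0 _ c0).
rewrite (le_trans (H _ _))//; first exact: measurableD.
have -> : 0 = fine (mu (~` E)) by rewrite -EC nE.
apply: fine_measure_le; [exact: measurableD|exact: measurableC|].
by move=> x [].
Qed.

Lemma density_measure mu (f : T -> R) : bmf f -> (forall x, 0 <= f x) ->
  exists m' : {finite_measure set T -> \bar R},
    forall A, measurable A -> fine (m' A) = \int[mu]_(x in A) f x.
Proof.
move=> bf f0.
have [||||m' m'E] := @finite_measure_of _ T R (fun A => (\int[mu]_(x in A) (f x)%:E)%E).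
- by rewrite integral_set0.
- by move=> A; apply: integral_ge0 => x _; rewrite lee_fin.
- move=> A mA tA mUA; rewrite integral_bigcup//=; last exact: bmf_integrable.
  apply: is_cvg_ereal_nneg_natsum_cond => n _ _.
  by apply: integral_ge0 => x _; rewrite lee_fin.
- by rewrite -EFin_int// ltry.
by exists m' => A mA; rewrite m'E.
Qed.

End densities.

Section square_integrals.
Context {d : measure_display} {T : measurableType d} {R : realType}.
Variable m : {finite_measure set T -> \bar R}.

(** The inequality 2 |f| <= f^2 / t + t for every t > 0. *)
Lemma int_sqr0 (f : T -> R) : bmf f -> \int[m]_x f x ^+ 2 = 0 -> \int[m]_x `|f x| = 0.
Proof.
move=> bf f20; apply/eqP; rewrite eq_le int_ge0 ?andbT//.
apply/ler_addgt0Pl => e e0; rewrite addr0.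
pose K := fine (m setT) + 1.
have mT0 : 0 <= fine (m setT) by rewrite fine_ge0.
have K0 : 0 < K by rewrite /K; lra.
pose t := e / K; have t0 : 0 < t by rewrite divr_gt0.
have bf2 : bmf (fun x => (2 * t)^-1 * f x ^+ 2) by apply: bmfZ; exact: bmfM.
apply: (@le_trans _ _ (\int[m]_x ((2 * t)^-1 * f x ^+ 2 + t / 2))).
  apply: int_le; [by []|exact: bmf_norm|by apply: bmfD => //; exact: bmf_cst|].
  move=> x _; rewrite -real_normK ?num_real//; set a := `|f x|.
  have -> : (2 * t)^-1 * a ^+ 2 + t / 2 = a + (2 * t)^-1 * (a - t) ^+ 2.
    by field; rewrite gt_eqF.
  by rewrite lerDl mulr_ge0 ?sqr_ge0// invr_ge0 mulr_ge0// ltW.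
rewrite intD//; last exact: bmf_cst.
rewrite intZ//; last exact: bmfM.
rewrite f20 mulr0 add0r int_cst//.
have : t * K = e by rewrite divfK// gt_eqF.
rewrite /K; nra.
Qed.

Lemma int_sqr_eq (a b : T -> R) A : bmf a -> bmf b -> measurable A ->
  \int[m]_x (a x - b x) ^+ 2 = 0 -> \int[m]_(x in A) a x ^+ 2 = \int[m]_(x in A) b x ^+ 2.
Proof.
move=> ba bb mA /(int_sqr0 (bmfB ba bb)) ab0.
have [_ [M aM]] := ba; have [_ [N bN]] := bb.
apply/eqP; rewrite -subr_eq0 -normr_le0 -intB//; [|exact: bmfM|exact: bmfM].
have b2 : bmf (fun x => a x ^+ 2 - b x ^+ 2) by apply: bmfB; exact: bmfM.
have bab : bmf (fun x => (M + N) * `|a x - b x|) by apply: bmfZ; apply: bmf_norm; exact: bmfB.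
rewrite (le_trans (int_norm _ _ _))//.
apply: (@le_trans _ _ (\int[m]_x ((M + N) * `|a x - b x|))).
  rewrite -(int_indicM m _ mA); apply: int_le => //.
    by apply: bmfM; [exact: bmf_norm|exact: bmf_indic].
  move=> x _; rewrite subr_sqr normrM mulrC indicE.
  have : `|a x + b x| <= M + N by rewrite (le_trans (ler_normD _ _))// lerD.
  have := normr_ge0 (a x - b x); have := normr_ge0 (a x + b x).
  by case: (x \in A); rewrite ?mul1r ?mul0r => ? ? ?; nra.
rewrite intZ//; last by apply: bmf_norm; exact: bmfB.
by rewrite ab0 mulr0.
Qed.

End square_integrals.

Section affinity.
Context {d : measure_display} {T : measurableType d} {R : realType} {I : finType}.
Variables (p : I -> R) (g ginv : I -> T -> T) (mu : probability T R).
Hypothesis p_gt0 : forall i, 0 < p i.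
Hypothesis p_sum1 : \sum_i p i = 1.
Hypothesis mg : forall i, measurable_fun setT (g i).
Hypothesis mginv : forall i, measurable_fun setT (ginv i).
Hypothesis gK : forall i, cancel (g i) (ginv i).
Hypothesis ginvK : forall i, cancel (ginv i) (g i).
Hypothesis mu_inv : forall A, measurable A ->
  \sum_i p i * fine (mu (g i @^-1` A)) = fine (mu A).

Let p_ge0 i : 0 <= p i. Proof. exact: ltW. Qed.

Let mpre i A : measurable A -> measurable (g i @^-1` A).
Proof. by move=> mA; rewrite -[X in measurable X]setTI; exact: mg. Qed.

Let mpreinv i A : measurable A -> measurable (ginv i @^-1` A).
Proof. by move=> mA; rewrite -[X in measurable X]setTI; exact: mginv. Qed.

(** Stationarity bounds the image of [mu] by [g i] by [mu] / p_i, hence it has a bounded density,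
   and shows that the mean density is at most 1 almost everywhere; cutting the densities off on a
   null set gives the bound everywhere. *)
Lemma image_densities : exists J : I -> T -> R,
  [/\ forall i, bmf (J i), forall i x, 0 <= J i x,
      forall x, \sum_i p i * J i x <= 1 &
      forall i A, measurable A -> \int[mu]_(x in A) J i x = fine (mu (g i @^-1` A))].
Proof.
have /choice[nu nuE] : forall i, exists nu : {finite_measure set T -> \bar R},
    forall A, nu A = mu (g i @^-1` A).
  by move=> i; exact: (pushforward_ex (mg i) (fin_ltT mu)).
have /choice[j jP] : forall i, exists J : T -> R, [/\ bmf J, forall x, 0 <= J x &
    forall A, measurable A -> \int[mu]_(x in A) J x = fine (nu i A)].
  move=> i; apply: density_bounded (p_gt0 i) _ => A mA; rewrite nuE -(mu_inv mA).
  rewrite (bigD1 i)//= lerDl; apply: sumr_ge0 => k _.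
  by rewrite mulr_ge0// fine_ge0.
have bj i : bmf (j i) by have [] := jP i.
have j0 i x : 0 <= j i x by have [_ + _] := jP i; apply.
have jI i A : measurable A -> \int[mu]_(x in A) j i x = fine (nu i A).
  by have [_ _ +] := jP i; apply.
pose D x := \sum_i p i * j i x.
have bD : bmf D by apply: bmf_sum => i; exact: bmfZ.
have nD : mu [set x | 1 < D x] = 0%E.
  apply: null_gt => [|A mA]; first exact: bmf_integrable.
  rewrite mul1r int_sum//; last by move=> i; exact: bmfZ.
  rewrite -(mu_inv mA); apply: ler_sum => i _.
  by rewrite intZ// jI// nuE.
pose E := [set x | D x <= 1].
have mE : measurable E by apply: measurable_sublevel; case: bD.
have EC : [set x | 1 < D x] = ~` E by exact: superlevelE.
exists (fun i x => j i x * \1_E x); split.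
- by move=> i; apply: bmfM => //; exact: bmf_indic.
- by move=> i x; rewrite mulr_ge0.
- move=> x; rewrite indicE; case: (boolP (x \in E)) => xE.
    by under eq_bigr do rewrite mulr1; move: xE; rewrite inE.
  by rewrite big1// => i _; rewrite !mulr0.
move=> i A mA; rewrite Rintegral_mkcond.
have -> : (fun x => j i x * \1_E x) \_ A = j i \_ (A `&` E).
  apply/funext => x; rewrite !patchE in_setI indicE.
  by case: (x \in A); case: (x \in E) => //=; rewrite ?mulr1 ?mulr0.
rewrite -Rintegral_mkcond jI; last exact: measurableI.
rewrite -nuE (fine_measure_split (nu i) mA mE).
suff -> : fine (nu i (A `\` E)) = 0 by rewrite addr0.
apply/eqP; rewrite eq_le fine_ge0// andbT.
have mAE : measurable (A `\` E) by exact: measurableD.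
rewrite -(pmulr_rle0 _ (p_gt0 i)).
have -> : 0 = fine (mu (~` E)) by rewrite -EC nD.
apply: (@le_trans _ _ (fine (mu (A `\` E)))).
  rewrite -(mu_inv mAE) (bigD1 i)//= nuE lerDl; apply: sumr_ge0 => k _.
  by rewrite mulr_ge0// fine_ge0.
apply: fine_measure_le => //; first exact: measurableC.
Qed.

Lemma gw_inj v : injective (gw g v).
Proof. by elim: v => [//|i v IH] x y /= /IH /(can_inj (gK i)). Qed.

Definition noinv := ~ exists nu : probability T R, forall i A, measurable A -> nu (g i @^-1` A) = nu A.

Hypothesis mu_noinv : noinv.

Section with_densities.
Variable J : I -> T -> R.
Hypothesis bJ : forall i, bmf (J i).
Hypothesis J_ge0 : forall i x, 0 <= J i x.
Hypothesis J_sum : forall x, \sum_i p i * J i x <= 1.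
Hypothesis JI : forall i A, measurable A -> \int[mu]_(x in A) J i x = fine (mu (g i @^-1` A)).

(** The isometry of L^2(mu) that carries the half-density of [v^2 mu] to that of its image by [g i]. *)
Definition hd i (v : T -> R) x := v (ginv i x) * Num.sqrt (J i x).

Let bmf_sqrtJ i : bmf (fun x => Num.sqrt (J i x)).
Proof.
have [mJ [M JM]] := bJ i; split.
  apply: (measurableT_comp _ mJ); apply: continuous_measurable_fun; exact: sqrt_continuous.
exists (1 + M) => x; have := JM x; rewrite !ger0_norm ?sqrtr_ge0// => h.
have := sqr_sqrtr (J_ge0 i x); have := sqrtr_ge0 (J i x); nra.
Qed.

Lemma bmf_hd i v : bmf v -> bmf (hd i v).
Proof. by move=> bv; apply: bmfM => //; exact: bmf_comp (mginv i) bv. Qed.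

Let int_density i f : bmf f -> \int[mu]_x (f (ginv i x) * J i x) = \int[mu]_x f x.
Proof.
have bfJ h : bmf h -> bmf (fun x => h (ginv i x) * J i x).
  by move=> bh; apply: bmfM => //; exact: bmf_comp (mginv i) bh.
apply: (@int_unique _ _ _ mu (fun f => \int[mu]_x (f (ginv i x) * J i x)) 1).
- move=> {}f h bf bh; rewrite -intD//; [|exact: bfJ|exact: bfJ].
  by apply: eq_Rintegral => x _; rewrite mulrDl.
- move=> c {}f bf; rewrite -intZ//; last exact: bfJ.
  by apply: eq_Rintegral => x _; rewrite mulrA.
- move=> {}f e bf fe; rewrite mul1r (le_trans (int_norm _ _ _))//; first exact: bfJ.
  apply: (@le_trans _ _ (\int[mu]_x (e * J i x))).
    apply: int_le => //; [by apply: bmf_norm; exact: bfJ|exact: bmfZ|].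
    by move=> x _; rewrite normrM (ger0_norm (J_ge0 i x)) ler_wpM2r.
  by rewrite intZ// JI// preimage_setT probT1 mulr1.
- move=> A mA; transitivity (\int[mu]_x (J i x * \1_(ginv i @^-1` A) x)).
    by apply: eq_Rintegral => x _; rewrite mulrC indic_pre.
  rewrite int_indicM; last exact: mpreinv.
  rewrite JI; last exact: mpreinv.
  by rewrite -comp_preimage (_ : _ \o _ = id)//; apply/funext => x /=; rewrite gK.
Qed.

Lemma int_hd_sqr i v A : bmf v -> measurable A ->
  \int[mu]_(x in A) (hd i v x) ^+ 2 = \int[mu]_(x in g i @^-1` A) (v x) ^+ 2.
Proof.
move=> bv mA; rewrite -(int_indicM mu _ mA) -(int_indicM mu _ (mpre i mA)).
have b2 : bmf (fun x => v x ^+ 2 * \1_(g i @^-1` A) x).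
  by apply: bmfM; [exact: bmfM|apply: bmf_indic; exact: mpre].
rewrite -(int_density i b2); apply: eq_Rintegral => x _.
rewrite /hd exprMn sqr_sqrtr// -[RHS]mulrAC; congr (_ * _).
by rewrite indic_pre ginvK.
Qed.

Definition Sop v x := \sum_i p i * hd i v x.

Lemma bmf_Sop v : bmf v -> bmf (Sop v).
Proof. by move=> bv; apply: bmf_sum => i; apply: bmfZ; exact: bmf_hd. Qed.

Lemma Sop_le u v : (forall x, u x <= v x) -> forall x, Sop u x <= Sop v x.
Proof.
move=> uv x; apply: ler_sum => i _; apply: ler_wpM2l => //.
by rewrite ler_wpM2r ?sqrtr_ge0.
Qed.

(** The arithmetic-geometric inequality, as the mean density is at most 1. *)
Lemma Sop1_le x : Sop (fun=> 1) x <= 1.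
Proof.
rewrite /Sop /hd; apply: (@le_trans _ _ (\sum_i (2^-1 * p i + 2^-1 * (p i * J i x)))).
  apply: ler_sum => i _; rewrite mul1r.
  have := sqr_sqrtr (J_ge0 i x); set s := Num.sqrt _ => sJ.
  rewrite -sJ; have := p_ge0 i; have := sqr_ge0 (s - 1); nra.
by rewrite big_split/= -!mulr_sumr p_sum1; have := J_sum x; lra.
Qed.

Let V n := iter n Sop (fun=> 1).

Let bV n : bmf (V n).
Proof. by elim: n => [|n IH]; [exact: bmf_cst|exact: bmf_Sop]. Qed.

Let V_ge0 n x : 0 <= V n x.
Proof.
elim: n x => [|n IH] x; first exact: ler01.
apply: sumr_ge0 => i _; rewrite mulr_ge0// mulr_ge0 ?sqrtr_ge0//; exact: IH.
Qed.

Let V_decr n x : V n.+1 x <= V n x.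
Proof.
elim: n x => [|n IH] x; first exact: Sop1_le.
exact: (Sop_le IH x).
Qed.

Let V_le1 n x : V n x <= 1.
Proof. by elim: n => [|n IH]; [exact: lexx|exact: le_trans (V_decr n x) IH]. Qed.

(** The iterates decrease to a fixed point [h] of [Sop]. This [h] is a mean of the vectors
   [hd i h], which have the same norm as [h], so they are all equal to [h]. Then [h^2 mu] is
   invariant by every map; if it did not vanish, its normalization would contradict the absence
   of invariant probability measures. *)
Lemma affinity_to0 : \int[mu]_x V n x @[n --> \oo] --> (0 : R).
Proof.
have Vdec x : nonincreasing_seq (fun n => V n x).
  by apply/nonincreasing_seqP => n; exact: V_decr.
have Vlb x : has_lbound (range (fun n => V n x)).
  by exists 0 => _ [n _ <-]; exact: V_ge0.
pose h x := inf (range (fun n => V n x)).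
have Vh x : V n x @[n --> \oo] --> h x by exact: nonincreasing_cvgn.
have [bh hn] := bmf_lim bV (fun n x => ltac:(rewrite ger0_norm; [exact: V_le1 n x|exact: V_ge0])) Vh.
have h0 x : 0 <= h x by apply: lb_le_inf; [exists (V 0%N x); exists 0%N|move=> _ [n _ <-]; exact: V_ge0].
have Sh : Sop h = h.
  apply/funext => x.
  have c1 : V n.+1 x @[n --> \oo] --> Sop h x.
    by apply: cvgn_sum => i; apply: cvgMr; apply: cvgMl; exact: Vh.
  have c2 : V n.+1 x @[n --> \oo] --> h x.
    by have := Vh x; rewrite -(cvg_shiftS (fun n => V n x)).
  by rewrite -(cvg_lim (@Rhausdorff R) c1) (cvg_lim (@Rhausdorff R) c2).
have bh2 : bmf (fun x => h x ^+ 2) by exact: bmfM.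
have bhd i : bmf (hd i h) by exact: bmf_hd.
have bhd2 i : bmf (fun x => hd i h x ^+ 2) by exact: bmfM.
have bhh i : bmf (fun x => h x * hd i h x) by exact: bmfM.
have bdif i : bmf (fun x => hd i h x - h x) by exact: bmfB.
have expand i : \int[mu]_x (hd i h x - h x) ^+ 2 =
    2 * \int[mu]_x h x ^+ 2 - 2 * \int[mu]_x (h x * hd i h x).
  have -> : \int[mu]_x (hd i h x - h x) ^+ 2 =
      \int[mu]_x (hd i h x ^+ 2 + h x ^+ 2 - 2 * (h x * hd i h x)).
    by apply: eq_Rintegral => x _; ring.
  rewrite intB//; [|exact: bmfD|exact: bmfZ].
  rewrite intD// intZ// int_hd_sqr// preimage_setT; ring.
have tot : \sum_i p i * \int[mu]_x (hd i h x - h x) ^+ 2 = 0.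
  under eq_bigr => i _ do rewrite expand mulrBr.
  rewrite sumrB -mulr_suml p_sum1 mul1r.
  have -> : \sum_i p i * (2 * \int[mu]_x (h x * hd i h x)) = 2 * \int[mu]_x h x ^+ 2.
    under eq_bigr => i _ do rewrite mulrCA -intZ//.
    rewrite -mulr_sumr -int_sum//; last by move=> i; exact: bmfZ.
    congr (_ * _); apply: eq_Rintegral => x _.
    have -> : h x ^+ 2 = h x * Sop h x by rewrite Sh.
    rewrite /Sop mulr_sumr; apply: eq_bigr => i _; ring.
  by rewrite subrr.
have fixhd i : \int[mu]_x (hd i h x - h x) ^+ 2 = 0.
  have nn k : 0 <= p k * \int[mu]_x (hd k h x - h x) ^+ 2.
    by rewrite mulr_ge0//; apply: int_ge0 => x _; exact: sqr_ge0.
  move/eqP : tot; rewrite psumr_eq0//= => /allP/(_ i (mem_index_enum i))/=.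
  by rewrite mulf_eq0 gt_eqF//= => /eqP.
have inv i A : measurable A -> \int[mu]_(x in g i @^-1` A) h x ^+ 2 = \int[mu]_(x in A) h x ^+ 2.
  by move=> mA; rewrite -int_hd_sqr//; exact: int_sqr_eq.
have [eta etaE] := density_measure mu bh2 (fun x => sqr_ge0 (h x)).
have h20 : \int[mu]_x h x ^+ 2 = 0.
  apply: contrapT => /eqP h2; apply: mu_noinv.
  have etaT : fine (eta setT) != 0 by rewrite etaE.
  have etaF : (eta setT == 0%E) || (eta setT == +oo%E) = false.
    apply/negbTE; rewrite negb_or; apply/andP; split.
      by apply: contra etaT => /eqP ->.
    by rewrite lt_eqF// fin_ltT.
  have mnE B : (mnormalize eta mu : set T -> \bar R) B = (eta B * (fine (eta setT))^-1%:E)%E.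
    by rewrite /= /mnormalize etaF.
  exists (mnormalize eta mu) => i A mA.
  apply: (etrans (mnE _)); apply: (etrans _ (esym (mnE _))); congr (_ * _)%E.
  rewrite -(@fineK _ (eta (g i @^-1` A))) ?fin_num_measure//; last exact: mpre.
  rewrite -(@fineK _ (eta A)) ?fin_num_measure//.
  by rewrite !etaE ?inv//; exact: mpre.
have hI0 : \int[mu]_x h x = 0.
  rewrite -[RHS](int_sqr0 bh h20); apply: eq_Rintegral => x _; rewrite ger0_norm//.
rewrite -hI0; apply: (int_lim (M := 1)) => // n x.
by rewrite ger0_norm; [exact: V_le1|exact: V_ge0].
Qed.

Fixpoint hdw v (u : T -> R) : T -> R := if v is i :: v' then hdw v' (hd i u) else u.

Lemma bmf_hdw v u : bmf u -> bmf (hdw v u).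
Proof. by elim: v u => [//|i v IH] u bu /=; apply: IH; exact: bmf_hd. Qed.

Lemma hdw_ge0 v u : (forall x, 0 <= u x) -> forall x, 0 <= hdw v u x.
Proof.
elim: v u => [//|i v IH] u u0 /=; apply: IH => x.
by rewrite mulr_ge0// sqrtr_ge0.
Qed.

Lemma mpregw v A : measurable A -> measurable (gw g v @^-1` A).
Proof. by move=> mA; rewrite -[X in measurable X]setTI; exact: (mgw mg). Qed.

Lemma int_hdw_sqr v u A : bmf u -> measurable A ->
  \int[mu]_(x in A) (hdw v u x) ^+ 2 = \int[mu]_(x in gw g v @^-1` A) (u x) ^+ 2.
Proof.
elim: v u => [//|i v IH] u bu mA /=; rewrite IH//; last exact: bmf_hd.
by rewrite int_hd_sqr//; exact: mpregw.
Qed.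

Lemma hdw_sum v (F : I -> T -> R) : hdw v (fun x => \sum_i p i * F i x) =
  fun x => \sum_i p i * hdw v (F i) x.
Proof.
elim: v F => [//|j v IH] F /=; rewrite -IH; congr (hdw v _); apply/funext => x.
by rewrite /hd mulr_suml; apply: eq_bigr => i _; rewrite mulrA.
Qed.

Lemma iter_Sop n u x : iter n Sop u x = Ew p n (fun v => hdw v u x).
Proof.
elim: n u => [//|n IH] u; rewrite iterSr IH /=.
transitivity (Ew p n (fun v => \sum_i p i * hdw v (hd i u) x)).
  by apply: eq_Ew => v _; rewrite (hdw_sum v (fun i => hd i u)).
rewrite (Ew_sum p_sum1 n _ (fun i v => p i * hdw v (hd i u) x)).
by apply: eq_bigr => i _; rewrite EwZ.
Qed.

End with_densities.

(** The half-densities of the images of [mu] under words are on average almost orthogonal to the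
   constant half-density of [mu]: their average is an iterate of [Sop] at 1. *)
Lemma words_singular : exists s : seq I -> T -> R,
  [/\ forall v, bmf (s v), forall v x, 0 <= s v x,
      forall v A, measurable A -> \int[mu]_(x in A) (s v x) ^+ 2 = fine (mu (gw g v @^-1` A)) &
      forall e, 0 < e -> exists n, forall k, (n <= k)%N -> \int[mu]_x Ew p k (fun v => s v x) < e].
Proof.
have [J [bJ J0 JS JI]] := image_densities.
exists (fun v => hdw J v (fun=> 1)); split.
- by move=> v; apply: bmf_hdw => //; exact: bmf_cst.
- by move=> v x; apply: hdw_ge0 => y; exact: ler01.
- move=> v A mA; rewrite int_hdw_sqr//; last exact: bmf_cst.
  have mA' : measurable (gw g v @^-1` A) by exact: mpregw.
  rewrite -[RHS]mul1r -int_cst//; apply: eq_Rintegral => x _; exact: expr1n.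
- move=> e e0; have /cvgrPdist_lt/(_ _ e0)[N _ HN] := affinity_to0 bJ J0 JS JI.
  exists N => k Nk; have := HN k Nk; rewrite sub0r normrN => /(le_lt_trans (ler_norm _)).
  by under [X in X < _ -> _]eq_Rintegral => x _ do rewrite iter_Sop.
Qed.

Lemma mu_gw A : measurable A -> forall n, Ew p n (fun v => fine (mu (gw g v @^-1` A))) = fine (mu A).
Proof.
move=> mA n; rewrite -int_indic// -(int_iter_Uop p_ge0 p_sum1 mg mu_inv n); last exact: bmf_indic.
under [RHS]eq_Rintegral => x _ do rewrite iter_Uop Ew_tuple.
rewrite int_sum//; last by move=> t; apply: bmfZ; apply: bmf_comp (mgw mg t) _; exact: bmf_indic.
rewrite Ew_tuple; apply: eq_bigr => t _.
rewrite intZ//; last by apply: bmf_comp (mgw mg t) _; exact: bmf_indic.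
by rewrite -int_indic//; exact: mpregw.
Qed.

(** At an atom of nearly maximal mass all the densities would be bounded, hence the average
   half-density would stay bounded below. *)
Lemma stationary_nonatomic : (forall x, measurable [set x : T]) -> forall x, mu [set x] = 0%E.
Proof.
move=> m1 x0; apply: contrapT => x0n.
have [s [bs s0 sI sE]] := words_singular.
pose a x := fine (mu [set x]).
have a0 x : 0 <= a x by rewrite fine_ge0.
have ax0 : 0 < a x0.
  rewrite lt_neqAle a0 andbT eq_sym; apply: contra_notN x0n => /eqP h.
  by rewrite -(@fineK _ (mu _)) ?fin_num_measure// -/(a x0) h.
pose m := sup (range a).
have hs : has_sup (range a).
  split; first by exists (a x0); exists x0.
  exists 1 => _ [x _ <-]; rewrite -(probT1 mu).
  exact: fine_measure_le.
have am x : a x <= m by apply: sup_upper_bound => //; exists x.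
have m0 : 0 < m by exact: lt_le_trans ax0 (am x0).
have [_ [x _ <-] mx] : exists2 b, range a b & m / 4 < b.
  have [|b rb hb] := @sup_adherent R (range a) (m - m / 4) _ hs; first by lra.
  by exists b => //; move: hb; rewrite -/m; lra.
have ax : 0 < a x by lra.
have pre v : fine (mu (gw g v @^-1` [set x])) <= 4 * a x.
  have [[y /= gy]|/forallNP ny] := pselect (exists y, gw g v y = x).
    have -> : gw g v @^-1` [set x] = [set y].
      by apply/seteqP; split=> [z /=|_ /= ->//]; rewrite -gy; exact: gw_inj.
    by rewrite (le_trans (am y))//; lra.
  have -> : gw g v @^-1` [set x] = set0 by rewrite -subset0 => y /= /ny.
  by rewrite measure0/=; lra.
have sx v : s v x ^+ 2 * a x = fine (mu (gw g v @^-1` [set x])).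
  rewrite -sI// -int_cst//; apply: eq_Rintegral => y.
  by rewrite inE => /= ->.
have s2 v : s v x <= 2.
  have := pre v; rewrite -sx => h.
  have : s v x ^+ 2 <= 4 by rewrite -(ler_pM2r ax).
  by have := s0 v x; nra.
have half n : 2^-1 <= Ew p n (fun v => s v x).
  have h1 : Ew p n (fun v => s v x ^+ 2) = 1.
    apply: (mulIf (lt0r_neq0 ax)); rewrite mul1r mulrC -EwZ -[RHS](mu_gw (m1 x) n).
    by apply: eq_Ew => v _; rewrite mulrC sx.
  apply: (@le_trans _ _ (Ew p n (fun v => 2^-1 * s v x ^+ 2))); first by rewrite EwZ h1 mulr1.
  apply: Ew_le => // v _.
  by have := s0 v x; have := s2 v; nra.
have ax4 : 0 < a x / 4 by rewrite divr_gt0.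
have [n /(_ n (leqnn n))] := sE _ ax4; apply/negP; rewrite -leNgt.
have bE : bmf (fun y => Ew p n (fun v => s v y)) by exact: bmf_Ew.
have hm : 2^-1 * fine (mu [set x]) <= \int[mu]_y Ew p n (fun v => s v y).
  apply: markov_ineq => //; first by move=> y; exact: Ew_ge0.
  by move=> _ /= ->.
by apply: le_trans hm; rewrite -/(a x); lra.
Qed.

End affinity.

(** * A covering inequality for arcs *)

Section covering.
Variable R : realType.
Local Notation C := (circle R).
Implicit Types (J U V A B : set C).

Lemma minimal_subfamily (F : C -> set C) (s : seq C) :
  exists s' : seq C, [/\ uniq s', {subset s' <= s},
    (forall z i, i \in s -> F i z -> exists2 j, j \in s' & F j z) &
    forall i, i \in s' -> exists2 z, F i z & forall j, j \in s' -> j != i -> ~ F j z].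
Proof.
have [n] := ubnP (size s); elim: n s => [//|n IH] s sn.
have [us|nus] := boolP (uniq s); last first.
  have [|s' [us' ss' cs' ms']] := IH (undup s).
    by apply: (@leq_trans (size s)) => //; rewrite ltn_size_undup.
  exists s'; split=> //; first by move=> x /ss'; rewrite mem_undup.
  by move=> z i is_; apply: cs'; rewrite mem_undup.
have [[i [is_ iF]]|H] := pselect (exists i, i \in s /\
    forall z, F i z -> exists2 j, j \in s & j != i /\ F j z).
  have [|s' [us' ss' cs' ms']] := IH (rem i s).
    by rewrite size_rem// -ltnS prednK//; case: (s) is_.
  exists s'; split=> //; first by move=> x /ss'; exact: mem_rem.
  move=> z k ks kz; have [ki|ki] := eqVneq k i.
    rewrite ki in kz; have [j js [ji jz]] := iF z kz.
    by apply: cs' jz; rewrite mem_rem_uniq// inE ji.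
  by apply: cs' kz; rewrite mem_rem_uniq// inE ki.
exists s; split=> //; first by move=> z i is_ iz; exists i.
move=> i is_; apply: contrapT => h; apply: H; exists i; split=> // z iz.
apply: contrapT => hz; apply: h; exists z => // j js ji jz.
by apply: hz; exists j.
Qed.

(** Among three short arcs through [z] one is covered by the two others, which the points that
   belong to a single member of the family exclude. *)
Lemma minimal_multiplicity (F : C -> set C) (s : seq C) (z : C) : uniq s ->
  (forall i, i \in s -> connected (F i)) ->
  (forall i, i \in s -> forall x y, F i x -> F i y -> mdist x y < 2^-1) ->
  (forall i, i \in s -> exists2 z, F i z & forall j, j \in s -> j != i -> ~ F j z) ->
  (count (fun i => z \in F i) s <= 2)%N.
Proof.
move=> us cF sF mF; rewrite leqNgt; apply/negP => h.
have [i [j [k [[is_ js ks] [[ij ik jk] [iz jz kz]]]]]] : exists i j k,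
    [/\ i \in s, j \in s & k \in s] /\ [/\ i != j, i != k & j != k] /\ [/\ F i z, F j z & F k z].
  rewrite -size_filter in h.
  case E : [seq i <- s | z \in F i] h => [//|i [//|j [//|k t]]] _.
  have uE : uniq [:: i, j, k & t] by rewrite -E filter_uniq.
  have mE x : x \in [:: i, j, k & t] -> x \in s /\ F x z.
    by rewrite -E mem_filter => /andP[]; rewrite inE.
  exists i, j, k; move: uE; rewrite /= !inE !negb_or => /and4P[/and3P[ij ik _] /andP[jk _] _ _].
  have [? ?] := mE i ltac:(by rewrite !inE eqxx).
  have [? ?] := mE j ltac:(by rewrite !inE eqxx orbT).
  have [? ?] := mE k ltac:(by rewrite !inE eqxx !orbT).
  by [].
pose f (o : 'I_3) := nth i [:: i; j; k] o.
have fs o : f o \in s by rewrite /f; case: o => -[|[|[|]]].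
have finj o o' : o != o' -> f o != f o'.
  case: o => -[|[|[|//]]] ho; case: o' => -[|[|[|//]]] ho'; rewrite -val_eqE//= => _;
    rewrite /f/= // eq_sym //.
have fz o : F (f o) z by rewrite /f; case: o => -[|[|[|]]].
have [q hq] := @connected_three R (fun q => F (f q)) z (fun q => cF _ (fs q))
  (fun q => sF _ (fs q)) fz.
have [y yq yn] := mF _ (fs q).
have [q' /= qq' y'] := hq _ yq.
by apply: (yn (f q')) y' => //; exact: finj.
Qed.

(** A compact part of the union, of nearly full measure, is covered by finitely many of the arcs.
   In a minimal subfamily that still covers it, no point of [W] is counted more than twice, so
   that the total [a]-mass of the arcs is at most twice that of [W]. *)
Lemma weak_type (a m : {finite_measure set C -> \bar R}) (t : R) (W : set C)
    (JJ : set (set C)) : 0 < t -> measurable W ->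
  (forall J, JJ J -> [/\ open J, connected J, forall x y, J x -> J y -> mdist x y < 2^-1,
     J `<=` W & t * fine (m J) <= fine (a J)]) ->
  fine (m (\bigcup_(J in JJ) J)) <= 2 / t * fine (a W).
Proof.
move=> t0 mW HJ; set B := \bigcup_(J in JJ) J.
have oB : open B by apply: bigcup_open => J /HJ[].
have mB := open_measurable_circle oB.
apply/ler_addgt0Pl => e e0.
have [r r0 hr] := shrink_approx m oB e0.
pose K := shrink B r.
have cK : closed K by exact: closed_shrink.
have mK : measurable K by exact: closed_measurable_circle.
have KB : K `<=` B by exact: shrink_sub.
have /choice[F FP] : forall x, exists J : set C, (K x -> JJ J /\ J x) /\ (~ K x -> J = set0).
  move=> x; have [Kx|nKx] := pselect (K x); last by exists set0.
  by have [J JJJ Jx] := KB _ Kx; exists J.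
have FJ x : K x -> JJ (F x) by move=> /(FP x).1[].
have oF x : K x -> open (F x) by move=> /FJ/HJ[].
have KK : compact K by apply: subclosed_compact cK (@compact_circle R) _.
move: (KK); rewrite compact_cover => /(_ C K F)[||D' D'K KD'].
- by move=> x; exact: oF.
- by move=> x Kx; exists x => //; exact: ((FP x).1 Kx).2.
have [s [us ss cs ms]] := minimal_subfamily F (finmap.enum_fset D').
have sK i : i \in s -> K i by move=> /ss iD; have := D'K i iD; rewrite inE.
have mF i : i \in s -> measurable (F i) by move=> /sK/oF; exact: open_measurable_circle.
have mult z : (count (fun i => z \in F i) s <= 2)%N.
  by apply: minimal_multiplicity => // i /sK/FJ/HJ[].
pose G i := if i \in s then F i else set0.
have mG i : measurable (G i) by rewrite /G; case: ifPn => // /mF.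
have GS i : i \in s -> G i = F i by rewrite /G => ->.
have KG : K `<=` \big[setU/set0]_(i <- s) G i.
  move=> z Kz; have [i iD Fz] := KD' _ Kz.
  have [j js jz] := cs z i iD Fz.
  by rewrite -bigcup_seq; exists j => //; rewrite /= GS.
have h1 : fine (m K) <= \sum_(i <- s) fine (m (G i)).
  apply: (@le_trans _ _ (fine (m (\big[setU/set0]_(i <- s) G i)))).
    by apply: fine_measure_le => //; exact: bigsetU_measurable.
  elim: (s) => [|i s' IH]; first by rewrite !big_nil measure0.
  rewrite !big_cons; apply: le_trans (fine_measureU_le _ _ _) _ => //.
    exact: bigsetU_measurable.
  by rewrite lerD2l.
have h2 : t * \sum_(i <- s) fine (m (G i)) <= \sum_(i <- s) fine (a (G i)).
  rewrite mulr_sumr big_seq [leRHS]big_seq; apply: ler_sum => i si.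
  by rewrite GS//; have [] := HJ _ (FJ _ (sK _ si)).
have h3 : \sum_(i <- s) fine (a (G i)) <= 2 * fine (a W).
  rewrite -(int_indic a mW) -intZ//; last exact: bmf_indic.
  under eq_bigr => i _ do rewrite -int_indic//.
  rewrite -int_sum//; last by move=> i; exact: bmf_indic.
  apply: int_le => //.
  - by apply: bmf_sum => i; exact: bmf_indic.
  - by apply: bmfZ; exact: bmf_indic.
  move=> z _; have [zW|zW] := pselect (W z); last first.
    rewrite big_seq big1 ?mulr_ge0// => i si; rewrite GS// indicE memNset//.
    by move=> iz; apply: zW; have [_ _ _ + _] := HJ _ (FJ _ (sK _ si)); apply.
  rewrite [in leRHS]indicE mem_set// mulr1.
  have -> : \sum_(i <- s) \1_(G i) z = (count (fun i => z \in F i) s)%:R :> R.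
    rewrite -sum1_count natr_sum [RHS]big_mkcond/= big_seq [RHS]big_seq.
    apply: eq_bigr => i si.
    by rewrite GS// indicE; case: (z \in F i).
  by rewrite ler_nat.
have h4 : fine (m B) <= fine (m K) + e.
  rewrite (fine_measure_split m mB mK); apply: lerD; last exact: ltW.
  by apply: fine_measure_le => //; exact: measurableI.
rewrite addrC (le_trans h4)// lerD2r.
have t1 : t * fine (m K) <= 2 * fine (a W).
  by rewrite (le_trans _ h3)// (le_trans _ h2)// ler_pM2l.
by rewrite mulrAC ler_pdivlMr// mulrC.
Qed.

End covering.

(** * A reference measure that dominates length and the stationary measure *)

Section reference_measure.
Variables (R : realType) (I : finType).
Local Notation C := (circle R).
Variables (p : I -> R) (ginv : I -> C -> C) (mu : probability C R).
Hypothesis p_ge0 : forall i, 0 <= p i.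
Hypothesis p_sum1 : \sum_i p i = 1.
Hypothesis mginv : forall i, measurable_fun setT (ginv i).
Hypothesis ginv_bij : forall i x, exists y, ginv i @^-1` [set x] = [set y].
Hypothesis mu_nonatomic : forall x, mu [set x] = 0%E.

(** Let Q average the images of a measure under the inverse maps. The sum of the measures
   2^(- n - 1) Q^n (mu + length) dominates half of mu + length, and Q at most doubles it. *)
Lemma reference_measure : exists kappa : {finite_measure set C -> \bar R},
  [/\ forall A, measurable A -> fine (mu A) <= 2 * fine (kappa A),
      forall A, measurable A -> fine (leb R A) <= 2 * fine (kappa A),
      forall A, measurable A -> \sum_i p i * fine (kappa (ginv i @^-1` A)) <= 2 * fine (kappa A) &
      forall x, kappa [set x] = 0%E].
Proof.
have /choice[Q QE] : forall m : {finite_measure set C -> \bar R},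
    exists m' : {finite_measure set C -> \bar R},
    forall A, m' A = (\sum_i (p i)%:E * m (ginv i @^-1` A))%E.
  move=> m.
  have /choice[n nE] : forall i, exists n : {finite_measure set C -> \bar R},
      forall A, n A = m (ginv i @^-1` A).
    by move=> i; exact: (pushforward_ex (mginv i) (fin_ltT m)).
  have [m' m'E] := measure_sum_ex n p_ge0.
  by exists m' => A; rewrite m'E; apply: eq_bigr => i _; rewrite nE.
have mpre i A : measurable A -> measurable (ginv i @^-1` A).
  by move=> mA; rewrite -[X in measurable X]setTI; exact: mginv.
have QfE m A : measurable A -> fine (Q m A) = \sum_i p i * fine (m (ginv i @^-1` A)).
  move=> mA; rewrite QE; under eq_bigr => i _.
    rewrite -(@fineK _ (m (ginv i @^-1` A))) ?fin_num_measure//; last exact: mpre.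
    over.
  by rewrite sumEFin.
have [m0 m0E] := @measure_sum_ex _ C R bool (fun=> 1)
  (fun b => if b then (mu : {finite_measure set C -> \bar R}) else leb R) (fun=> ler01).
have fm0 A : measurable A -> fine (m0 A) = fine (mu A) + fine (leb R A).
  move=> mA; rewrite m0E big_bool/= !mul1e fineD//; exact: fin_num_measure.
pose M n := iter n Q m0.
pose c n : R := 1 / (2 ^ n.+1)%:R.
have c0 n : 0 <= c n by rewrite divr_ge0.
have MT n : fine (M n setT) = 2.
  elim: n => [|n IH]; first by rewrite fm0// probT1 lebT.
  rewrite /M iterS QfE//; under eq_bigr do rewrite preimage_setT IH.
  by rewrite -mulr_suml p_sum1 mul1r.
have [|kappa kE] := @measure_series_ex _ C R c M c0.
  apply: (@le_lt_trans _ _ 2%:E); last exact: ltry.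
  apply: le_trans (epsilon_trick0 xpredT (_ : 0 <= 2 :> R)) => //.
  apply: lee_nneseries => n _ //; first by rewrite mule_ge0// lee_fin.
  rewrite -(@fineK _ (M n setT)) ?fin_num_measure// MT -EFinM lee_fin.
  by rewrite /c mulrAC mul1r.
pose S n A := \sum_(0 <= k < n) c k * fine (M k A).
have SE n A : measurable A -> (S n A)%:E = (\sum_(0 <= k < n) (c k)%:E * M k A)%E.
  move=> mA; rewrite /S -sumEFin; apply: eq_bigr => k _.
  by rewrite EFinM fineK// fin_num_measure.
have cS A : measurable A -> S n A @[n --> \oo] --> fine (kappa A).
  move=> mA; apply: (@fine_cvg _ _ _ _ (fun n => (S n A)%:E)).
  rewrite fineK ?fin_num_measure// kE.
  under eq_fun do rewrite SE//.
  by apply: is_cvg_nneseries => k _ _; rewrite mule_ge0// lee_fin.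
have Sle n A : measurable A -> S n A <= fine (kappa A).
  move=> mA; have nd : nondecreasing_seq (S ^~ A).
    apply/nondecreasing_seqP => k; rewrite /S big_nat_recr//= lerDl mulr_ge0// fine_ge0//.
  rewrite -(cvg_lim (@Rhausdorff R) (cS A mA)).
  by apply: nondecreasing_cvgn_le => //; apply/cvg_ex; exists (fine (kappa A)); exact: cS.
have S1 A : measurable A -> fine (mu A) + fine (leb R A) <= 2 * fine (kappa A).
  move=> mA; have := Sle 1%N A mA; rewrite /S big_nat1 /M/= fm0// /c expn1; lra.
have ge0 A (m : {finite_measure set C -> \bar R}) : 0 <= fine (m A) by rewrite fine_ge0.
exists kappa; split.
- by move=> A mA; have := S1 A mA; have := ge0 A (leb R); lra.
- by move=> A mA; have := S1 A mA; have := ge0 A mu; lra.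
- move=> A mA.
  have c1 : \sum_i p i * S n (ginv i @^-1` A) @[n --> \oo] -->
      \sum_i p i * fine (kappa (ginv i @^-1` A)).
    by apply: cvgn_sum => i; apply: cvgMr; apply: cS; exact: mpre.
  rewrite -(cvg_lim (@Rhausdorff R) c1); apply: limr_le.
    by apply/cvg_ex; eexists; exact: c1.
  apply: nearW => n.
  apply: (@le_trans _ _ (2 * S n.+1 A)); last by rewrite ler_pM2l// Sle.
  rewrite /S big_nat_recl//= mulrDr mulr_sumr.
  apply: (@le_trans _ _ (\sum_(0 <= k < n) 2 * (c k.+1 * fine (M k.+1 A)))); last first.
    by rewrite lerDr mulr_ge0// mulr_ge0.
  under eq_bigr do rewrite mulr_sumr.
  rewrite exchange_big/=; apply: ler_sum => k _.
  rewrite QfE// !mulr_sumr; apply: ler_sum => i _.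
  have -> : c k = 2 * c k.+1.
    by rewrite /c (expnS _ k.+1) natrM; field; rewrite pnatr_eq0 expn_eq0.
  by rewrite le_eqVlt; apply/orP; left; apply/eqP; ring.
- move=> x; rewrite kE eseries0// => n _ _.
  suff -> : M n [set x] = 0%E by rewrite mule0.
  elim: n x => [|n IH] x.
    by rewrite /M/= m0E big_bool/= mu_nonatomic leb1 !mule0 adde0.
  rewrite /M iterS QE big1// => i _.
  by have [y ->] := ginv_bij i x; rewrite IH mule0.
Qed.

End reference_measure.

(** * Contraction of small arcs in the mean *)

Section mean_contraction.
Variables (R : realType) (I : finType).
Local Notation C := (circle R).
Variables (p : I -> R) (g ginv : I -> C -> C) (mu : probability C R).
Hypothesis p_gt0 : forall i, 0 < p i.
Hypothesis p_sum1 : \sum_i p i = 1.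
Hypothesis cg : forall i, continuous (g i).
Hypothesis cginv : forall i, continuous (ginv i).
Hypothesis gK : forall i, cancel (g i) (ginv i).
Hypothesis ginvK : forall i, cancel (ginv i) (g i).
Hypothesis mu_inv : forall A, measurable A ->
  \sum_i p i * fine (mu (g i @^-1` A)) = fine (mu A).
Hypothesis mu_noinv : noinv (R := R) g.

Variable kappa : {finite_measure set C -> \bar R}.
Hypothesis mu_kappa : forall A, measurable A -> fine (mu A) <= 2 * fine (kappa A).
Hypothesis leb_kappa : forall A, measurable A -> fine (leb R A) <= 2 * fine (kappa A).
Hypothesis kappa_back : forall A, measurable A ->
  \sum_i p i * fine (kappa (ginv i @^-1` A)) <= 2 * fine (kappa A).

Let p_ge0 i : 0 <= p i. Proof. exact: ltW. Qed.

Let mg i : measurable_fun setT (g i). Proof. exact: continuous_measurable_map. Qed.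
Let mginv i : measurable_fun setT (ginv i). Proof. exact: continuous_measurable_map. Qed.

Fixpoint gwi (v : seq I) (x : C) : C := if v is i :: v' then ginv i (gwi v' x) else x.

Lemma gwK v : cancel (gw g v) (gwi v).
Proof. by elim: v => [//|i v IH] x /=; rewrite IH gK. Qed.

Lemma gwiK v : cancel (gwi v) (gw g v).
Proof. by elim: v => [//|i v IH] x /=; rewrite ginvK IH. Qed.

Lemma continuous_gw v : continuous (gw g v).
Proof.
elim: v => [|i v IH] x; first exact: cvg_id.
apply: (@continuous_comp _ _ _ (g i) (gw g v)); [exact: cg|exact: IH].
Qed.

Lemma continuous_gwi v : continuous (gwi v).
Proof.
elim: v => [|i v IH] x; first exact: cvg_id.
apply: (@continuous_comp _ _ _ (gwi v) (ginv i)); [exact: IH|exact: cginv].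
Qed.

Lemma gw_image v A : gw g v @` A = gwi v @^-1` A.
Proof.
apply/seteqP; split=> [_ [x Ax <-]|y /= Ay]; first by rewrite /= gwK.
by exists (gwi v y) => //; rewrite gwiK.
Qed.

Lemma open_gw_image v A : open A -> open (gw g v @` A).
Proof. by move=> oA; rewrite gw_image; apply: open_comp => // x _; exact: continuous_gwi. Qed.

Lemma connected_gw_image v A : connected A -> connected (gw g v @` A).
Proof.
move=> cA; apply: connected_continuous_connected => //.
exact: continuous_subspaceT (@continuous_gw v).
Qed.

Let mgwi v : measurable_fun setT (gwi v). Proof. exact: continuous_measurable_map (@continuous_gwi v). Qed.

Lemma small_kappa (A : set C) (x y : C) : measurable A -> connected A -> A x -> A y ->
  mdist x y <= 4 * fine (kappa A).
Proof.
move=> mA cA Ax Ay; have := leb_connected mA cA Ax Ay; have := leb_kappa mA; lra.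
Qed.

Let distortion_letter i A : measurable A ->
  fine (kappa (ginv i @^-1` A)) <= (\sum_j 2 / p j) * fine (kappa A).
Proof.
move=> mA; have k0 B : 0 <= fine (kappa B) by rewrite fine_ge0.
have h : p i * fine (kappa (ginv i @^-1` A)) <= 2 * fine (kappa A).
  apply: le_trans (kappa_back mA); rewrite (bigD1 i)//= lerDl.
  by apply: sumr_ge0 => j _; rewrite mulr_ge0.
apply: (@le_trans _ _ (2 / p i * fine (kappa A))).
  by rewrite mulrAC ler_pdivlMr// mulrC.
rewrite ler_wpM2r// (bigD1 i)//= lerDl.
by apply: sumr_ge0 => j _; rewrite divr_ge0.
Qed.

Lemma distortion v A : measurable A ->
  fine (kappa (gwi v @^-1` A)) <= (\sum_j 2 / p j) ^+ size v * fine (kappa A).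
Proof.
have D0 : 0 <= \sum_j 2 / p j by apply: sumr_ge0 => j _; rewrite divr_ge0.
elim: v A => [|i v IH] A mA; first by rewrite /= expr0 mul1r.
have mA' : measurable (ginv i @^-1` A) by rewrite -[X in measurable X]setTI; exact: mginv.
apply: (le_trans (IH _ mA')); rewrite /= exprSr -mulrA.
by rewrite ler_wpM2l// ?exprn_ge0//; exact: distortion_letter.
Qed.

(** [gwi v @^-1` J] is the image of [J] by the word [v], in a form whose measurability is plain. *)
Definition bad_arc v (t delta : R) : set (set C) := [set J |
  [/\ open J, connected J, fine (kappa J) < delta &
      t * fine (kappa J) < fine (kappa (gwi v @^-1` J))]].

Definition bad v t delta : set C := \bigcup_(J in bad_arc v t delta) J.

Lemma open_bad v t delta : open (bad v t delta).
Proof. by apply: bigcup_open => J []. Qed.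

Let mbad v t delta : measurable (bad v t delta).
Proof. by apply: open_measurable_circle; exact: open_bad. Qed.

Lemma bad_decr v t t' delta : t <= t' -> bad v t' delta `<=` bad v t delta.
Proof.
move=> tt' x [J [oJ cJ kJ bJ] Jx]; exists J => //; split=> //.
by apply: le_lt_trans bJ; rewrite ler_wpM2r// fine_ge0.
Qed.

Let image_measure v : exists la : {finite_measure set C -> \bar R},
  forall A, la A = kappa (gwi v @^-1` A).
Proof. exact: (pushforward_ex (mgwi v) (fin_ltT kappa)). Qed.

(** [weak_type] for the measure A |-> kappa (image of A by v), which is large on the bad arcs: if
   the image of [W] is small, there is little room for bad arcs in [W]. *)
Lemma bad_weak_type v t delta W : 0 < t -> delta <= 8^-1 -> measurable W ->
  fine (mu (\bigcup_(J in [set J | bad_arc v t delta J /\ J `<=` W]) J)) <=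
  4 / t * fine (kappa (gwi v @^-1` W)).
Proof.
move=> t0 d8 mW; have [la laE] := image_measure v.
have t20 : 0 < t / 2 by rewrite divr_gt0.
have -> : 4 / t * fine (kappa (gwi v @^-1` W)) = 2 / (t / 2) * fine (la W).
  by rewrite laE; field; rewrite gt_eqF.
apply: (@weak_type R la mu (t / 2) W) => // J [[oJ cJ kJ bJ] JW].
have mJ := open_measurable_circle oJ.
split=> //.
  move=> x y Jx Jy; apply: le_lt_trans (small_kappa mJ cJ Jx Jy) _; lra.
rewrite laE; apply: le_trans (ltW bJ).
by have := mu_kappa mJ; rewrite -(ler_pM2l t20); lra.
Qed.

Lemma bad_weak_type_all v t delta : 0 < t -> delta <= 8^-1 ->
  fine (mu (bad v t delta)) <= 4 / t * fine (kappa setT).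
Proof.
move=> t0 d8; have := bad_weak_type v t0 d8 measurableT; rewrite preimage_setT.
apply: le_trans; apply: fine_measure_le => //.
  by apply: open_measurable_circle; apply: bigcup_open => J [[]].
by move=> x [J bJ Jx]; exists J => //; split.
Qed.

(** Let J be the density of [mu] with respect to [kappa], and [N] the set where it vanishes. The
   sets where J is positive but small have arbitrarily small [kappa]-measure, and where J is not
   small [kappa] is controlled by [mu]. *)
Lemma absolutely_continuous_part : exists2 N : set C, measurable N /\ mu N = 0%E &
  forall e, 0 < e -> exists2 rho, 0 < rho & forall B, measurable B -> fine (mu B) <= rho ->
    fine (kappa (B `\` N)) <= e.
Proof.
have [|J [bJ J0 JI]] := @density_bounded _ _ R mu kappa 2^-1 ltac:(lra).
  by move=> A mA; have := mu_kappa mA; lra.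
have mle c : measurable [set x | J x <= c] by apply: measurable_sublevel; case: bJ.
exists [set x | J x <= 0].
  split=> //; apply/eqP; rewrite -(@fineK _ (mu _)) ?fin_num_measure// eqe -JI//.
  rewrite (_ : \int[kappa]_(x in _) J x = \int[kappa]_(x in [set x | J x <= 0]) 0).
    by rewrite int_cst// mul0r.
  by apply: eq_Rintegral => x; rewrite inE/= => Jx; apply/le_anti; rewrite Jx J0.
move=> e e0; have e2 : 0 < e / 2 by rewrite divr_gt0.
pose F (n : nat) := [set x | J x <= n.+1%:R^-1] `\` [set x | J x <= 0].
have cF : fine (kappa (F n)) @[n --> \oo] --> (0 : R).
  apply: measure_decr_cvg.
  - by move=> n; exact: measurableD.
  - move=> n x [/= Jx nx]; split=> //=; apply: le_trans Jx _.
    by rewrite lef_pV2 ?posrE// ler_nat.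
  - rewrite -subset0 => x Hx; have [/= _ /negP] := Hx 0%N Logic.I; rewrite -ltNge => Jx.
    have /cvgrPdist_lt/(_ _ Jx)[n _ Hn] := @cvg_harmonic R.
    have := Hn n (leqnn n); rewrite /harmonic/= sub0r normrN gtr0_norm// => h.
    by have [/= /(lt_le_trans h)] := Hx n Logic.I; rewrite ltxx.
have /cvgrPdist_lt/(_ _ e2)[n _ Hn] := cF.
have := Hn n (leqnn n); rewrite sub0r normrN ger0_norm ?fine_ge0// => hF.
pose tau : R := n.+1%:R^-1; have tau0 : 0 < tau by rewrite invr_gt0.
exists (tau * (e / 2)); first by rewrite mulr_gt0.
move=> B mB muB; set N := [set x | J x <= 0].
pose B' := B `\` [set x | J x <= tau].
have mB' : measurable B' by exact: measurableD.
have mF : measurable (F n) by exact: measurableD.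
apply: (@le_trans _ _ (fine (kappa (F n `|` B')))).
  apply: fine_measure_le; [by apply: measurableD => //; exact: mle|exact: measurableU|].
  by move=> x [Bx nN]; have [h|h] := pselect (J x <= tau); [left|right].
apply: (le_trans (fine_measureU_le _ mF mB')).
rewrite (splitr e); apply: lerD; first exact: ltW.
rewrite -(ler_pM2l tau0); apply: le_trans muB.
apply: (@le_trans _ _ (fine (mu B'))); last first.
  by apply: fine_measure_le => // x [].
rewrite -JI// -int_cst//; apply: int_le => //; first exact: bmf_cst.
by move=> x [_ /= /negP]; rewrite -ltNge => /ltW.
Qed.

Lemma fin_min (T : finType) (r : T -> R) : (forall t, 0 < r t) ->
  exists2 d : R, 0 < d & forall t, d <= r t.
Proof.
move=> r0; pose S := 1 + \sum_t (r t)^-1.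
have S0 : 0 < S by rewrite ltr_pwDl// sumr_ge0// => t _; rewrite invr_ge0 ltW.
exists S^-1; first by rewrite invr_gt0.
move=> t; rewrite -[leRHS]invrK lef_pV2 ?posrE ?invr_gt0//.
rewrite /S (bigD1 t)//= addrCA lerDl addr_ge0// sumr_ge0// => k _.
by rewrite invr_ge0 ltW.
Qed.

(** By [words_singular] most words of a suitable length map an open set of nearly full measure to
   a small set. The arcs around most points are contained in that open set as soon as they are
   short, and by the weak type inequality few of them are bad. *)
Lemma bad_small e t : 0 < e -> 0 < t -> exists N (delta : R), [/\ (0 < N)%N, 0 < delta, delta <= 8^-1 &
  Ew p N (fun v => fine (mu (bad v t delta))) <= e].
Proof.
move=> e0 t0.
have [s [bs s0 sI sE]] := words_singular p_gt0 p_sum1 mg mginv gK ginvK mu_inv mu_noinv.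
have [N0 [mN0 muN0] N0P] := absolutely_continuous_part.
pose e1 := Num.min (e / 4) (e * t / 32).
have e10 : 0 < e1 by rewrite lt_min !divr_gt0// mulr_gt0.
have e11 : e1 <= e / 4 by rewrite ge_min lexx.
have e12 : 8 / t * e1 <= e / 4.
  rewrite mulrAC ler_pdivrMr//.
  have : e1 <= e * t / 32 by rewrite ge_min lexx orbT.
  lra.
have [rho rho0 HN0] := N0P e1 e10.
pose eta := Num.min rho e1; have eta0 : 0 < eta by rewrite lt_min rho0.
have eta1 : eta <= rho by rewrite ge_min lexx.
have eta2 : eta <= e1 by rewrite ge_min lexx orbT.
have [N' /(_ N'.+1 (leqnSn N'))] := sE _ (mulr_gt0 eta0 eta0).
set N := N'.+1 => HN.
pose I1 v := \int[mu]_x s v x.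
have I10 v : 0 <= I1 v by apply: int_ge0 => x _.
have EI1 : Ew p N I1 < eta * eta.
  by apply: le_lt_trans HN; rewrite int_Ew.
(* [B] is the part of the circle where the image of [mu] by the word has a density above 1; it is
     small for [mu], and also for [kappa] once the part of [kappa] singular to [mu] is removed,
     and it carries the image of [mu] up to [e1] *)
have good v : I1 v <= eta -> exists U r, [/\ open U, 0 < r,
    fine (kappa (gwi v @^-1` U)) <= 2 * e1 & fine (mu (~` shrink U r)) <= 2 * e1].
  move=> Iv; have [la laE] := image_measure v.
  pose B := [set x | 1 < s v x] `\` N0.
  have mB1 : measurable [set x | 1 < s v x].
    by apply: measurable_strict_superlevel; case: (bs v).
  have mB : measurable B by exact: measurableD.
  have muB1 : fine (mu [set x | 1 < s v x]) <= eta.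
    apply: le_trans Iv; rewrite -[leLHS]mul1r; apply: markov_ineq => //.
    by move=> x /= /ltW.
  have kB : fine (kappa B) <= e1 by apply: HN0 => //; exact: le_trans muB1 eta1.
  pose A := gw g v @^-1` B.
  have mgw' D : measurable D -> measurable (gw g v @^-1` D) by exact: mpregw.
  have mA : measurable A by exact: mgw'.
  have muAC : fine (mu (~` A)) <= e1.
    have -> : ~` A = (gw g v @^-1` [set x | s v x <= 1]) `|` (gw g v @^-1` N0).
      apply/seteqP; split=> x /=.
        move=> h; have [Nx|nNx] := pselect (N0 (gw g v x)); first by right.
        by left; rewrite leNgt; apply/negP => h'; apply: h.
      by move=> [h|h] [/= h1 h2] //; move: h1; rewrite ltNge h.
    have mle : measurable [set x | s v x <= 1] by apply: measurable_sublevel; case: (bs v).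
    apply: (le_trans (fine_measureU_le _ (mgw' _ mle) (mgw' _ mN0))).
    have -> : fine (mu (gw g v @^-1` N0)) = 0.
      rewrite -sI//; apply/eqP; rewrite eq_le int_ge0 ?andbT; last first.
        by move=> x _; exact: sqr_ge0.
      have [_ [M sM]] := bs v.
      apply: (@le_trans _ _ (\int[mu]_(x in N0) (M ^+ 2))).
        apply: int_le => //; [by apply: bmfM|exact: bmf_cst|].
        by move=> x _; have := sM x; rewrite ger0_norm// => h; rewrite !expr2 ler_pM.
      by rewrite int_cst// [X in fine X]muN0 mulr0.
    rewrite addr0 -sI//; apply: le_trans eta2; apply: le_trans Iv.
    rewrite -(int_indicM mu _ mle); apply: int_le => //.
      by apply: bmfM; [exact: bmfM|exact: bmf_indic].
    move=> x _; rewrite indicE; case: (boolP (x \in _)) => xs; rewrite ?mulr0 ?mulr1//.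
    by move: xs; rewrite inE/= => xs; rewrite expr2 ler_piMr.
  have [U [oU AU hU]] := outer_regular la mA e10.
  have mU := open_measurable_circle oU.
  have laA : fine (la A) <= e1.
    rewrite laE (_ : gwi v @^-1` A = B)//.
    by apply/seteqP; split=> x; rewrite /A /=; rewrite gwiK.
  have [r r0 hr] := shrink_approx mu oU e10.
  exists U, r; split => //.
    rewrite -laE (fine_measure_split la mU mA) (_ : U `&` A = A); last first.
      by apply/setIidPr.
    by have := ltW hU; lra.
  have mS : measurable (shrink U r) by apply: closed_measurable_circle; exact: closed_shrink.
  have mUS : measurable (U `\` shrink U r) by exact: measurableD.
  apply: (@le_trans _ _ (fine (mu (~` A `|` (U `\` shrink U r))))).
    apply: fine_measure_le; [exact: measurableC|apply: measurableU => //; exact: measurableC|].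
    move=> x nS; have [Ax|nAx] := pselect (A x); last by left.
    by right; split=> //; exact: AU.
  apply: (le_trans (fine_measureU_le _ (measurableC mA) mUS)).
  by have := ltW hr; lra.
have /choice[r rP] : forall v, exists r, 0 < r /\ (I1 v <= eta -> exists U, [/\ open U,
    fine (kappa (gwi v @^-1` U)) <= 2 * e1 & fine (mu (~` shrink U r)) <= 2 * e1]).
  move=> v; have [h|h] := pselect (I1 v <= eta); last by exists 1; split.
  by have [U [r [oU r0 h1 h2]]] := good v h; exists r; split=> // _; exists U.
have [d0 d00 d0r] := fin_min (fun v : N.-tuple I => (rP v).1).
pose delta := Num.min (d0 / 4) 8^-1.
have delta0 : 0 < delta by rewrite lt_min divr_gt0//=.
have delta8 : delta <= 8^-1 by rewrite ge_min lexx orbT.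
have delta4 : 4 * delta <= d0.
  have h : delta <= d0 / 4 by rewrite ge_min lexx.
  by lra.
exists N, delta; split => //.
have mu1 A : measurable A -> fine (mu A) <= 1.
  by move=> mA; rewrite -(probT1 mu); exact: fine_measure_le.
(* the first term accounts for the words with a large half-density, by Chebyshev's inequality *)
have key v : size v = N -> fine (mu (bad v t delta)) <= eta^-1 * I1 v + (2 * e1 + 8 / t * e1).
  move=> sv; have [h|h] := leP (I1 v) eta; last first.
    have h1 : 1 <= eta^-1 * I1 v by rewrite mulrC ler_pdivlMr// mul1r ltW.
    have h2 : 0 <= 2 * e1 + 8 / t * e1.
      by rewrite addr_ge0// mulr_ge0 ?ltW// divr_gt0.
    by have := mu1 _ (mbad v t delta); lra.
  have [U [oU kU mS]] := (rP v).2 h.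
  have mU := open_measurable_circle oU.
  pose W := \bigcup_(J in [set J | bad_arc v t delta J /\ J `<=` U]) J.
  have mW : measurable W.
    by apply: open_measurable_circle; apply: bigcup_open => J [[]].
  have mS' : measurable (~` shrink U (r v)).
    by apply: measurableC; apply: closed_measurable_circle; exact: closed_shrink.
  have rv : d0 <= r v by have := d0r (Tuple (introT eqP sv)).
  apply: (@le_trans _ _ (fine (mu (~` shrink U (r v) `|` W)))).
    apply: fine_measure_le; [exact: mbad|exact: measurableU|].
    move=> x [J bJ Jx]; have [Sx|nSx] := pselect (shrink U (r v) x); last by left.
    right; exists J => //; split=> // y Jy; apply: Sx.
    have [oJ cJ kJ _] := bJ.
    apply: le_lt_trans (small_kappa (open_measurable_circle oJ) cJ Jx Jy) _.
    lra.
  apply: (le_trans (fine_measureU_le _ mS' mW)).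
  have := bad_weak_type v t0 delta8 mU; rewrite -/W => hW.
  have h0 : 0 <= eta^-1 * I1 v by rewrite mulr_ge0// invr_ge0 ltW.
  have h4 : 4 / t * fine (kappa (gwi v @^-1` U)) <= 8 / t * e1.
    have -> : 8 / t * e1 = 4 / t * (2 * e1) by ring.
    by rewrite ler_pM2l// divr_gt0.
  lra.
apply: (le_trans (Ew_le p_ge0 key)).
rewrite EwD EwZ Ew_cst//.
have : eta^-1 * Ew p N I1 <= eta by rewrite mulrC ler_pdivrMr// ltW.
lra.
Qed.

(** The exponent [m v x] counts the integers j such that [x] lies on an arc that [v] does not
   contract by exp (j - 2). The j-th of these events has probability at most e, by the choice of
   the word length, and at most D exp (- j), by the weak type inequality; the geometric mean of
   the two bounds decays like exp (- j / 2) with a small factor, so that [m] has mean below 1.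
   Words of length [N] distort [kappa] by a bounded factor, hence finitely many j matter. *)
Lemma mean_contraction : exists (N : nat) (delta : R) (m : seq I -> C -> R),
  [/\ (0 < N)%N /\ 0 < delta, forall v, bmf (m v), forall v x, 0 <= m v x,
      \int[mu]_x Ew p N (fun v => m v x) < 1 &
      forall v x J, size v = N -> open J -> connected J -> J x -> fine (kappa J) < delta ->
        fine (kappa (gw g v @` J)) <= expR (m v x - 2) * fine (kappa J)].
Proof.
pose K := fine (kappa setT); have K0 : 0 <= K by rewrite fine_ge0.
pose t (j : nat) : R := expR (j%:R - 2).
have t0 j : 0 < t j by exact: expR_gt0.
pose D := 4 * K * expR 2; have D0 : 0 <= D by rewrite !mulr_ge0// expR_ge0.
pose e := (16 * (D + 1))^-1; have e0 : 0 < e by rewrite invr_gt0; nra.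
have [N [delta [N0 delta0 delta8 hbad]]] := bad_small e0 (t0 0%N).
pose cst := (\sum_j 2 / p j) ^+ N.
pose Jm := (Num.bound `|cst|).+1.
have tJm : cst <= t Jm.
  rewrite (le_trans (ler_norm _))// (le_trans (ltW (archi_boundP (normr_ge0 _))))//.
  rewrite /t /Jm (le_trans _ (expR_ge1Dx _))// -natr1; lra.
pose m v x : R := \sum_(j < Jm) \1_(bad v (t j) delta) x.
have bm v : bmf (m v) by apply: bmf_sum => j; apply: bmf_indic; exact: mbad.
have m0 v x : 0 <= m v x by apply: sumr_ge0.
exists N, delta, m; split => //.
  pose b j := Ew p N (fun v => fine (mu (bad v (t j) delta))).
  have -> : \int[mu]_x Ew p N (fun v => m v x) = \sum_(j < Jm) b j.
    rewrite int_Ew// -(Ew_sum p_sum1 N _ (fun (j : 'I_Jm) v => fine (mu (bad v (t j) delta)))).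
    apply: eq_Ew => v _; rewrite int_sum//; last first.
      by move=> j; apply: bmf_indic; exact: mbad.
    by apply: eq_bigr => j _; rewrite int_indic.
  have b0 j : 0 <= b j by apply: Ew_ge0 => // v _; rewrite fine_ge0.
  have be j : b j <= e.
    apply: le_trans hbad; apply: Ew_le => // v _; apply: fine_measure_le => //.
    by apply: bad_decr; rewrite /t ler_expR lerD2r ler_nat.
  pose y : R := expR (- 2^-1).
  have y0 : 0 <= y by exact: expR_ge0.
  have y1 : y <= 2 / 3.
    have h : (3 / 2 : R) <= expR 2^-1 by apply: le_trans (expR_ge1Dx _); lra.
    have : y * expR 2^-1 = 1 by rewrite -expRD addNr expR0.
    nra.
  have bD j : b j <= D * (y ^+ j * y ^+ j).
    rewrite -(Ew_cst p_sum1 N (D * _)); apply: Ew_le => // v _.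
    apply: le_trans (bad_weak_type_all v (t0 j) delta8) _.
    have -> : D * (y ^+ j * y ^+ j) = 4 / t j * K; last by [].
    have -> : (t j)^-1 = expR 2 * (y ^+ j * y ^+ j).
      by rewrite /t -expRN -exprD -expRM_natl -expRD natrD; congr expR; lra.
    rewrite /D; ring.
  have by4 j : b j <= 4^-1 * y ^+ j.
    have yj : 0 <= y ^+ j by exact: exprn_ge0.
    have eD : 16 * e * (D + 1) = 1 by rewrite /e; field; lra.
    have := be j; have := bD j; have := b0 j.
    set bj := b j; set yy := y ^+ j.
    move=> h0 h1 h2.
    have : bj ^+ 2 <= (4^-1 * yy) ^+ 2.
      have : bj ^+ 2 <= e * (D * (yy * yy)) by rewrite expr2 ler_pM.
      have : 16 * (e * D) <= 1 by lra.
      have : 0 <= yy * yy by rewrite mulr_ge0.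
      nra.
    by rewrite ler_sqr ?nnegrE// mulr_ge0.
  have geo n : \sum_(j < n) y ^+ j <= 3 - 3 * y ^+ n.
    elim: n => [|n IH]; first by rewrite big_ord0 expr0; lra.
    rewrite big_ord_recr/= exprS; have yn : 0 <= y ^+ n by exact: exprn_ge0.
    nra.
  apply: (@le_lt_trans _ _ (\sum_(j < Jm) 4^-1 * y ^+ j)).
    by apply: ler_sum => j _.
  rewrite -mulr_sumr; have := geo Jm; have : 0 <= y ^+ Jm by exact: exprn_ge0.
  lra.
move=> v x J sv oJ cJ Jx kJ; rewrite gw_image.
have mJ := open_measurable_circle oJ.
have kJ0 : 0 <= fine (kappa J) by rewrite fine_ge0.
pose P q := fine (kappa (gwi v @^-1` J)) <= t q * fine (kappa J).
have PJ : P Jm.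
  apply: le_trans (distortion v mJ) _; rewrite sv ler_wpM2r//.
have exP : exists q, P q by exists Jm.
case: (ex_minnP exP) => q Pq qmin.
apply: le_trans Pq _; rewrite ler_wpM2r// /t ler_expR lerD2r.
have qJ : (q <= Jm)%N by exact: qmin.
have inbad (j : nat) : (j < q)%N -> bad v (t j) delta x.
  move=> jq; exists J => //; split => //; rewrite ltNge; apply/negP => h.
  by have := qmin _ h; rewrite leqNgt jq.
rewrite /m (bigID (fun j : 'I_Jm => (j < q)%N))/=.
rewrite -[leLHS]addr0 lerD//; last exact: sumr_ge0.
rewrite (big_ord_narrow qJ)/= -[q in leLHS]card_ord -sumr_const.
by apply: ler_sum => i _; rewrite indicE mem_set//; exact: inbad.
Qed.

End mean_contraction.

(** * The maximal ergodic inequality *)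

Section maximal_ergodic.
Context {d : measure_display} {T : measurableType d} {R : realType} {I : finType}.
Variables (p : I -> R) (g : I -> T -> T) (mu : probability T R).
Hypothesis p_ge0 : forall i, 0 <= p i.
Hypothesis p_sum1 : \sum_i p i = 1.
Hypothesis mg : forall i, measurable_fun setT (g i).
Hypothesis mu_inv : forall A, measurable A ->
  \sum_i p i * fine (mu (g i @^-1` A)) = fine (mu A).
Variable Y : I -> T -> R.
Hypothesis bY : forall i, bmf (Y i).
Hypothesis Y_geN1 : forall i x, - 1 <= Y i x.

(** The maximum of the partial sums of [Y] along the trajectory of [x], the empty sum included. *)
Fixpoint maxsum (v : seq I) (x : T) : R :=
  if v is i :: v' then Num.max 0 (Y i x + maxsum v' (g i x)) else 0.

Lemma maxsum_ge0 v x : 0 <= maxsum v x.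
Proof. by case: v => [|i v] //=; rewrite le_max lexx. Qed.

Lemma bmf_maxsum v : bmf (maxsum v).
Proof.
elim: v => [|i v IH]; first exact: bmf_cst.
apply: bmf_max; first exact: bmf_cst.
by apply: bmfD => //; exact: bmf_comp (mg i) IH.
Qed.

Lemma maxsum_rcons v i x : maxsum v x <= maxsum (rcons v i) x.
Proof.
elim: v x => [|j v IH] x; first exact: maxsum_ge0.
by rewrite /= ge_max !le_max lexx/= lerD2l IH orbT.
Qed.

Definition calm v x : R := ((maxsum v x <= 0)%R : nat)%:R.

Lemma calm01 v x : 0 <= calm v x <= 1.
Proof. by rewrite /calm; case: (maxsum v x <= 0)%R => /=; rewrite ?lexx ?ler01. Qed.

Lemma bmf_calm v : bmf (calm v).
Proof.
have -> : calm v = \1_[set x | maxsum v x <= 0].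
  apply/funext => x; rewrite /calm indicE; congr ((nat_of_bool _)%:R).
  by apply/idP/idP; rewrite inE.
by apply: bmf_indic; apply: measurable_sublevel; case: (bmf_maxsum v).
Qed.

Definition calm_prob n x := Ew p n (fun v => calm v x).

Lemma bmf_calm_prob n : bmf (calm_prob n).
Proof. by apply: bmf_Ew => v; exact: bmf_calm. Qed.

Lemma calm_prob_decr n x : calm_prob n.+1 x <= calm_prob n x.
Proof.
rewrite /calm_prob Ew_rcons//; apply: Ew_le => // v _.
apply: (@le_trans _ _ (\sum_i p i * calm v x)); last by rewrite -mulr_suml p_sum1 mul1r.
apply: ler_sum => i _; rewrite ler_wpM2l// /calm.
have h := maxsum_rcons v i x.
case: (leP (maxsum (rcons v i) x) 0) => h'; last by rewrite ler0n.
by rewrite (le_trans h h').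
Qed.

(** Garsia's argument. Along a trajectory, the maximum from the first point minus the maximum from
   the second one is the first increment if the former is positive; otherwise it is at most 0,
   hence at most the increment plus 1. By stationarity the mean of this difference is
   nonnegative. *)
Lemma maximal_ergodic n :
  - (\int[mu]_x (\sum_i p i * Y i x)) <= \int[mu]_x calm_prob n.+1 x.
Proof.
pose F m x := Ew p m (fun v => maxsum v x).
have bF m : bmf (F m) by apply: bmf_Ew => v; exact: bmf_maxsum.
have bsY : bmf (fun x => \sum_i p i * Y i x) by apply: bmf_sum => i; exact: bmfZ.
have bUF : bmf (Uop p g (F n)) by exact: bmf_Uop.
have bc := bmf_calm_prob n.+1.
have pw x : F n.+1 x - Uop p g (F n) x - calm_prob n.+1 x <= \sum_i p i * Y i x.
  rewrite /F /Uop /calm_prob /= -!sumrB; apply: ler_sum => i _.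
  rewrite -!mulrBr ler_wpM2l// -!EwB -[leRHS](Ew_cst p_sum1 n).
  apply: Ew_le => // v _ /=; rewrite /calm /=.
  have hY := Y_geN1 i x; have hm := maxsum_ge0 v (g i x).
  case: (leP (Y i x + maxsum v (g i x)) 0) => h.
    by rewrite lexx/=; lra.
  have -> : (Y i x + maxsum v (g i x) <= 0) = false by apply/negbTE; rewrite -ltNge.
  by rewrite /= subr0 addrK.
have FF : \int[mu]_x F n x <= \int[mu]_x F n.+1 x.
  apply: int_le => // x _; rewrite /F Ew_rcons//; apply: Ew_le => // v _.
  apply: (@le_trans _ _ (\sum_i p i * maxsum v x)).
    by rewrite -mulr_suml p_sum1 mul1r.
  by apply: ler_sum => i _; rewrite ler_wpM2l// maxsum_rcons.
have h : \int[mu]_x (F n.+1 x - Uop p g (F n) x - calm_prob n.+1 x) <=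
    \int[mu]_x (\sum_i p i * Y i x).
  by apply: int_le => //; apply: bmfB => //; exact: bmfB.
rewrite intB// in h; last exact: bmfB.
rewrite intB// int_Uop// in h.
lra.
Qed.

(** The probability that no partial sum is positive decreases with the length. If it had a small
   limit at every point, its mean would contradict [maximal_ergodic] for long words. *)
Lemma calm_point : \int[mu]_x (\sum_i p i * Y i x) < 0 ->
  exists x, exists2 eta, 0 < eta & forall n, eta <= calm_prob n x.
Proof.
set c := \int[mu]_x _ => c0; pose eta := - c / 2.
have eta0 : 0 < eta by rewrite /eta; lra.
apply: contrapT => /forallNP H.
pose F n := [set x | eta <= calm_prob n.+1 x].
have mF n : measurable (F n) by apply: measurable_superlevel; case: (bmf_calm_prob n.+1).
have cF : fine (mu (F n)) @[n --> \oo] --> (0 : R).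
  apply: measure_decr_cvg => //.
    by move=> n x /= h; apply: le_trans h _; exact: calm_prob_decr.
  rewrite -subset0 => x Hx; apply: (H x); exists eta => // n.
  by apply: le_trans (calm_prob_decr n x); exact: (Hx n Logic.I).
have /cvgrPdist_lt/(_ _ eta0)[n _ Hn] := cF.
have := Hn n (leqnn n); rewrite sub0r normrN ger0_norm ?fine_ge0// => hF.
have := maximal_ergodic n; rewrite -/c; apply/negP; rewrite -ltNge.
apply: (@le_lt_trans _ _ (\int[mu]_x (eta + \1_(F n) x))).
  apply: int_le => //; [exact: bmf_calm_prob|by apply: bmfD; [exact: bmf_cst|exact: bmf_indic]|].
  move=> x _; rewrite indicE; case: (boolP (x \in F n)) => xF /=.
    have : calm_prob n.+1 x <= 1.
      by rewrite -[leRHS](Ew_cst p_sum1 n.+1); apply: Ew_le => // v _; case/andP: (calm01 v x).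
    lra.
  rewrite addr0 leNgt; apply: contra xF => h; rewrite inE; exact: ltW.
rewrite intD//; [|exact: bmf_cst|exact: bmf_indic].
rewrite int_indic// int_cst// probT1 mulr1.
by rewrite /eta in hF *; lra.
Qed.

End maximal_ergodic.

(** * The Poisson equation *)

Lemma expR_geometric (R : realType) M : \sum_(k < M) expR (- k%:R) <= 2 :> R.
Proof.
pose y : R := expR (-1).
have y0 : 0 <= y by exact: expR_ge0.
have y1 : y <= 2^-1.
  have h : (2 : R) <= expR 1 by apply: le_trans (expR_ge1Dx _); lra.
  have : y * expR 1 = 1 by rewrite -expRD addNr expR0.
  nra.
have -> : \sum_(k < M) expR (- k%:R) = \sum_(k < M) y ^+ k.
  by apply: eq_bigr => k _; rewrite -expRM_natl mulrN1.
suff h : \sum_(k < M) y ^+ k <= 2 - 2 * y ^+ M.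
  have : 0 <= y ^+ M by exact: exprn_ge0.
  lra.
elim: M => [|M IH]; first by rewrite big_ord0 expr0; lra.
rewrite big_ord_recr/= exprS; have : 0 <= y ^+ M by exact: exprn_ge0.
nra.
Qed.

Section poisson.
Variables (R : realType) (I : finType).
Local Notation C := (circle R).
Variables (p : I -> R) (g ginv : I -> C -> C) (mu : probability C R).
Hypothesis p_gt0 : forall i, 0 < p i.
Hypothesis p_sum1 : \sum_i p i = 1.
Hypothesis cg : forall i, continuous (g i).
Hypothesis cginv : forall i, continuous (ginv i).
Hypothesis gK : forall i, cancel (g i) (ginv i).
Hypothesis ginvK : forall i, cancel (ginv i) (g i).
Hypothesis mu_inv : forall A, measurable A ->
  \sum_i p i * fine (mu (g i @^-1` A)) = fine (mu A).
Hypothesis mu_noinv : noinv (R := R) g.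

Variable kappa : {finite_measure set C -> \bar R}.
Hypothesis mu_kappa : forall A, measurable A -> fine (mu A) <= 2 * fine (kappa A).
Hypothesis leb_kappa : forall A, measurable A -> fine (leb R A) <= 2 * fine (kappa A).
Hypothesis kappa_back : forall A, measurable A ->
  \sum_i p i * fine (kappa (ginv i @^-1` A)) <= 2 * fine (kappa A).
Hypothesis kappa_nonatomic : forall x, kappa [set x] = 0%E.

(** Every large time is allowed, so that two independent trajectories can be required to visit [O]
   at the same time. *)
Hypothesis hitting : forall O : set C, open O -> O !=set0 ->
  exists n0, forall n, (n0 <= n)%N -> exists2 c : R, 0 < c &
    forall x, c <= Ew p n (fun v => \1_O (gw g v x)).

Let p_ge0 i : 0 <= p i. Proof. exact: ltW. Qed.

Let mg i : measurable_fun setT (g i). Proof. exact: continuous_measurable_map. Qed.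

Let kappa_ge0 A : 0 <= fine (kappa A). Proof. by rewrite fine_ge0. Qed.

(** Functions that are Lipschitz for the length [kappa] of arcs; this class contains the
   Lipschitz functions and is stable under the Markov operator and under products. *)
Definition arc_lip (f : C -> R) : Prop := bmf f /\ exists2 L, 0 <= L &
  forall J x y, open J -> connected J -> J x -> J y -> `|f x - f y| <= L * fine (kappa J).

Lemma arc_lip_cst c : arc_lip (fun=> c).
Proof.
split; first exact: bmf_cst.
by exists 0 => // *; rewrite subrr normr0 mul0r.
Qed.

Lemma arc_lipD f h : arc_lip f -> arc_lip h -> arc_lip (fun x => f x + h x).
Proof.
move=> [bf [L L0 fL]] [bh [M M0 hM]]; split; first exact: bmfD.
exists (L + M) => [|J x y oJ cJ Jx Jy]; first exact: addr_ge0.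
rewrite opprD addrACA (le_trans (ler_normD _ _))// mulrDl.
by apply: lerD; [exact: fL|exact: hM].
Qed.

Lemma arc_lipM f h : arc_lip f -> arc_lip h -> arc_lip (fun x => f x * h x).
Proof.
move=> [bf [L L0 fL]] [bh [M M0 hM]]; split; first exact: bmfM.
have [_ [F fF]] := bf; have [_ [H hH]] := bh.
have F0 : 0 <= F by exact: le_trans (fF point).
have H0 : 0 <= H by exact: le_trans (hH point).
exists (H * L + F * M) => [|J x y oJ cJ Jx Jy]; first by rewrite addr_ge0// mulr_ge0.
have -> : f x * h x - f y * h y = h x * (f x - f y) + f y * (h x - h y) by ring.
rewrite (le_trans (ler_normD _ _))// !normrM mulrDl -!mulrA.
by apply: lerD; apply: ler_pM => //; [exact: fL|exact: hM].
Qed.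

Lemma arc_lipZ c f : arc_lip f -> arc_lip (fun x => c * f x).
Proof. by move=> lf; apply: arc_lipM => //; exact: arc_lip_cst. Qed.

Lemma arc_lip_sum (J : Type) (s : seq J) (F : J -> C -> R) :
  (forall j, arc_lip (F j)) -> arc_lip (fun x => \sum_(j <- s) F j x).
Proof.
move=> lF; elim: s => [|j s IH].
  by under eq_fun do rewrite big_nil; exact: arc_lip_cst.
by under eq_fun do rewrite big_cons; exact: arc_lipD.
Qed.

(** A single application may double the Lipschitz constant, so that this bound alone says nothing
   about the sum of the iterates. *)
Lemma arc_lip_Uop f : arc_lip f -> arc_lip (Uop p g f).
Proof.
move=> [bf [L L0 fL]]; split; first exact: bmf_Uop.
exists (2 * L) => [|J x y oJ cJ Jx Jy]; first by rewrite mulr_ge0.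
have mJ := open_measurable_circle oJ.
rewrite /Uop -sumrB (le_trans (ler_norm_sum _ _ _))//.
apply: (@le_trans _ _ (\sum_i p i * (L * fine (kappa (ginv i @^-1` J))))).
  apply: ler_sum => i _; rewrite -mulrBr normrM (ger0_norm (p_ge0 i)) ler_wpM2l//.
  apply: fL.
  - by apply: open_comp => // z _; exact: cginv.
  - rewrite -(gw_image gK ginvK [:: i]).
    exact: (connected_gw_image cg).
  - by rewrite /= gK.
  - by rewrite /= gK.
under eq_bigr do rewrite mulrCA.
rewrite -mulr_sumr [2 * L]mulrC -mulrA ler_wpM2l//.
exact: kappa_back.
Qed.

Lemma arc_lip_iter n f : arc_lip f -> arc_lip (iter n (Uop p g) f).
Proof. by move=> lf; elim: n => [//|n IH]; exact: arc_lip_Uop. Qed.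

Section blocks.
Variables (N : nat) (delta : R) (m : seq I -> C -> R).
Hypothesis N_gt0 : (0 < N)%N.
Hypothesis delta_gt0 : 0 < delta.
Hypothesis bm : forall v, bmf (m v).
Hypothesis m_ge0 : forall v x, 0 <= m v x.
Hypothesis m_mean : \int[mu]_x Ew p N (fun v => m v x) < 1.
Hypothesis contr : forall v x J, size v = N -> open J -> connected J -> J x -> fine (kappa J) < delta ->
  fine (kappa (gw g v @` J)) <= expR (m v x - 2) * fine (kappa J).

(* The words of length [N] are the letters of a new system. A letter stretches the arcs through [x]
   at most by exp (Y - 1); where no partial sum of [Y] is positive, short arcs shrink like
   exp (- j) along the trajectory. *)
Local Notation W := (N.-tuple I).
Let q (t : W) : R := pw p t.
Let G (t : W) : C -> C := gw g t.
Let Y (t : W) x : R := m t x - 1.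

Let q_ge0 t : 0 <= q t. Proof. exact: pw_ge0. Qed.
Let q_sum1 : \sum_t q t = 1. Proof. exact: pw_sum1. Qed.

Let mG t : measurable_fun setT (G t). Proof. exact: mgw. Qed.

Let q_inv A : measurable A -> \sum_t q t * fine (mu (G t @^-1` A)) = fine (mu A).
Proof. by move=> mA; rewrite -(mu_gw p_gt0 p_sum1 mg mu_inv mA N) Ew_tuple. Qed.

Local Notation T := (Uop q G).

Lemma block_Uop f : T f = iter N (Uop p g) f.
Proof. by apply/funext => x; rewrite iter_Uop Ew_tuple. Qed.

Lemma block_iter n f : iter n T f = iter (n * N) (Uop p g) f.
Proof. by elim: n f => [//|n IH] f; rewrite iterS IH block_Uop mulSn iterD. Qed.

Lemma calm_start : exists x, exists2 eta : R, 0 < eta & forall n, eta <= calm_prob q G Y n x.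
Proof.
apply: (calm_point q_ge0 q_sum1 mG q_inv).
- by move=> t; apply: bmfB => //; exact: bmf_cst.
- by move=> t x; rewrite /Y lerBrDr addNr.
rewrite (_ : \int[mu]_x _ = \int[mu]_x (Ew p N (fun v => m v x) - 1)); last first.
  apply: eq_Rintegral => x _; rewrite Ew_tuple -q_sum1 -sumrB.
  by apply: eq_bigr => t _; rewrite /Y mulrBr mulr1.
rewrite intB//; [|exact: bmf_Ew|exact: bmf_cst].
have -> : \int[mu]_x (1 : R) = 1 by rewrite int_prob_cst.
by rewrite subr_lt0.
Qed.

Variable f : C -> R.
Hypothesis lf : arc_lip f.
Hypothesis f_mean0 : \int[mu]_x f x = 0.

Let S M x y := \sum_(k < M) `|iter k T f x - iter k T f y|.

Let S_ge0 M x y : 0 <= S M x y. Proof. exact: sumr_ge0. Qed.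

Let S_mono M M' x y : (M <= M')%N -> S M x y <= S M' x y.
Proof.
move=> MM'; rewrite /S -(subnKC MM') big_split_ord/= lerDl.
exact: sumr_ge0.
Qed.

Let S_rec M x y : S M.+1 x y <= `|f x - f y| + \sum_t q t * S M (G t x) (G t y).
Proof.
rewrite /S big_ord_recl/= lerD2l.
under [leRHS]eq_bigr do rewrite mulr_sumr.
rewrite exchange_big/=; apply: ler_sum => k _.
rewrite add0n {1 2}/Uop -sumrB (le_trans (ler_norm_sum _ _ _))//.
by apply: ler_sum => t _; rewrite -mulrBr normrM (ger0_norm (q_ge0 t)).
Qed.

Let P M s x := Ew q M (fun v => ((s + maxsum G Y v x <= 0)%R : nat)%:R : R).

Let P01 M s x : 0 <= P M s x <= 1.
Proof.
apply/andP; split; first by apply: Ew_ge0 => // v _; exact: ler0n.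
rewrite -[leRHS](Ew_cst q_sum1 M); apply: Ew_le => // v _.
by case: (_ <= 0)%R.
Qed.

(** Here [J] is the image of a short arc by the [j] letters read so far, [x] the reference
   trajectory on it, and [s] the sum of [Y] over these letters. As long as no partial sum is
   positive, [x'] and [y'] lie on a common arc of length at most delta / 2 * exp (- j), on which
   [f] varies little; on the complementary event the a priori bound [A] takes over. *)
Lemma contraction_induction (L A : R) (Mt : nat) : 0 <= L -> 0 <= A ->
  (forall J x y, open J -> connected J -> J x -> J y -> `|f x - f y| <= L * fine (kappa J)) ->
  (forall x y, S Mt x y <= A) ->
  forall M j s J x x' y', (M <= Mt)%N -> open J -> connected J -> J x -> J x' -> J y' ->
    fine (kappa J) <= delta / 2 * expR (s - j%:R) ->
    S M x' y' <= L * (delta / 2) * (\sum_(k < M) expR (- (j + k)%:R)) + (1 - P M s x) * A.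
Proof.
move=> L0 A0 fL SA; elim=> [|M IH] j s J x x' y' MMt oJ cJ Jx Jx' Jy' kJ.
  rewrite /S !big_ord0 mulr0 add0r mulr_ge0// subr_ge0.
  by case/andP: (P01 0 s x).
have E0 n : 0 <= L * (delta / 2) * (\sum_(k < n) expR (- (j + k)%:R)).
  apply: mulr_ge0; first by rewrite mulr_ge0// ltW// divr_gt0.
  by apply: sumr_ge0 => k _; exact: expR_ge0.
have [s0|s0] := leP s 0; last first.
  have -> : P M.+1 s x = 0.
    rewrite /P -[RHS](Ew_cst q_sum1 M.+1 0); apply: eq_Ew => v _.
    by rewrite leNgt (lt_le_trans s0)// lerDl maxsum_ge0.
  rewrite subr0 mul1r -[leLHS]add0r lerD//.
  exact: le_trans (S_mono x' y' MMt) (SA _ _).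
have ej : expR (s - j%:R) <= expR (- j%:R) by rewrite ler_expR; lra.
have d2 : 0 < delta / 2 by rewrite divr_gt0.
have kJd : fine (kappa J) < delta.
  apply: le_lt_trans kJ _; have e1 : expR (s - j%:R) <= 1.
    by rewrite -expR0 ler_expR subr_le0 (le_trans s0)// ler0n.
  have := expR_ge0 (s - j%:R); nra.
apply: (le_trans (S_rec _ _ _)).
rewrite big_ord_recl/= addn0 mulrDr -addrA; apply: lerD.
  apply: (le_trans (fL J _ _ oJ cJ Jx' Jy')).
  by rewrite -mulrA ler_wpM2l// (le_trans kJ)// ler_wpM2l// ltW.
have PS : P M.+1 s x = \sum_t q t * P M (s + Y t x) (G t x).
  rewrite /P /=; apply: eq_bigr => t _; congr (_ * _); apply: eq_Ew => v _.
  congr ((nat_of_bool _)%:R); rewrite -[X in _ = (X <= 0)]addrA.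
  case: (leP 0 (Y t x + maxsum G Y v (G t x))) => // h.
  by rewrite addr0 s0; apply/esym; lra.
rewrite PS; apply: (@le_trans _ _ (\sum_t q t * (L * (delta / 2) *
    (\sum_(k < M) expR (- (j.+1 + k)%:R)) + (1 - P M (s + Y t x) (G t x)) * A))).
  apply: ler_sum => t _; rewrite ler_wpM2l//.
  apply: (IH j.+1 (s + Y t x) (gw g t @` J) (G t x)).
  - exact: ltnW.
  - exact: (open_gw_image cginv gK ginvK).
  - exact: (connected_gw_image cg).
  - by exists x.
  - by exists x'.
  - by exists y'.
  apply: (le_trans (contr (size_tuple t) oJ cJ Jx kJd)).
  apply: (le_trans (ler_wpM2l (expR_ge0 _) kJ)).
  rewrite mulrCA -expRD; apply: ler_wpM2l; first exact: ltW.
  by rewrite ler_expR /Y -natr1; lra.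
set c0 := L * (delta / 2) * _.
rewrite [leLHS](_ : _ = \sum_t (q t * c0 + q t * ((1 - P M (s + Y t x) (G t x)) * A))); last first.
  by apply: eq_bigr => t _; rewrite mulrDr.
rewrite big_split/= -mulr_suml q_sum1 mul1r.
apply: lerD.
  apply: ler_wpM2l; first exact: mulr_ge0 L0 (ltW d2).
  by apply: ler_sum => k _; rewrite /bump /= add1n addnS addSn.
rewrite mulrBl mul1r mulr_suml.
under eq_bigr do rewrite mulrBl mul1r mulrBr.
rewrite sumrB -[X in X - _ <= _]mulr_suml q_sum1 mul1r lerD2l lerN2.
by apply: ler_sum => t _; rewrite mulrA.
Qed.

(** Two independent trajectories reach a neighbourhood of a calm point at the same time with
   probability at least c^2, from any two starting points; with probability at least eta, a
   common continuation then keeps them close forever. Hence a bound [A] improves to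
   K + (1 - rho) A, and the supremum, which is finite for given [M], is at most K / rho. *)
Lemma discrepancy_bounded : exists B : R, forall M x y, S M x y <= B.
Proof.
have [x0 [eta eta0 Hx0]] := calm_start.
have [bf [L L0 fL]] := lf.
have d2 : 0 < delta / 2 by rewrite divr_gt0.
have [r r0 Hr] : exists2 r, 0 < r & fine (kappa [set y | mdist x0 y < r]) <= delta / 2.
  have c0 : fine (kappa [set y | mdist x0 y < n.+1%:R^-1 /\ y <> x0]) @[n --> \oo] --> (0 : R).
    apply: measure_decr_cvg.
    - move=> n; rewrite (_ : [set y | _ /\ _] = [set y | mdist x0 y < n.+1%:R^-1] `\` [set x0])//.
      apply: measurableD; last exact: measurable_set1_circle.
      by apply: open_measurable_circle; exact: open_mball.
    - move=> n y /= [h ?]; split=> //; apply: lt_le_trans h _.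
      by rewrite lef_pV2 ?posrE// ler_nat.
    - rewrite -subset0 => y Hy; have [_ yx] := Hy 0%N Logic.I.
      have y0 : 0 < mdist x0 y.
        rewrite lt_neqAle mdist_ge0 andbT; apply/eqP => h; apply: yx.
        by apply/esym/mdist_positivity.
      have [n hn] := ltr_add_invr y0.
      have [+ _] := Hy n Logic.I => /=.
      by rewrite add0r in hn => /(lt_trans hn); rewrite ltxx.
  have /cvgrPdist_lt/(_ _ d2)[n _ Hn] := c0.
  have := Hn n (leqnn n); rewrite sub0r normrN ger0_norm// => hn.
  exists n.+1%:R^-1; first by rewrite invr_gt0.
  have -> : [set y | mdist x0 y < n.+1%:R^-1] =
      [set y | mdist x0 y < n.+1%:R^-1 /\ y <> x0] `|` [set x0].
    rewrite eqEsubset; split=> y /=.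
      by have [->|yx] := eqVneq y x0; [right|left; split=> //; apply/eqP].
    by move=> [[]//|->]; rewrite mdistxx invr_gt0.
  rewrite (le_trans (fine_measureU_le _ _ _))//.
  - rewrite (_ : [set y | _ /\ _] = [set y | mdist x0 y < n.+1%:R^-1] `\` [set x0])//.
    apply: measurableD; last exact: measurable_set1_circle.
    by apply: open_measurable_circle; exact: open_mball.
  - exact: measurable_set1_circle.
  - by rewrite kappa_nonatomic/= addr0 ltW.
set O := [set y | mdist x0 y < r] in Hr.
have oO : open O by exact: open_mball.
have cO : connected O by exact: connected_mball.
have Ox0 : O x0 by rewrite /O/= mdistxx.
have [n0 /(_ (n0 * N)%N)] := hitting oO (ex_intro _ x0 Ox0).
rewrite leq_pmulr// => /(_ isT)[c c0 Hc].
have [_ [F fF]] := bf.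
have F0 : 0 <= F by exact: le_trans (fF point).
have eta1 : eta <= 1.
  by apply: le_trans (Hx0 0%N) _; rewrite /calm_prob /= /calm /= lexx.
have c1 : c <= 1.
  apply: le_trans (Hc point) _; rewrite -[leRHS](Ew_cst p_sum1 (n0 * N)).
  by apply: Ew_le => // v _; rewrite indicE lern1 leq_b1.
have TF k x : `|iter k T f x| <= F.
  by elim: k x => [|k IH] x; [exact: fF|exact: Uop_bound].
have Hc' x : c <= Ew q n0 (fun v => \1_O (gw G v x)).
  by rewrite -(iter_Uop q G n0 \1_O) block_iter iter_Uop.
pose B0 := L * (delta / 2) * 2.
have B00 : 0 <= B0 by rewrite !mulr_ge0// ltW.
pose K := n0%:R * (2 * F) + B0.
pose rho := c * c * eta.
have rho0 : 0 < rho by rewrite !mulr_gt0.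
have improve M A : 0 <= A -> (forall x y, S M x y <= A) ->
    forall x y, S M x y <= K + (1 - rho) * A.
  move=> A0 SA x y.
  have near x' y' : O x' -> O y' -> S M x' y' <= B0 + (1 - eta) * A.
    move=> Ox' Oy'.
    have hk : fine (kappa O) <= delta / 2 * expR (0 - 0%:R) by rewrite subr0 expR0 mulr1.
    have := contraction_induction L0 A0 fL SA (leqnn M) oO cO Ox0 Ox' Oy' hk.
    move/le_trans; apply; apply: lerD.
      apply: ler_wpM2l; first exact: mulr_ge0 L0 (ltW d2).
      by under eq_bigr do rewrite add0n; exact: expR_geometric.
    rewrite ler_wpM2r// lerD2l lerN2; apply: le_trans (Hx0 M) _.
    by apply: Ew_le => // v _; rewrite add0r.
  have hpair x' y' : S M x' y' <= A - \1_O x' * \1_O y' * (eta * A - B0).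
    rewrite !indicE; have [Ox|Ox] := boolP (x' \in O); have [Oy|Oy] := boolP (y' \in O).
    - by rewrite inE in Ox; rewrite inE in Oy; have := near _ _ Ox Oy; rewrite !mul1r; lra.
    - by rewrite mulr0 mul0r subr0.
    - by rewrite !mul0r subr0.
    - by rewrite !mul0r subr0.
  apply: (le_trans (S_mono x y (leq_addl n0 M))).
  rewrite /S big_split_ord/= /K -addrA; apply: lerD.
    rewrite -[n0 in leRHS]card_ord mulr_natl -sumr_const; apply: ler_sum => k _.
    by rewrite (le_trans (ler_normB _ _))// mulr2n mulrDl mul1r lerD.
  apply: (@le_trans _ _ (Ew q n0 (fun v => Ew q n0 (fun w => S M (gw G v x) (gw G w y))))).
    rewrite /S; under [leRHS]eq_Ew => v _ do rewrite Ew_sum//.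
    rewrite Ew_sum//; apply: ler_sum => k _.
    rewrite !iterD !(iter_Uop q G n0).
    rewrite -(Ew_cst q_sum1 n0 (Ew q n0 (fun v => iter k T f (gw G v y)))) -EwB//.
    apply: (le_trans (Ew_norm _ _ _)) => //; apply: Ew_le => // v _.
    rewrite -[X in `|X - _|](Ew_cst q_sum1 n0) -EwB//.
    exact: Ew_norm.
  apply: (@le_trans _ _ (Ew q n0 (fun v => Ew q n0 (fun w =>
      A - \1_O (gw G v x) * \1_O (gw G w y) * (eta * A - B0))))).
    by apply: Ew_le => // v _; apply: Ew_le => // w _; exact: hpair.
  pose a := Ew q n0 (fun v => \1_O (gw G v x)).
  pose b := Ew q n0 (fun v => \1_O (gw G v y)).
  have -> : Ew q n0 (fun v => Ew q n0 (fun w =>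
      A - \1_O (gw G v x) * \1_O (gw G w y) * (eta * A - B0))) = A - a * b * (eta * A - B0).
    transitivity (Ew q n0 (fun v => A - (b * (eta * A - B0)) * \1_O (gw G v x))).
      apply: eq_Ew => v _; rewrite EwB Ew_cst//; congr (_ - _).
      transitivity (Ew q n0 (fun w => (\1_O (gw G v x) * (eta * A - B0)) * \1_O (gw G w y))).
        by apply: eq_Ew => w _; ring.
      by rewrite EwZ -/b; ring.
    by rewrite EwB Ew_cst// EwZ -/a; ring.
  have ha : c <= a by exact: Hc'.
  have hb : c <= b by exact: Hc'.
  have ha1 : a <= 1.
    by rewrite -(Ew_cst q_sum1 n0 1); apply: Ew_le => // v _; rewrite indicE lern1 leq_b1.
  have hb1 : b <= 1.
    by rewrite -(Ew_cst q_sum1 n0 1); apply: Ew_le => // v _; rewrite indicE lern1 leq_b1.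
  have ab1 : a * b <= 1 by rewrite mulr_ile1//; lra.
  have abc : c * c <= a * b by rewrite ler_pM// ltW.
  have h1 : a * b * B0 <= B0 by rewrite ler_piMl.
  have h2 : c * c * (eta * A) <= a * b * (eta * A) by rewrite ler_wpM2r// mulr_ge0// ltW.
  rewrite /rho; lra.
exists (K / rho) => M x y.
pose E := [set S M z.1 z.2 | z in [set: C * C]].
have supE : has_sup E.
  split; first by exists (S M x y); exists (x, y).
  exists (M%:R * (2 * F)) => _ [[x' y'] _ <-] /=.
  rewrite /S -[M in leRHS]card_ord mulr_natl -sumr_const; apply: ler_sum => k _.
  by rewrite (le_trans (ler_normB _ _))// mulr2n mulrDl mul1r lerD.
have Sle x' y' : S M x' y' <= sup E.
  by apply: sup_upper_bound => //; exists (x', y').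
have sup0 : 0 <= sup E by exact: le_trans (S_ge0 M x y) (Sle x y).
have : sup E <= K + (1 - rho) * sup E.
  apply: sup_le_ub; first by have [] := supE.
  by move=> _ [[x' y'] _ <-] /=; exact: improve.
move=> h; apply: le_trans (Sle x y) _; rewrite ler_pdivlMr//.
by lra.
Qed.

(** The iterates have mean zero, so that integrating the discrepancy over the second point bounds
   the sum over the multiples of [N]; the other residues follow by conditioning on the first
   letters. *)
Lemma iterates_summable : exists B : R, forall n x, \sum_(j < n) `|iter j (Uop p g) f x| <= B.
Proof.
have [B SB] := discrepancy_bounded.
have bf k : bmf (iter k T f) by rewrite block_iter; have [] := arc_lip_iter (k * N) lf.
have block M x : \sum_(k < M) `|iter k T f x| <= B.
  have -> : B = \int[mu]_y B by rewrite int_prob_cst.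
  have bS k : bmf (fun y => `|iter k T f x - iter k T f y|).
    by apply: bmf_norm; apply: bmfB => //; exact: bmf_cst.
  apply: (@le_trans _ _ (\int[mu]_y S M x y)); last first.
    apply: int_le => //; [exact: bmf_sum|exact: bmf_cst].
  rewrite /S int_sum//; apply: ler_sum => k _.
  have e : iter k T f x = \int[mu]_y (iter k T f x - iter k T f y).
    rewrite intB//; last exact: bmf_cst.
    rewrite int_prob_cst block_iter.
    by rewrite [X in _ - X](etrans (int_iter_Uop p_ge0 p_sum1 mg mu_inv _ lf.1) f_mean0) subr0.
  rewrite [in leLHS]e.
  by apply: int_norm => //; apply: bmfB => //; exact: bmf_cst.
exists (N%:R * B) => n x.
have h M : \sum_(j < M * N) `|iter j (Uop p g) f x| <=
    \sum_(r < N) Ew p r (fun v => \sum_(k < M) `|iter k T f (gw g v x)|).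
  elim: M => [|M IH].
    rewrite mul0n big_ord0; apply: sumr_ge0 => r _; apply: Ew_ge0 => // v _.
    by rewrite big_ord0.
  rewrite mulSnr big_split_ord/=.
  under [leRHS]eq_bigr => r _.
    rewrite (_ : Ew _ _ _ = Ew p r (fun v => \sum_(k < M) `|iter k T f (gw g v x)|) +
      Ew p r (fun v => `|iter M T f (gw g v x)|)); last first.
      by rewrite -EwD; apply: eq_Ew => v _; rewrite big_ord_recr.
    over.
  rewrite big_split/=; apply: lerD => //; apply: ler_sum => r _.
  by rewrite addnC iterD -block_iter iter_Uop; exact: Ew_norm.
apply: (@le_trans _ _ (\sum_(j < n * N) `|iter j (Uop p g) f x|)).
  rewrite -(subnKC (leq_pmulr n N_gt0)) big_split_ord/= lerDl.
  exact: sumr_ge0.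
apply: le_trans (h n) _; rewrite -[N in leRHS]card_ord mulr_natl -sumr_const.
apply: ler_sum => r _; rewrite -[leRHS](Ew_cst p_sum1 r).
by apply: Ew_le => // v _; exact: block.
Qed.

End blocks.

(** The series of the iterates of the Markov operator converges absolutely and solves the equation.
   Its sum may leave the class [arc_lip], as the constants of the partial sums [hk] may be
   unbounded; so the partial sums are part of the conclusion. *)
Lemma poisson f : arc_lip f -> \int[mu]_x f x = 0 ->
  exists (h : C -> R) (hk : nat -> C -> R) (B : R),
    [/\ forall n, arc_lip (hk n), forall n x, `|hk n x| <= B,
        forall x, hk n x @[n --> \oo] --> h x & forall x, h x - Uop p g h x = f x].
Proof.
move=> lf f0.
have [N [delta [m [[N0 d0] bm m0 m1 contr]]]] := mean_contraction p_gt0 p_sum1 cg cginv gK ginvK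
  mu_inv mu_noinv mu_kappa leb_kappa kappa_back.
have [B HB] := iterates_summable N0 d0 bm m0 m1 contr lf f0.
pose a x j := iter j (Uop p g) f x.
have ca x : cvgn (series (a x)).
  have cn : cvgn (series (fun j => `|a x j| : R)).
    apply: nondecreasing_is_cvgn.
      by apply: nondecreasing_series => i _ _; exact: normr_ge0.
    by exists B => _ [n _ <-]; rewrite seriesEord; exact: HB.
  exact: normed_cvg cn.
pose h x := limn (series (a x)).
pose hk n x := \sum_(j < n) a x j.
have hkE n x : hk n x = series (a x) n by rewrite seriesEord.
have hkh x : hk n x @[n --> \oo] --> h x.
  by under eq_fun do rewrite hkE; exact: ca.
exists h, hk, B; split => //.
- by move=> n; apply: arc_lip_sum => j; exact: arc_lip_iter.
- by move=> n x; apply: le_trans (ler_norm_sum _ _ _) _; exact: HB.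
- move=> x.
  have Uhk n : Uop p g (hk n) x = hk n.+1 x - f x.
    rewrite /hk big_ord_recl /= addrC addKr /Uop.
    rewrite [RHS]exchange_big/=.
    by apply: eq_bigr => i _; rewrite mulr_sumr.
  have c1 : Uop p g (hk n) x @[n --> \oo] --> Uop p g h x.
    apply: (@cvgn_sum R I (index_enum I) (fun i n => p i * hk n (g i x))) => i.
    by apply: cvgM; [exact: cvg_cst|exact: hkh].
  have c2 : Uop p g (hk n) x @[n --> \oo] --> h x - f x.
    under eq_fun do rewrite Uhk.
    apply: cvgB; last exact: cvg_cst.
    have := hkh x; rewrite -(cvg_shiftS (fun n => hk n x)); exact.
  have -> : Uop p g h x = h x - f x by exact: cvg_unique c1 c2.
  by rewrite opprB addrC subrK.
Qed.

End poisson.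

(** * Laziness, and the Poisson equation for minimal families *)

Lemma lipschitz_continuousW (R : realType) (f : circle R -> R) :
  lipschitz_continuous f -> continuous f.
Proof.
move=> [L fL]; apply/continuousP => U oU; apply/open_ballP => x Ux.
have /nbhs_ballP[e /= e0 He] := open_nbhs_nbhs (conj oU Ux).
have L1 : 0 < `|L| + 1 by rewrite ltr_wpDl.
exists (e / (`|L| + 1)) => [|y xy]; first exact: divr_gt0.
apply: He; apply: (le_lt_trans (fL x y)).
rewrite ltr_pdivlMr// mulrC in xy; apply: le_lt_trans xy.
by rewrite ler_wpM2r ?mdist_ge0// (le_trans (ler_norm _))// lerDl.
Qed.

Section lazy.
Variables (R : realType) (I : finType).
Local Notation C := (circle R).
Variables (p : I -> R) (g ginv : I -> C -> C) (mu : probability C R).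
Hypothesis p_gt0 : forall i, 0 < p i.
Hypothesis p_sum1 : \sum_i p i = 1.
Hypothesis cg : forall i, continuous (g i).
Hypothesis cginv : forall i, continuous (ginv i).
Hypothesis gK : forall i, cancel (g i) (ginv i).
Hypothesis ginvK : forall i, cancel (ginv i) (g i).
Hypothesis mu_inv : forall A, measurable A ->
  \sum_i p i * fine (mu (g i @^-1` A)) = fine (mu A).
Hypothesis mu_noinv : noinv (R := R) g.
Hypothesis g_min : forall (O : set C) x, open O -> O !=set0 -> exists w, O (gw g w x).

Definition lazy_prob (u : option I) : R := if u is Some i then p i / 2 else 2^-1.
Definition lazy_map (f : I -> C -> C) (u : option I) : C -> C := if u is Some i then f i else id.

Lemma sum_option (F : option I -> R) : \sum_u F u = F None + \sum_i F (Some i).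
Proof.
rewrite (bigD1 None)//=; congr (_ + _).
rewrite (reindex_omap Some id)/=; last by case.
by apply: eq_bigl => i; rewrite eqxx.
Qed.

Lemma lazy_prob_gt0 u : 0 < lazy_prob u.
Proof. by case: u => [i|] /=; [exact: divr_gt0|rewrite invr_gt0]. Qed.

Lemma lazy_prob_sum1 : \sum_u lazy_prob u = 1.
Proof. by rewrite sum_option /= -mulr_suml p_sum1; lra. Qed.

Lemma lazy_inv A : measurable A ->
  \sum_u lazy_prob u * fine (mu (lazy_map g u @^-1` A)) = fine (mu A).
Proof.
move=> mA; rewrite sum_option /=.
have -> : \sum_i p i / 2 * fine (mu (g i @^-1` A)) = 2^-1 * fine (mu A).
  by rewrite -mu_inv// mulr_sumr; apply: eq_bigr => i _; rewrite mulrAC mulrC.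
by rewrite preimage_id -mulrDl; lra.
Qed.

Lemma gw_lazy w n x : gw (lazy_map g) (map Some w ++ nseq n None) x = gw g w x.
Proof.
rewrite gw_cat; set y := gw _ _ x.
have -> : y = gw g w x by rewrite /y; elim: w x {y} => [//|i w IH] x; rewrite /= IH.
by elim: n => [//|n IH]; exact: IH.
Qed.

(** Laziness absorbs the parity of hitting times: a short word that leads to [O] is completed by
   identities into a word of any larger length, and compactness bounds the lengths. *)
Lemma lazy_hitting (O : set C) : open O -> O !=set0 ->
  exists n0, forall n, (n0 <= n)%N -> exists2 c : R, 0 < c &
    forall x, c <= Ew lazy_prob n (fun v => \1_O (gw (lazy_map g) v x)).
Proof.
move=> oO O0.
pose V (w : seq I) := [set x | O (gw g w x)].
have oV w : open (V w).
  by apply: open_comp => // x _; exact: continuous_gw.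
have := @compact_circle R; rewrite compact_cover => /(_ _ [set: seq I] V)[||D _ VD].
- by move=> w _; exact: oV.
- by move=> x _; have [w Hw] := g_min x oO O0; exists w.
have [e e0 Ee] := fin_min lazy_prob_gt0.
exists (\max_(w <- finmap.enum_fset D) size w)%N => n Dn.
exists (e ^+ n); first exact: exprn_gt0.
move=> x; have [w /= wD Ow] := VD x Logic.I.
have sw : (size w <= n)%N.
  apply: leq_trans Dn; exact: (@leq_bigmax_seq _ (finmap.enum_fset D) xpredT size).
pose v := map Some w ++ nseq (n - size w) None.
have sv : size v = n by rewrite size_cat size_map size_nseq subnKC.
have F0 (u : seq (option I)) : 0 <= \1_O (gw (lazy_map g) u x) :> R by rewrite indicE.
have := Ew_word (fun u => ltW (lazy_prob_gt0 u)) lazy_prob_sum1 v F0.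
rewrite sv; apply: le_trans.
rewrite gw_lazy indicE mem_set// mulr1 -sv.
elim: v {sv} => [|u v IH]; first by rewrite expr0 /pw big_nil.
rewrite /pw big_cons exprS; apply: ler_pM => //; first exact: ltW.
by rewrite exprn_ge0// ltW.
Qed.

Lemma continuous_lazy (f : I -> C -> C) : (forall i, continuous (f i)) ->
  forall u, continuous (lazy_map f u).
Proof. by move=> cf [i|] x /=; [exact: cf|exact: cvg_id]. Qed.

(** The Markov operator of the lazy system is (1 + U) / 2, so that half of a solution for the lazy
   system is a solution for the given one; kappa comes from the lazy system. *)
Lemma poisson_minimal : exists kappa : {finite_measure set C -> \bar R},
  (forall f, lipschitz_continuous f -> arc_lip kappa f) /\
  forall f, arc_lip kappa f -> \int[mu]_x f x = 0 ->
    exists (h : C -> R) (hk : nat -> C -> R) (B : R),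
    [/\ forall n, arc_lip kappa (hk n), forall n x, `|hk n x| <= B,
        forall x, hk n x @[n --> \oo] --> h x & forall x, h x - Uop p g h x = f x].
Proof.
have cG := continuous_lazy cg; have cGinv := continuous_lazy cginv.
have GK u : cancel (lazy_map g u) (lazy_map ginv u) by case: u.
have GinvK u : cancel (lazy_map ginv u) (lazy_map g u) by case: u.
have noG : noinv (R := R) (lazy_map g).
  by move=> [nu Hnu]; apply: mu_noinv; exists nu => i A mA; exact: (Hnu (Some i)).
have mG u := continuous_measurable_map (cG u); have mGinv u := continuous_measurable_map (cGinv u).
have at0 := stationary_nonatomic lazy_prob_gt0 lazy_prob_sum1 mG mGinv GK GinvK lazy_inv noG
  (@measurable_set1_circle R).
have bij u x : exists y, lazy_map ginv u @^-1` [set x] = [set y].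
  exists (lazy_map g u x); rewrite eqEsubset; split=> y /= h; last by rewrite h GK.
  by rewrite -h GinvK.
have [kappa [k1 k2 k3 k4]] := reference_measure (fun u => ltW (lazy_prob_gt0 u)) lazy_prob_sum1
  mGinv bij at0.
exists kappa; split.
  move=> f fL; have cf := lipschitz_continuousW fL.
  case: fL => L fL; split; first exact: continuous_bmf.
  exists (4 * `|L|) => [|J x y oJ cJ Jx Jy]; first by rewrite mulr_ge0.
  have mJ := open_measurable_circle oJ.
  have h1 := leb_connected mJ cJ Jx Jy; have h2 := k2 _ mJ.
  apply: (le_trans (fL x y)); apply: (@le_trans _ _ (`|L| * mdist x y)).
    by rewrite ler_wpM2r// ?mdist_ge0// ler_norm.
  rewrite [4 * _]mulrC -mulrA ler_wpM2l//; lra.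
move=> f lf f0.
have [h [hk [B [lhk hkB hkh hU]]]] := poisson lazy_prob_gt0 lazy_prob_sum1 cG cGinv GK GinvK
  lazy_inv noG k1 k2 k3 k4 lazy_hitting lf f0.
exists (fun x => 2^-1 * h x), (fun n x => 2^-1 * hk n x), B; split.
- by move=> n; exact: arc_lipZ.
- move=> n x; rewrite normrM ger0_norm//; have := hkB n x; have := normr_ge0 (hk n x); lra.
- by move=> x; apply: cvgM; [exact: cvg_cst|exact: hkh].
- move=> x; rewrite UopZ -[RHS]hU /Uop sum_option /=.
  under [in RHS]eq_bigr do rewrite mulrAC.
  rewrite -mulr_suml; lra.
Qed.

End lazy.

(** * The law of the chain *)

Section chain_law.
Variables (R : realType) (k : nat).
Context {d' : measure_display} {T : measurableType d'}.
Variables (g : 'I_k -> T -> T) (p : 'I_k -> R) (mu : probability T R).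
Hypothesis p_gt0 : forall i, 0 < p i.
Context {d : measure_display} {Omega : measurableType d}.
Variables (P : probability Omega R) (X : nat -> Omega -> T).
Variable idx : nat -> Omega -> 'I_k.
Hypothesis mX0 : measurable_fun setT (X 0%N).
Hypothesis X0_law : forall A, measurable A -> P (X 0%N @^-1` A) = mu A.
Hypothesis idx_driving : driving_sequence p P idx.
Hypothesis X0_indep : independent_systems P (preimage_set_system setT (X 0%N) measurable)
  <<s \bigcup_n index_sigma (idx n) >>.
Hypothesis X_rec : forall n w, X n.+1 w = g (idx n w) (X n w).

Definition driving_word n (w : Omega) : seq 'I_k := [seq idx j w | j <- iota 0 n].

Lemma size_driving_word n w : size (driving_word n w) = n.
Proof. by rewrite size_map size_iota. Qed.

Lemma driving_wordS n w : driving_word n.+1 w = rcons (driving_word n w) (idx n w).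
Proof. by rewrite /driving_word -addn1 iotaD map_cat cats1. Qed.

Lemma chain_gw n w : X n w = gw g (driving_word n w) (X 0%N w).
Proof. by elim: n => [//|n IH]; rewrite X_rec IH driving_wordS gw_rcons. Qed.

Let E (v : seq 'I_k) := [set w | driving_word (size v) w = v].

Let E_sigma v : <<s \bigcup_n index_sigma (idx n) >> (E v).
Proof.
rewrite -[X in X (E v)]/(@measurable _ (g_sigma_algebraType (\bigcup_n index_sigma (idx n)))).
elim/last_ind: v => [|v i IH].
  by rewrite (_ : E [::] = setT)//; exact/seteqP.
rewrite (_ : E (rcons v i) = E v `&` idx (size v) @^-1` [set i]); last first.
  apply/seteqP; split=> w; rewrite /E /= size_rcons driving_wordS.
    by move/rcons_inj => [].
  by move=> [-> ->].
apply: measurableI => //; apply: sub_sigma_algebra; exists (size v) => //.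
by exists [set i] => //; rewrite setTI.
Qed.

Let mE v : measurable (E v).
Proof.
have [midx _ _] := idx_driving.
elim/last_ind: v => [|v i IH].
  by rewrite (_ : E [::] = setT)//; exact/seteqP.
rewrite (_ : E (rcons v i) = E v `&` idx (size v) @^-1` [set i]); last first.
  apply/seteqP; split=> w; rewrite /E /= size_rcons driving_wordS.
    by move/rcons_inj => [].
  by move=> [-> ->].
exact: measurableI.
Qed.

Let PE v : P (E v) = (pw p v)%:E.
Proof.
have [midx Pidx /= indep] := idx_driving.
case: v => [|i0 v']; first by rewrite (_ : E [::] = setT) ?probability_setT /pw ?big_nil//; exact/seteqP.
set v := i0 :: v'.
pose J := finmap.seq_fset tt (iota 0 (size v)).
have := indep J (fun j => idx j @^-1` [set nth i0 v j]).
rewrite (_ : \bigcap_(_ in _) _ = E v); last first.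
  apply/seteqP; split=> w /= h.
    apply: (@eq_from_nth _ i0); rewrite size_driving_word// => j jv.
    rewrite (nth_map 0%N) ?size_iota// nth_iota//.
    by apply: h; rewrite /= finmap.seq_fsetE mem_iota.
  move=> j /=; rewrite finmap.seq_fsetE mem_iota /= add0n => jv.
  by rewrite -[in RHS]h (nth_map 0%N) ?size_iota// nth_iota.
move=> ->; last first.
  by move=> j _; exists [set nth i0 v j] => //; rewrite setTI.
rewrite (perm_big _ (finmap.seq_fset_perm _ _)) undup_id ?iota_uniq//=.
under eq_bigr do rewrite Pidx.
rewrite prodEFin; congr (_%:E).
by rewrite /pw (big_nth i0) /index_iota subn0.
Qed.

(** The index word is independent of the starting point, so that the law of the pair is a product. *)
Lemma chain_law n (F : seq 'I_k -> T -> R) : (forall v, bmf (F v)) ->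
  bmf (fun w => F (driving_word n w) (X 0%N w)) /\
  \int[P]_w F (driving_word n w) (X 0%N w) = \int[mu]_x Ew p n (fun v => F v x).
Proof.
move=> bF.
have FE w : F (driving_word n w) (X 0%N w) =
    \sum_(t : n.-tuple 'I_k) F t (X 0%N w) * \1_(E t) w.
  have sz : size (driving_word n w) == n by rewrite size_driving_word.
  rewrite (bigD1 (Tuple sz))//= big1 ?addr0.
    by rewrite indicE mem_set ?mulr1// /E/= size_driving_word.
  move=> t tn; rewrite indicE memNset ?mulr0// /E/= size_tuple => h.
  by move/eqP: tn; apply; apply: val_inj.
have bFX v : bmf (fun w => F v (X 0%N w)) by exact: bmf_comp mX0 (bF v).
have bE v : bmf (\1_(E v) : Omega -> R) by exact: bmf_indic.
rewrite (funext FE); split.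
  by apply: bmf_sum => t; exact: bmfM.
rewrite int_sum//; last by move=> t; exact: bmfM.
rewrite int_Ew// Ew_tuple; apply: eq_bigr => t _.
have pt : 0 < pw p t by rewrite /pw; apply: prodr_gt0.
pose L (f : T -> R) := (pw p t)^-1 * \int[P]_w (f (X 0%N w) * \1_(E t) w).
suff : L (F t) = \int[mu]_x F t x.
  by move=> <-; rewrite /L mulrA divff ?mul1r// gt_eqF.
have bX (f : T -> R) : bmf f -> bmf (fun w => f (X 0%N w) * \1_(E t) w).
  by move=> bf; apply: bmfM => //; exact: bmf_comp mX0 bf.
apply: (@int_unique _ _ R mu L 1) => //.
- move=> f h bf bh; rewrite /L -mulrDr -intD//; [|exact: bX|exact: bX].
  by congr (_ * _); apply: eq_Rintegral => w _; rewrite mulrDl.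
- move=> c f bf; rewrite /L mulrCA -(intZ P c measurableT (bX f bf)).
  by congr (_ * _); apply: eq_Rintegral => w _; rewrite mulrA.
- move=> f e bf fe; rewrite /L normrM ger0_norm ?invr_ge0 ?(ltW pt)// mul1r ler_pdivrMl//.
  apply: (le_trans (int_norm _ _ _)) => //; first exact: bX.
  apply: (@le_trans _ _ (\int[P]_w (e * \1_(E t) w))).
    apply: int_le => //; [by apply: bmf_norm; exact: bX|exact: bmfZ|].
    move=> w _; rewrite normrM [`|\1_ _ _|]ger0_norm ?indicE//.
    by rewrite ler_wpM2r.
  by rewrite intZ// int_indic// [X in fine X]PE mulrC.
- move=> A mA; rewrite /L.
  have -> : \int[P]_w (\1_A (X 0%N w) * \1_(E t) w) = fine (P (X 0%N @^-1` A `&` E t)).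
    rewrite -int_indic; last first.
      by apply: measurableI => //; rewrite -[X in measurable X]setTI; exact: mX0.
    by apply: eq_Rintegral => w _; rewrite indicI.
  rewrite [X in fine X]X0_indep//; last first.
    by exists A => //; rewrite setTI.
  rewrite X0_law// PE fineM//= ?fin_num_measure//.
  by rewrite mulrC mulfK// gt_eqF.
Qed.

End chain_law.

(** * Taylor bounds for the cosine *)

Section taylor.
Variable R : realType.
Implicit Types b t x : R.

Lemma sin_lip x : `|sin x| <= `|x|.
Proof.
wlog x0 : x / 0 <= x => [H|].
  have [/H//|/ltW x0] := leP 0 x.
  by rewrite -normrN -sinN -[leRHS]normrN H// oppr_ge0.
have [c _] : exists2 c, c \in `[0, x]%R & sin x - sin 0 = cos c * (x - 0).
  by apply: MVT_segment => //; exact: continuous_subspaceT (@continuous_sin R).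
rewrite sin0 !subr0 => ->; rewrite normrM ler_piMl//; exact: cos_max.
Qed.

Lemma cos_half x : 1 - cos x = 2 * sin (x / 2) ^+ 2.
Proof.
rewrite [in LHS](_ : x = x / 2 + x / 2); last by field.
rewrite cosD -!expr2 cos2sin2; set y := sin _ ^+ 2; ring.
Qed.

Lemma cos_quad x : 1 - cos x <= x ^+ 2 / 2.
Proof.
rewrite cos_half; have := sin_lip (x / 2); rewrite -ler_sqr ?nnegrE//.
by rewrite !real_normK ?num_real// => h; lra.
Qed.

Lemma cos_lip x (y : R) : `|cos x - cos y| <= `|x - y|.
Proof.
pose m := (x + y) / 2; pose d := (x - y) / 2.
have -> : x = m + d by rewrite /m /d; field.
have -> : y = m - d by rewrite /m /d; field.
have -> : cos (m + d) - cos (m - d) = - (2 * (sin m * sin d)) by rewrite cosD cosB; ring.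
have -> : m + d - (m - d) = 2 * d by ring.
move: m d => m d; rewrite normrN !normrM ler_wpM2l// (le_trans _ (sin_lip d))// ler_piMl//.
exact: sin_max.
Qed.

Lemma sin_cubic x : `|sin x - x| <= `|x| ^+ 3.
Proof.
wlog x0 : x / 0 <= x => [H|].
  have [/H//|/ltW x0] := leP 0 x.
  by rewrite -normrN opprD -sinN -[X in _ <= X ^+ 3]normrN H// oppr_ge0.
have [c /itvP cx] : exists2 c, c \in `[0, x]%R & (sin x - x) - (sin 0 - 0) = (cos c - 1) * (x - 0).
  apply: (@MVT_segment _ (fun x => sin x - x)) => //.
  by apply: continuous_subspaceT => y; apply: cvgB; [exact: continuous_sin|exact: cvg_id].
have c1 : `|cos c - 1| = 1 - cos c by rewrite distrC ger0_norm// subr_ge0 cos_le1.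
rewrite sin0 !subr0 => ->; rewrite normrM c1 (ger0_norm x0) exprSr ler_wpM2r//.
apply: (le_trans (cos_quad c)).
have : c ^+ 2 <= x ^+ 2 by rewrite ler_sqr ?nnegrE ?cx.
have := sqr_ge0 c; lra.
Qed.

Lemma cos_quartic x : `|cos x - (1 - x ^+ 2 / 2)| <= x ^+ 4.
Proof.
have -> : cos x - (1 - x ^+ 2 / 2) = 2 * ((x / 2 - sin (x / 2)) * (x / 2 + sin (x / 2))).
  have -> : cos x = 1 - 2 * sin (x / 2) ^+ 2 by rewrite -cos_half; ring.
  by field.
rewrite normrM ger0_norm// normrM.
have h1 := sin_cubic (x / 2); rewrite distrC in h1.
have h2 : `|x / 2 + sin (x / 2)| <= 2 * `|x / 2|.
  by rewrite (le_trans (ler_normD _ _))//; have := sin_lip (x / 2); lra.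
have h3 : `|x / 2| ^+ 4 = x ^+ 4 / 16.
  by rewrite -normrX ger0_norm ?exprn_even_ge0//; field.
have : `|x / 2 - sin (x / 2)| * `|x / 2 + sin (x / 2)| <= `|x / 2| ^+ 3 * (2 * `|x / 2|).
  exact: ler_pM.
have : 0 <= x ^+ 4 by exact: exprn_even_ge0.
have -> : `|x / 2| ^+ 3 * (2 * `|x / 2|) = 2 * `|x / 2| ^+ 4 by ring.
rewrite h3; lra.
Qed.

Lemma cos_taylor b t :
  `|cos (b + t) - (cos b - t * sin b - t ^+ 2 / 2 * cos b)| <= `|t| ^+ 3 + t ^+ 4.
Proof.
have -> : cos (b + t) - (cos b - t * sin b - t ^+ 2 / 2 * cos b) =
    - (sin b * (sin t - t)) + cos b * (cos t - (1 - t ^+ 2 / 2)).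
  by rewrite cosD; field.
rewrite (le_trans (ler_normD _ _))// normrN !normrM; apply: lerD.
  by rewrite (le_trans _ (sin_cubic t))// ler_piMl// sin_max.
by rewrite (le_trans _ (cos_quartic t))// ler_piMl// cos_max.
Qed.

End taylor.

Lemma continuous_cos_affine (R : realType) (a b : R) : continuous (fun x : R => cos (a * x + b)).
Proof.
move=> x; apply: (@continuous_comp _ _ _ (fun x : R => a * x + b) (@cos R)).
  by apply: cvgD; [apply: cvgM; [exact: cvg_cst|exact: cvg_id]|exact: cvg_cst].
exact: continuous_cos.
Qed.

Lemma bmf_cos_affine (R : realType) (a b : R) :
  bmf (fun x : measurableTypeR R => cos (a * x + b)).
Proof.
split; last by exists 1 => x; exact: cos_max.
by apply: continuous_measurable_fun; exact: continuous_cos_affine.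
Qed.

Lemma invsqrt_small (R : realType) (c e : R) : 0 < e -> \forall n \near \oo, (Num.sqrt n%:R)^-1 * c < e.
Proof.
move=> e0; near=> n.
have hn : (`|c| / e) ^+ 2 < n%:R by near: n; exact: nbhs_infty_gtr.
have n0 : 0 < Num.sqrt n%:R :> R by rewrite sqrtr_gt0 (le_lt_trans _ hn)// sqr_ge0.
rewrite ltr_pdivrMl//; apply: le_lt_trans (ler_norm c) _.
rewrite -ltr_pdivrMr//.
have -> : `|c| / e = Num.sqrt ((`|c| / e) ^+ 2).
  by rewrite sqrtr_sqr normrM normr_id [`|e^-1|]ger0_norm// invr_ge0 ltW.
by rewrite ltr_sqrt// (le_lt_trans _ hn)// sqr_ge0.
Unshelve. all: by end_near. Qed.

(** * The martingale central limit theorem for characteristic functions *)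

Section martingale.
Context {d : measure_display} {T : measurableType d} {R : realType} {I : finType}.
Variables (p : I -> R) (g : I -> T -> T) (mu : probability T R).
Hypothesis p_ge0 : forall i, 0 <= p i.
Hypothesis p_sum1 : \sum_i p i = 1.
Hypothesis mg : forall i, measurable_fun setT (g i).
Hypothesis mu_inv : forall A, measurable A ->
  \sum_i p i * fine (mu (g i @^-1` A)) = fine (mu A).

Variable D : I -> T -> R.
Hypothesis bD : forall i, bmf (D i).
Hypothesis D_mean0 : forall x, \sum_i p i * D i x = 0.

Fixpoint mart (v : seq I) (x : T) : R :=
  if v is i :: v' then D i x + mart v' (g i x) else 0.

Lemma mart_rcons v i x : mart (rcons v i) x = mart v x + D i (gw g v x).
Proof. by elim: v x => [|j v IH] x /=; rewrite ?addr0 ?add0r// IH addrA. Qed.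

Lemma bmf_mart v : bmf (mart v).
Proof.
elim: v => [|i v IH]; first exact: bmf_cst.
by apply: bmfD => //; exact: bmf_comp (mg i) IH.
Qed.

Definition cond_var x := \sum_i p i * D i x ^+ 2.

Lemma bmf_cond_var : bmf cond_var.
Proof. by apply: bmf_sum => i; apply: bmfZ; apply: bmfM. Qed.

Let bcos (f : T -> R) : bmf f -> bmf (fun x => cos (f x)).
Proof.
move=> [mf _]; split; last by exists 1 => x; exact: cos_max.
by apply: measurableT_comp => //; apply: continuous_measurable_fun; exact: continuous_cos.
Qed.

(** The increments are orthogonal, and their conditional variances are stationary. *)
Lemma mart_second_moment n :
  \int[mu]_x Ew p n (fun v => mart v x ^+ 2) = n%:R * \int[mu]_x cond_var x.
Proof.
have b2 v : bmf (fun x => mart v x ^+ 2) by apply: bmfM; exact: bmf_mart.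
have bV := bmf_cond_var.
elim: n => [|n IH].
  by rewrite mul0r /= expr0n/= int_cst// mul0r.
rewrite -natr1 mulrDl mul1r -IH.
rewrite -[X in _ = _ + X](int_iter_Uop p_ge0 p_sum1 mg mu_inv n bV).
rewrite -intD//; [|by apply: bmf_Ew|]; last first.
  by elim: n {IH} => [//|n IH]; exact: bmf_Uop.
apply: eq_Rintegral => x _; rewrite Ew_rcons iter_Uop -EwD; apply: eq_Ew => v _.
have -> : \sum_i p i * mart (rcons v i) x ^+ 2 = \sum_i (p i * mart v x ^+ 2 +
    2 * mart v x * (p i * D i (gw g v x)) + p i * D i (gw g v x) ^+ 2).
  by apply: eq_bigr => i _; rewrite mart_rcons; ring.
by rewrite !big_split/= -mulr_suml p_sum1 -mulr_sumr D_mean0 mulr0 addr0 mul1r.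
Qed.

(** In the expansion of the cosine the first-order term has mean zero. The second-order terms
   contributed by the increment and by the change of [q] add up to the conditional variance plus
   U q - q, that is to the constant [sg] up to the error on the right: the factor
   1 - s^2 q / 2 makes a conditional variance that is only cohomologous to a constant behave
   like a constant one. *)
Lemma one_step (q : T -> R) (Q M s sg b : R) x :
  (forall y, `|q y| <= Q) -> 0 <= M -> (forall i y, `|D i y| <= M) -> `|s| <= 1 ->
  `|\sum_i p i * ((1 - s ^+ 2 / 2 * q (g i x)) * cos (b + s * D i x)) -
    (1 - s ^+ 2 / 2 * sg) * (1 - s ^+ 2 / 2 * q x) * cos b| <=
  s ^+ 2 / 2 * `|cond_var x + Uop p g q x - q x - sg| +
  `|s| ^+ 3 * ((M ^+ 3 + M ^+ 4) * (1 + Q) + Q * (M + M ^+ 2) + `|sg| * Q).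
Proof.
move=> qQ M0 DM s1.
pose tay i := cos b - s * D i x * sin b - (s * D i x) ^+ 2 / 2 * cos b.
pose rem i := cos (b + s * D i x) - tay i.
have Q0 : 0 <= Q by exact: le_trans (qQ x).
have s0 : 0 <= `|s| by [].
have s2E : s ^+ 2 = `|s| ^+ 2 by rewrite real_normK// num_real.
have s32 : `|s| ^+ 3 <= `|s| ^+ 2 by rewrite ler_wiXn2l.
have s43 : `|s| ^+ 4 <= `|s| ^+ 3 by rewrite ler_wiXn2l.
have s21 : `|s| ^+ 2 <= 1 by rewrite exprn_ile1.
have -> : \sum_i p i * ((1 - s ^+ 2 / 2 * q (g i x)) * cos (b + s * D i x)) -
    (1 - s ^+ 2 / 2 * sg) * (1 - s ^+ 2 / 2 * q x) * cos b =
  - (s ^+ 2 / 2 * cos b * (cond_var x + Uop p g q x - q x - sg)) +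
  (\sum_i p i * ((1 - s ^+ 2 / 2 * q (g i x)) * rem i +
     s ^+ 2 / 2 * q (g i x) * (s * D i x * sin b + (s * D i x) ^+ 2 / 2 * cos b)) -
   (s ^+ 2 / 2) ^+ 2 * sg * q x * cos b).
  have remE i : cos (b + s * D i x) = tay i + rem i by rewrite [RHS]addrC /rem subrK.
  under eq_bigr do rewrite remE; rewrite /tay.
  move: (cos b) (sin b) => c sn.
  rewrite (_ : \sum_i _ = \sum_i (p i * c + - (s * sn) * (p i * D i x) +
      - (s ^+ 2 / 2 * c) * (p i * D i x ^+ 2) + - (s ^+ 2 / 2 * c) * (p i * q (g i x)) +
      p i * ((1 - s ^+ 2 / 2 * q (g i x)) * rem i +
        s ^+ 2 / 2 * q (g i x) * (s * D i x * sn + (s * D i x) ^+ 2 / 2 * c)))); last first.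
    by apply: eq_bigr => i _; field.
  rewrite !big_split/= -mulr_suml p_sum1 -!mulr_sumr D_mean0 -/(cond_var x) -/(Uop p g q x).
  by field.
apply: (le_trans (ler_normD _ _)); apply: lerD.
  have s2 : 0 <= s ^+ 2 / 2 by rewrite divr_ge0// sqr_ge0.
  by rewrite normrN normrM ler_wpM2r// normrM ger0_norm// ler_piMr// cos_max.
have s2q y : `|s ^+ 2 / 2 * q y| <= `|s| ^+ 2 * Q.
  rewrite normrM ler_pM// ger0_norm ?divr_ge0 ?sqr_ge0// s2E.
  have := sqr_ge0 `|s|; lra.
have sD i : `|s * D i x| <= `|s| * M by rewrite normrM ler_wpM2l.
have sM0 : 0 <= `|s| * M by rewrite mulr_ge0.
have remB i : `|rem i| <= `|s| ^+ 3 * (M ^+ 3 + M ^+ 4).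
  apply: (le_trans (cos_taylor b (s * D i x))).
  have h3 : `|s * D i x| ^+ 3 <= (`|s| * M) ^+ 3 by rewrite lerXn2r ?nnegrE.
  have h4 : `|s * D i x| ^+ 4 <= (`|s| * M) ^+ 4 by rewrite lerXn2r ?nnegrE.
  have -> : (s * D i x) ^+ 4 = `|s * D i x| ^+ 4 by rewrite -normrX ger0_norm ?exprn_even_ge0.
  have h5 : `|s| ^+ 4 * M ^+ 4 <= `|s| ^+ 3 * M ^+ 4 by rewrite ler_wpM2r ?exprn_ge0.
  by rewrite !exprMn in h3 h4; lra.
have tailB i : `|s * D i x * sin b + (s * D i x) ^+ 2 / 2 * cos b| <= `|s| * (M + M ^+ 2).
  rewrite (le_trans (ler_normD _ _))// mulrDr; apply: lerD.
    rewrite normrM (le_trans _ (sD i))// ler_piMr ?sin_max//.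
  rewrite normrM (@le_trans _ _ `|(s * D i x) ^+ 2 / 2|)// ?ler_piMr ?cos_max//.
  rewrite normrM normrX [`|2^-1|]ger0_norm ?invr_ge0//.
  have h : `|s * D i x| ^+ 2 <= (`|s| * M) ^+ 2 by rewrite lerXn2r ?nnegrE.
  rewrite exprMn in h.
  have h' : `|s| ^+ 2 * M ^+ 2 <= `|s| * M ^+ 2.
    by rewrite ler_wpM2r ?sqr_ge0// -[leRHS]mulr1 expr2 ler_wpM2l.
  have := sqr_ge0 `|s * D i x|; lra.
rewrite (le_trans (ler_normB _ _))// [leRHS]mulrDr; apply: lerD.
  rewrite -[leRHS](Ew_cst p_sum1 1) /=.
  rewrite (le_trans (ler_norm_sum _ _ _))//; apply: ler_sum => i _.
  rewrite normrM (ger0_norm (p_ge0 i)) ler_wpM2l// (le_trans (ler_normD _ _))// [leRHS]mulrDr.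
  apply: lerD.
    rewrite normrM mulrC mulrA; apply: ler_pM => //.
    rewrite (le_trans (ler_normB _ _))// normr1 lerD2l (le_trans (s2q _))//.
    by rewrite ler_piMl.
  rewrite normrM.
  have -> : `|s| ^+ 3 * (Q * (M + M ^+ 2)) = (`|s| ^+ 2 * Q) * (`|s| * (M + M ^+ 2)) by ring.
  exact: ler_pM.
rewrite normrM (@le_trans _ _ `|(s ^+ 2 / 2) ^+ 2 * sg * q x|)// ?ler_piMr ?cos_max//.
rewrite 2!normrM s2E ger0_norm ?sqr_ge0// mulrA -mulrA.
have h1 : `|sg| * `|q x| <= `|sg| * Q by rewrite ler_wpM2l.
have h2 : (`|s| ^+ 2 / 2) ^+ 2 <= `|s| ^+ 3.
  have -> : (`|s| ^+ 2 / 2) ^+ 2 = `|s| ^+ 4 / 4 by field.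
  have := exprn_ge0 4 s0; lra.
by rewrite -[leRHS]mulrA; apply: ler_pM => //; rewrite ?sqr_ge0// mulr_ge0.
Qed.

Section perturbation.
Variables (q : T -> R) (Q M s sg eps b : R).
Hypothesis bq : bmf q.
Hypothesis qQ : forall y, `|q y| <= Q.
Hypothesis M0 : 0 <= M.
Hypothesis DM : forall i y, `|D i y| <= M.
Hypothesis s1 : `|s| <= 1.
Hypothesis sg0 : 0 <= sg.
Hypothesis err : \int[mu]_x `|cond_var x + Uop p g q x - q x - sg| <= eps.

Let c3 := (M ^+ 3 + M ^+ 4) * (1 + Q) + Q * (M + M ^+ 2) + `|sg| * Q.
Let Q0 : 0 <= Q. Proof. exact: le_trans (qQ point). Qed.
(* exp (- s^2 sg / 2) agrees with 1 - s^2 sg / 2 up to order 4, lies between 0 and 1 for every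
   [s], and its n-th power does not depend on n when s = theta / sqrt n *)
Let rho := expR (- (s ^+ 2 / 2 * sg)).

Let s2E : s ^+ 2 = `|s| ^+ 2. Proof. by rewrite real_normK// num_real. Qed.
Let s21 : s ^+ 2 <= 1. Proof. by rewrite s2E exprn_ile1. Qed.

Let rho01 : 0 <= rho <= 1.
Proof.
rewrite /rho expR_ge0/= -expR0 ler_expR oppr_le0 mulr_ge0// divr_ge0// sqr_ge0//.
Qed.

Let rho_near : `|rho - (1 - s ^+ 2 / 2 * sg)| <= `|s| ^+ 3 * sg ^+ 2.
Proof.
set y := s ^+ 2 / 2 * sg.
have y0 : 0 <= y by rewrite mulr_ge0// divr_ge0// sqr_ge0.
have h1 : 1 - y <= rho by rewrite /rho -/y; exact: expR_ge1Dx.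
have h2 : rho * (1 + y) <= 1.
  rewrite /rho -/y expRN mulrC ler_pdivrMr ?expR_gt0// mul1r; exact: expR_ge1Dx.
have h3 : rho <= 1 - y + y ^+ 2 by nra.
rewrite ger0_norm ?subr_ge0//; apply: (@le_trans _ _ (y ^+ 2)); first lra.
rewrite /y exprMn ler_wpM2r ?sqr_ge0//.
have -> : (s ^+ 2 / 2) ^+ 2 = `|s| ^+ 4 / 4 by rewrite s2E; field.
have : `|s| ^+ 4 <= `|s| ^+ 3 by rewrite ler_wiXn2l.
have := exprn_ge0 4 (normr_ge0 s); lra.
Qed.

Let G n x := Ew p n (fun v => (1 - s ^+ 2 / 2 * q (gw g v x)) * cos (b + s * mart v x)).

Let bgw v (f : T -> R) : bmf f -> bmf (fun x => f (gw g v x)).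
Proof. by move=> bf; exact: bmf_comp (mgw mg v) bf. Qed.

Let bcosm v : bmf (fun x => cos (b + s * mart v x)).
Proof. by apply: bcos; apply: bmfD; [exact: bmf_cst|apply: bmfZ; exact: bmf_mart]. Qed.

Let bG n : bmf (G n).
Proof.
apply: bmf_Ew => v; apply: bmfM => //.
by apply: bmfB; [exact: bmf_cst|apply: bmfZ; exact: bgw].
Qed.

Let factor y : `|1 - s ^+ 2 / 2 * q y| <= 1 + Q.
Proof.
rewrite (le_trans (ler_normB _ _))// normr1 lerD2l normrM ger0_norm ?divr_ge0 ?sqr_ge0//.
apply: (@le_trans _ _ (1 * `|q y|)); last by rewrite mul1r.
have h : s ^+ 2 / 2 <= 1 by have := s21; lra.
exact: ler_wpM2r.
Qed.

Let G_bound n x : `|G n x| <= 1 + Q.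
Proof.
rewrite (le_trans (Ew_norm p_ge0 n _))// -[leRHS](Ew_cst p_sum1 n).
apply: Ew_le => // v _; rewrite normrM -[leRHS]mulr1.
by apply: ler_pM => //; exact: cos_max.
Qed.

Let G_step n : `|\int[mu]_x G n.+1 x - rho * \int[mu]_x G n x| <=
  s ^+ 2 / 2 * eps + `|s| ^+ 3 * (c3 + sg ^+ 2 * (1 + Q)).
Proof.
pose e x := `|cond_var x + Uop p g q x - q x - sg|.
have be : bmf e.
  apply: bmf_norm; apply: bmfB; last exact: bmf_cst.
  by apply: bmfB => //; apply: bmfD; [exact: bmf_cond_var|exact: bmf_Uop].
have bie : bmf (iter n (Uop p g) e).
  by elim: n => [//|n IH]; exact: bmf_Uop.
pose r1 := 1 - s ^+ 2 / 2 * sg.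
have pt x : `|G n.+1 x - rho * G n x| <=
    s ^+ 2 / 2 * iter n (Uop p g) e x + `|s| ^+ 3 * (c3 + sg ^+ 2 * (1 + Q)).
  have -> : G n.+1 x - rho * G n x = (G n.+1 x - r1 * G n x) - (rho - r1) * G n x by ring.
  rewrite (le_trans (ler_normB _ _))// mulrDr addrA; apply: lerD; last first.
    rewrite normrM mulrA.
    apply: ler_pM => //.
  rewrite /G Ew_rcons// -EwZ -EwB (le_trans (Ew_norm _ _ _))// iter_Uop -EwZ.
  rewrite -(Ew_cst p_sum1 n (`|s| ^+ 3 * c3)) -EwD; apply: Ew_le => // v _.
  under eq_bigr do rewrite gw_rcons mart_rcons mulrDr addrA.
  rewrite mulrA; exact: one_step.
have bB : bmf (fun x => G n.+1 x - rho * G n x) by apply: bmfB => //; exact: bmfZ.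
rewrite -intZ// -intB//; last exact: bmfZ.
apply: (le_trans (int_norm _ _ _)) => //.
apply: (@le_trans _ _ (\int[mu]_x (s ^+ 2 / 2 * iter n (Uop p g) e x +
    `|s| ^+ 3 * (c3 + sg ^+ 2 * (1 + Q))))).
  by apply: int_le => //; [exact: bmf_norm|apply: bmfD; [exact: bmfZ|exact: bmf_cst]].
rewrite intD//; [|exact: bmfZ|exact: bmf_cst].
rewrite intZ// (int_iter_Uop p_ge0 p_sum1 mg mu_inv)//.
rewrite int_prob_cst lerD2r.
by rewrite ler_wpM2l// divr_ge0// sqr_ge0.
Qed.

Let G_pow n : `|\int[mu]_x G n x - rho ^+ n * \int[mu]_x G 0 x| <=
  n%:R * (s ^+ 2 / 2 * eps + `|s| ^+ 3 * (c3 + sg ^+ 2 * (1 + Q))).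
Proof.
elim: n => [|n IH]; first by rewrite expr0 mul1r subrr normr0 mul0r.
have -> : \int[mu]_x G n.+1 x - rho ^+ n.+1 * \int[mu]_x G 0 x =
    (\int[mu]_x G n.+1 x - rho * \int[mu]_x G n x) +
    rho * (\int[mu]_x G n x - rho ^+ n * \int[mu]_x G 0 x) by rewrite exprS; ring.
apply: (le_trans (ler_normD _ _)); rewrite -natr1 mulrDl mul1r [leRHS]addrC.
apply: lerD; first exact: G_step.
have /andP[r0 r1] := rho01.
by rewrite normrM (ger0_norm r0) (le_trans _ IH)// ler_piMl.
Qed.

(** The errors of the [n] steps add up, since each step multiplies the previous ones by a factor at
   most 1; the last term is the cost of the factor 1 - s^2 q / 2 at both ends. *)
Lemma mart_cos_estimate n :
  `|\int[mu]_x Ew p n (fun v => cos (b + s * mart v x)) -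
    expR (- (s ^+ 2 / 2 * sg)) ^+ n * cos b| <=
  n%:R * (s ^+ 2 / 2 * eps + `|s| ^+ 3 * (c3 + sg ^+ 2 * (1 + Q))) + 2 * (s ^+ 2 * Q).
Proof.
rewrite -/rho; have /andP[r0 r1] := rho01.
have bW : bmf (fun x => Ew p n (fun v => cos (b + s * mart v x))) by exact: bmf_Ew.
have sq y : `|s ^+ 2 / 2 * q y| <= s ^+ 2 * Q.
  rewrite normrM ler_pM// ger0_norm ?divr_ge0 ?sqr_ge0//.
  have := sqr_ge0 s; lra.
have near f h : bmf f -> bmf h -> (forall x, `|f x - h x| <= s ^+ 2 * Q) ->
    `|\int[mu]_x f x - \int[mu]_x h x| <= s ^+ 2 * Q.
  move=> bf bh fh; rewrite -intB//; apply: (le_trans (int_norm _ _ _)) => //; first exact: bmfB.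
  rewrite -[leRHS](int_prob_cst mu).
  by apply: int_le => //; [apply: bmf_norm; exact: bmfB|exact: bmf_cst].
have h1 : `|\int[mu]_x Ew p n (fun v => cos (b + s * mart v x)) - \int[mu]_x G n x| <= s ^+ 2 * Q.
  apply: near => // x; rewrite /G -EwB (le_trans (Ew_norm _ _ _))//.
  rewrite -[leRHS](Ew_cst p_sum1 n); apply: Ew_le => // v _.
  rewrite mulrBl mul1r subKr normrM (le_trans _ (sq (gw g v x)))// ler_piMr// cos_max//.
have h2 : `|\int[mu]_x G 0 x - cos b| <= s ^+ 2 * Q.
  have -> : cos b = \int[mu]_x cos b by rewrite int_prob_cst.
  apply: near => //; first exact: bmf_cst.
  move=> x; have -> : G 0 x - cos b = - (s ^+ 2 / 2 * q x * cos b) by rewrite /G/= mulr0 addr0; ring.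
  rewrite normrN normrM.
  by rewrite (le_trans _ (sq x))// ler_piMr// cos_max.
have h3 : `|rho ^+ n * (\int[mu]_x G 0 x - cos b)| <= s ^+ 2 * Q.
  rewrite normrM (le_trans _ h2)// ler_piMl// ger0_norm ?exprn_ge0//.
  exact: exprn_ile1.
have -> : \int[mu]_x Ew p n (fun v => cos (b + s * mart v x)) - rho ^+ n * cos b =
  (\int[mu]_x Ew p n (fun v => cos (b + s * mart v x)) - \int[mu]_x G n x) +
  (\int[mu]_x G n x - rho ^+ n * \int[mu]_x G 0 x) +
  rho ^+ n * (\int[mu]_x G 0 x - cos b) by ring.
have h4 := G_pow n.
rewrite (le_trans (ler_normD _ _))//.
have := ler_normD (\int[mu]_x Ew p n (fun v => cos (b + s * mart v x)) - \int[mu]_x G n x)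
  (\int[mu]_x G n x - rho ^+ n * \int[mu]_x G 0 x).
lra.
Qed.

End perturbation.

(** In [mart_cos_estimate] with s = theta / sqrt n, the [n] errors of order s^3 tend to 0 together
   with the boundary terms, and those of order s^2 add up to at most theta^2 times the error of
   the corrector, which is arbitrarily small. *)
Lemma mart_cos_cvg (sg theta b : R) : 0 <= sg ->
  (forall e : R, 0 < e -> exists2 q, bmf q &
    \int[mu]_x `|cond_var x + Uop p g q x - q x - sg| <= e) ->
  \int[mu]_x Ew p n (fun v => cos (b + theta / Num.sqrt n%:R * mart v x)) @[n --> \oo] -->
    expR (- (theta ^+ 2 / 2 * sg)) * cos b.
Proof.
move=> sg0 corr.
have [M M0 DM] : exists2 M : R, 0 <= M & forall i x, `|D i x| <= M.
  have /choice[m Dm] i : exists m : R, forall x, `|D i x| <= m by have [_] := bD i.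
  exists (\sum_i `|m i|) => [|i x]; first exact: sumr_ge0.
  rewrite (le_trans (Dm i x))// (le_trans (ler_norm _))// (bigD1 i)//= lerDl.
  exact: sumr_ge0.
apply/cvgrPdist_lt => e e0.
pose ep := e / (2 * (theta ^+ 2 + 1)).
have t0 : 0 <= theta ^+ 2 by exact: sqr_ge0.
have ep0 : 0 < ep by rewrite divr_gt0// mulr_gt0// ltr_wpDl.
have [q bq qe] := corr _ ep0; have [_ [Q qQ]] := bq.
have Q0 : 0 <= Q by exact: le_trans (qQ point).
pose K := (M ^+ 3 + M ^+ 4) * (1 + Q) + Q * (M + M ^+ 2) + `|sg| * Q + sg ^+ 2 * (1 + Q).
pose K' := `|theta| ^+ 3 * K + 2 * (theta ^+ 2 * Q) + 1.
have K0 : 0 <= K.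
  by rewrite /K !addr_ge0// !mulr_ge0// ?addr_ge0// ?exprn_ge0// sqr_ge0.
have K'0 : 0 < K'.
  rewrite /K' ltr_wpDl// addr_ge0//; first by rewrite mulr_ge0// exprn_ge0.
  by rewrite mulr_ge0// mulr_ge0.
near=> n.
have [n0 n1 n2] : [/\ (0 < n)%N, (Num.sqrt n%:R)^-1 * `|theta| <= 1 &
    (Num.sqrt n%:R)^-1 * K' < e / 2].
  split.
  - by near: n; exact: nbhs_infty_gt.
  - by apply: ltW; near: n; exact: invsqrt_small.
  - by near: n; apply: invsqrt_small; exact: divr_gt0.
set a := (Num.sqrt n%:R)^-1 in n1 n2 *.
have an : a ^+ 2 * n%:R = 1.
  by rewrite /a exprVn sqr_sqrtr ?ler0n// mulVf// pnatr_eq0 -lt0n.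
have a0 : 0 <= a by rewrite invr_ge0 sqrtr_ge0.
have a1 : a <= 1.
  have : (1 : R) <= n%:R by rewrite ler1n.
  have := sqr_ge0 a; nra.
have s1 : `|theta * a| <= 1 by rewrite normrM (ger0_norm a0) mulrC.
have := mart_cos_estimate b bq qQ M0 DM s1 sg0 qe n.
have -> : expR (- ((theta * a) ^+ 2 / 2 * sg)) ^+ n = expR (- (theta ^+ 2 / 2 * sg)).
  rewrite -expRM_natl; congr expR; rewrite mulrN exprMn; congr (- _).
  have -> : n%:R * (theta ^+ 2 * a ^+ 2 / 2 * sg) = (a ^+ 2 * n%:R) * (theta ^+ 2 / 2 * sg) by field.
  by rewrite an mul1r.
rewrite distrC => /le_lt_trans; apply.
rewrite normrM (ger0_norm a0) -/K.
have -> : n%:R * ((theta * a) ^+ 2 / 2 * ep + (`|theta| * a) ^+ 3 * K) + 2 * ((theta * a) ^+ 2 * Q) =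
  (a ^+ 2 * n%:R) * (theta ^+ 2 / 2 * ep + a * (`|theta| ^+ 3 * K)) + a * (a * (2 * (theta ^+ 2 * Q))).
  by field.
rewrite an mul1r.
have h1 : theta ^+ 2 / 2 * ep <= e / 4.
  rewrite /ep; have -> : theta ^+ 2 / 2 * (e / (2 * (theta ^+ 2 + 1))) =
    (e / 4) * (theta ^+ 2 / (theta ^+ 2 + 1)) by field; rewrite gt_eqF// ltr_wpDl.
  apply: ler_piMr; first by rewrite divr_ge0// ltW.
  by rewrite ler_pdivrMr ?mul1r ?lerDl// ltr_wpDl.
have h2 : a * (a * (2 * (theta ^+ 2 * Q))) <= a * (2 * (theta ^+ 2 * Q)).
  by rewrite ler_wpM2l// ler_piMl// mulr_ge0// mulr_ge0.
have h3 : a * K' = a * (`|theta| ^+ 3 * K) + a * (2 * (theta ^+ 2 * Q)) + a by rewrite /K'; ring.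
lra.
Unshelve. all: by end_near. Qed.

End martingale.

(** * Bernstein approximation with trigonometric weights *)

Section bernstein.
Variable R : realType.

(** Compactness of the segment makes the modulus of continuity uniform in [c], while [d] may lie
   outside of it. *)
Lemma heine (F : R -> R) (a b e : R) : continuous F -> 0 < e ->
  exists2 r : R, 0 < r & forall c d, a <= c <= b -> `|c - d| < r -> `|F c - F d| <= e.
Proof.
move=> cF e0; pose Q (r c : R) := forall d, `|c - d| < r -> `|F c - F d| <= e.
have /compact_near_coveringP/(_ R (0^'+) Q _) := @segment_compact R a b.
case.
  move=> x _; have e2 : 0 < e / 2 by exact: divr_gt0.
  have /cvgrPdist_lt/(_ _ e2)/nbhs_ballP[r /= r0 Hr] := cF x.
  exists (ball x (r / 2), [set t : R | t < r / 2]).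
    split; first by apply: nbhsx_ballx; exact: divr_gt0.
    by apply: nbhs_right_lt; exact: divr_gt0.
  move=> [c t] [/= xc tr] d cd.
  have h1 : `|F x - F c| < e / 2 by apply: Hr; apply: lt_trans xc _; lra.
  have h2 : `|F x - F d| < e / 2.
    apply: Hr; rewrite /ball/=; have := ler_distD c x d.
    by rewrite /ball/= in xc; lra.
  have := ler_distD (F x) (F c) (F d); rewrite [`|F c - F x|]distrC; lra.
move=> r /= r0 h; exists (r / 2) => [|c d cab]; first exact: divr_gt0.
apply: (h (r / 2)) => /=; last by rewrite in_itv.
- by rewrite sub0r normrN ger0_norm; lra.
- exact: divr_gt0.
Qed.

Definition coin (u : R) (c : bool) : R := if c then u else 1 - u.

Lemma coin_ge0 u c : 0 <= u <= 1 -> 0 <= coin u c.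
Proof. by move=> /andP[? ?]; case: c => //=; rewrite subr_ge0. Qed.

Lemma coin_sum1 u : \sum_c coin u c = 1.
Proof. by rewrite big_bool /= addrC subrK. Qed.

(** The offset [a] absorbs the first toss in the induction. *)
Lemma coin_variance u N a :
  Ew (coin u) N (fun v => ((count id v)%:R + a - N%:R * u) ^+ 2) = N%:R * (u * (1 - u)) + a ^+ 2.
Proof.
elim: N a => [|N IH] a; first by rewrite /= mul0r subr0 mul0r !add0r.
rewrite [LHS]/= big_bool /=.
have E c : Ew (coin u) N (fun v => ((c + count id v)%:R + a - N.+1%:R * u) ^+ 2) =
    N%:R * (u * (1 - u)) + (c%:R + a - u) ^+ 2.
  rewrite -IH; apply: eq_Ew => v _; congr (_ ^+ 2); rewrite natrD -natr1; ring.
by rewrite (E 1%N) (E 0%N) -natr1; ring.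
Qed.

(** Chebyshev's inequality for the frequency of heads. *)
Lemma bernstein_approx (F : R -> R) (M e r u : R) N : (0 < N)%N -> 0 <= u <= 1 -> 0 < r ->
  (forall c, `|F c| <= M) -> (forall d, `|u - d| < r -> `|F u - F d| <= e) -> 0 <= e ->
  `|Ew (coin u) N (fun v => F ((count id v)%:R / N%:R)) - F u| <= e + 2 * M / (N%:R * r ^+ 2).
Proof.
move=> N0 u01 r0 FM Fe e0.
have p0 c : 0 <= coin u c by exact: coin_ge0.
have M0 : 0 <= M by exact: le_trans (FM 0).
have NR : 0 < N%:R :> R by rewrite ltr0n.
have r2 : 0 < r ^+ 2 by exact: exprn_gt0.
rewrite -[F u](Ew_cst (coin_sum1 u) N) -EwB (le_trans (Ew_norm p0 _ _))//.
pose A := 2 * M / (N%:R ^+ 2 * r ^+ 2).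
have A0 : 0 <= A by rewrite divr_ge0 ?mulr_ge0// ltW// exprn_gt0.
apply: (@le_trans _ _ (Ew (coin u) N (fun v => e + A * ((count id v)%:R + 0 - N%:R * u) ^+ 2))).
  apply: Ew_le => // v _; set c := (count id v)%:R.
  have [h|h] := ltP `|u - c / N%:R| r.
    by rewrite distrC (le_trans (Fe _ h))// lerDl mulr_ge0// sqr_ge0.
  apply: (@le_trans _ _ (2 * M)).
    by rewrite (le_trans (ler_normB _ _))// mulrDl mul1r lerD.
  rewrite (@le_trans _ _ (A * (c + 0 - N%:R * u) ^+ 2))// ?lerDr//.
  have -> : (c + 0 - N%:R * u) ^+ 2 = N%:R ^+ 2 * `|u - c / N%:R| ^+ 2.
    by rewrite real_normK ?num_real// addr0; field; rewrite gt_eqF.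
  have h2 : r ^+ 2 <= `|u - c / N%:R| ^+ 2 by rewrite lerXn2r ?nnegrE// ltW.
  rewrite /A mulrAC ler_pdivlMr ?mulr_gt0// ?exprn_gt0// -!mulrA.
  by have NR0 := ltW NR; do 4![apply: ler_wpM2l => //].
rewrite EwD Ew_cst ?coin_sum1// lerD2l EwZ coin_variance expr0n addr0.
have h : u * (1 - u) <= 1 by case/andP: u01 => h1 h2; nra.
have -> : 2 * M / (N%:R * r ^+ 2) = A * (N%:R * 1).
  by rewrite /A; field; rewrite !gt_eqF.
by rewrite ler_wpM2l// ler_wpM2l// ltW.
Qed.

End bernstein.

(** * Convergence in distribution from trigonometric integrals *)

Section levy.
Variable R : realType.
Context {d : measure_display} {Omega : measurableType d}.
Local Notation RM := (measurableTypeR R).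
Variables (P : probability Omega R) (Y : nat -> Omega -> R) (m : probability RM R).
Hypothesis bY : forall n, bmf (Y n).
Hypothesis cvg_cos : forall a b, \int[P]_w cos (a * Y n w + b) @[n --> \oo] -->
  \int[m]_x cos (a * x + b).
Hypothesis tight : forall e : R, 0 < e -> exists2 K : R, 0 < K &
  (forall n, fine (P [set w | K < `|Y n w|]) <= e) /\ fine (m [set x | K < `|x|]) <= e.

Let bmfY n (f : RM -> R) : bmf f -> bmf (fun w => f (Y n w)).
Proof. by move=> bf; apply: bmf_comp bf; case: (bY n). Qed.

Let conv (f : RM -> R) := bmf f /\
  \int[P]_w f (Y n w) @[n --> \oo] --> \int[m]_x f x.

Let convD f h : conv f -> conv h -> conv (fun x => f x + h x).
Proof.
move=> [bf cf] [bh ch]; split; first exact: bmfD.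
have E n : \int[P]_w (f (Y n w) + h (Y n w)) = \int[P]_w f (Y n w) + \int[P]_w h (Y n w).
  by rewrite intD//; exact: bmfY.
rewrite intD//; under eq_fun do rewrite E.
exact: cvgD.
Qed.

Let convZ c f : conv f -> conv (fun x => c * f x).
Proof.
move=> [bf cf]; split; first exact: bmfZ.
have E n : \int[P]_w (c * f (Y n w)) = c * \int[P]_w f (Y n w).
  by rewrite intZ//; exact: bmfY.
rewrite intZ//; under eq_fun do rewrite E.
by apply: cvgM => //; exact: cvg_cst.
Qed.

Let bmf_cont (f : R -> R) : continuous f -> (exists M, forall x, `|f x| <= M) -> bmf (f : RM -> R).
Proof. by move=> cf bf; split=> //; exact: continuous_measurable_fun. Qed.

(* products with all cosines converge: this class is stable under multiplication by sines *)
Let tconv (f : RM -> R) := bmf f /\ forall a b, conv (fun x => f x * cos (a * x + b)).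

Let tconv_conv f : tconv f -> conv f.
Proof.
move=> [bf /(_ 0 0)]; congr conv; apply/funext => x.
by rewrite mul0r addr0 cos0 mulr1.
Qed.

Let tconv_cst c : tconv (fun=> c).
Proof.
split; first exact: bmf_cst.
by move=> a b; apply: convZ; split; [exact: bmf_cos_affine|exact: cvg_cos].
Qed.

Let tconvD f h : tconv f -> tconv h -> tconv (fun x => f x + h x).
Proof.
move=> [bf cf] [bh ch]; split; first exact: bmfD.
move=> a b; under eq_fun do rewrite mulrDl; exact: convD.
Qed.

Let tconvZ c f : tconv f -> tconv (fun x => c * f x).
Proof.
move=> [bf cf]; split; first exact: bmfZ.
by move=> a b; under eq_fun do rewrite -mulrA; exact: convZ.
Qed.

Let tconv_sin t f : tconv f -> tconv (fun x => sin (t * x) * f x).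
Proof.
move=> [bf cf]; split.
  apply: bmfM => //; apply: bmf_cont; last by exists 1 => x; exact: sin_max.
  move=> x; apply: continuous_comp; last exact: continuous_sin.
  by apply: cvgM; [exact: cvg_cst|exact: cvg_id].
move=> a b.
have -> : (fun x : RM => sin (t * x) * f x * cos (a * x + b)) = (fun x =>
    2^-1 * (f x * cos ((t + a) * x + (b - pi / 2)) + f x * cos ((t - a) * x + (- b - pi / 2)))).
  apply/funext => x.
  have -> : (t + a) * x + (b - pi / 2) = (t * x + (a * x + b)) - pi / 2 by ring.
  have -> : (t - a) * x + (- b - pi / 2) = (t * x - (a * x + b)) - pi / 2 by ring.
  by rewrite !cosBpihalf sinD sinB; field.
by apply: convZ; apply: convD.
Qed.

Let tconv_coin t N (G : seq bool -> R) :
  tconv (fun x => Ew (coin ((1 + sin (t * x)) / 2)) N G).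
Proof.
elim: N G => [|N IH] G; first exact: tconv_cst.
have -> : (fun x : RM => Ew (coin ((1 + sin (t * x)) / 2)) N.+1 G) = (fun x =>
  (2^-1 * Ew (coin ((1 + sin (t * x)) / 2)) N (fun v => G (true :: v)) +
   2^-1 * (sin (t * x) * Ew (coin ((1 + sin (t * x)) / 2)) N (fun v => G (true :: v)))) +
  (2^-1 * Ew (coin ((1 + sin (t * x)) / 2)) N (fun v => G (false :: v)) +
   - 2^-1 * (sin (t * x) * Ew (coin ((1 + sin (t * x)) / 2)) N (fun v => G (false :: v))))).
  by apply/funext => x; rewrite [LHS]/= big_bool /=; field.
by apply: tconvD; apply: tconvD; apply: tconvZ => //; exact: tconv_sin.
Qed.

(** On the segment from - K to K, [f] is a continuous function of u = (1 + sin (x / K)) / 2, hence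
   uniformly close to one of its Bernstein polynomials. As a function of x this is a
   trigonometric polynomial, whose integrals converge, and it is bounded by the same constant as
   [f] on the whole line; tightness bounds the contribution of the rest of the line. *)
Theorem levy (f : R -> R) : continuous f -> (exists M, forall x, `|f x| <= M) ->
  \int[P]_w f (Y n w) @[n --> \oo] --> \int[m]_x f x.
Proof.
move=> cf [M fM]; have M0 : 0 <= M by exact: le_trans (fM 0).
have bf : bmf (f : RM -> R) by apply: bmf_cont => //; exists M.
apply/cvgrPdist_lt => e e0.
pose ep := e / (4 * (4 * M + 4)).
have ep0 : 0 < ep by rewrite divr_gt0// mulr_gt0// ltr_wpDl// mulr_ge0.
have epE : (2 + 2 * M) * ep = e / 8 by rewrite /ep; field; rewrite gt_eqF// ltr_wpDl// mulr_ge0.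
clearbody ep.
have [K K0 [PK mK]] := tight ep0.
pose s1 : R := sin 1.
have pih : (1 : R) <= pi / 2 by exact: pihalf_ge1.
have s10 : 0 < s1 by apply: sin_gt0_pi; have := pi_ge2 R; lra.
have s11 : s1 < 1.
  rewrite lt_neqAle sin_le1 andbT; apply/eqP => h.
  have : cos (1 : R) = 0 by apply: sin1cos0; rewrite -/s1 h normr1.
  by have := cos1_gt0 R; lra.
(* the truncation of [v] to the segment from [- s1] to [s1]; as s1 = sin 1 < 1, the function [asin]
   is continuous at its values, and u = (1 + sin y) / 2 is recovered for |y| <= 1 *)
pose cl (v : R) := (`|v + s1| - `|v - s1|) / 2.
pose F (c : R) := f (K * asin (cl (2 * c - 1))).
have clB v : - s1 <= cl v <= s1.
  rewrite /cl; case: (ler0P (v + s1)) => ?; case: (ler0P (v - s1)) => ?; lra.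
have clE v : - s1 <= v <= s1 -> cl v = v.
  by rewrite /cl; case: (ler0P (v + s1)) => ?; case: (ler0P (v - s1)) => ?; lra.
have cF : continuous F.
  have c1 : continuous (fun c : R => 2 * c - 1).
    move=> c; apply: cvgB; last exact: cvg_cst.
    by apply: cvgM; [exact: cvg_cst|exact: cvg_id].
  have c2 : continuous cl.
    move=> c; apply: cvgM; last exact: cvg_cst.
    by apply: cvgB; apply: cvg_norm; [apply: cvgD|apply: cvgB]; (exact: cvg_id || exact: cvg_cst).
  have c3 (c : R) : {for c, continuous (fun c : R => cl (2 * c - 1))}.
    by apply: (@continuous_comp _ _ _ (fun c : R => 2 * c - 1) cl); [exact: c1|exact: c2].
  have c4 (c : R) : {for c, continuous (fun c : R => asin (cl (2 * c - 1)))}.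
    apply: (@continuous_comp _ _ _ (fun c : R => cl (2 * c - 1)) (@asin R)); first exact: c3.
    by apply: continuous_asin; have := clB (2 * c - 1); lra.
  have c5 (c : R) : {for c, continuous (fun c : R => K * asin (cl (2 * c - 1)))}.
    by apply: cvgM; [exact: cvg_cst|exact: c4].
  move=> c; apply: (@continuous_comp _ _ _ (fun c : R => K * asin (cl (2 * c - 1))) f).
    exact: c5.
  exact: cf.
have [r r0 Hr] := heine 0 1 cF ep0.
pose N := (Num.bound (2 * M / (r ^+ 2 * ep))).+1.
have HN : 2 * M / (N%:R * r ^+ 2) <= ep.
  have r2 : 0 < r ^+ 2 by exact: exprn_gt0.
  have B0 : 0 <= 2 * M / (r ^+ 2 * ep) by apply: divr_ge0; apply: mulr_ge0 => //; exact: ltW.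
  have hB : 2 * M / (r ^+ 2 * ep) < N%:R.
    by apply: lt_trans (archi_boundP B0) _; rewrite ltr_nat.
  rewrite ler_pdivrMr ?mulr_gt0 ?ltr0n//.
  rewrite ltr_pdivrMr ?mulr_gt0// in hB.
  by rewrite [leRHS]mulrC -mulrA ltW.
pose u (x : R) := (1 + sin (K^-1 * x)) / 2.
pose g (x : RM) := Ew (coin (u x)) N (fun v => F ((count id v)%:R / N%:R)).
have [bg cg] : conv g by apply: tconv_conv; exact: tconv_coin.
have u01 x : 0 <= u x <= 1.
  by rewrite /u; have := sin_le1 (K^-1 * x); have := sin_geN1 (K^-1 * x); lra.
have uF x : `|x| <= K -> F (u x) = f x.
  move=> xK; rewrite /F.
  have -> : 2 * u x - 1 = sin (K^-1 * x) by rewrite /u; field.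
  have /andP[y1 y2] : - 1 <= K^-1 * x <= 1.
    by rewrite -ler_norml normrM ger0_norm ?invr_ge0 ?(ltW K0)// mulrC ler_pdivrMr// mul1r.
  have i1 (y : R) : - 1 <= y <= 1 -> y \in `[(- (pi / 2)), (pi / 2)]%R.
    by move=> h; rewrite in_itv /=; lra.
  rewrite clE.
    by rewrite sinK ?i1 ?y1// mulrA divff ?mul1r// gt_eqF.
  rewrite /s1 -sinN !leNgt !ltr_sin ?i1// ?y1//; last 2 first.
  - by apply/andP; split; lra.
  - by apply/andP; split; lra.
  by rewrite -!leNgt y1.
have FM c : `|F c| <= M by exact: fM.
have gM x : `|g x| <= M.
  have p0 c : 0 <= coin (u x) c by exact: coin_ge0.
  rewrite (le_trans (Ew_norm p0 _ _))// -[leRHS](Ew_cst (coin_sum1 (u x)) N).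
  by apply: Ew_le.
have fg x : `|f x - g x| <= 2 * ep + 2 * M * \1_[set x : RM | K < `|x|] x.
  rewrite indicE; have [xK|xK] := leP `|x| K.
    rewrite memNset ?mulr0 ?addr0; last by rewrite /=; lra.
    rewrite -(uF x xK) distrC; have e0' := ltW ep0.
    have := bernstein_approx (ltn0Sn _) (u01 x) r0 FM (fun d => Hr _ d (u01 x)) e0'.
    by move/(_ N.-1)/le_trans; apply; rewrite /= -/N; lra.
  rewrite mem_set//= mulr1 (le_trans (ler_normB _ _))//.
  have := fM x; have := gM x; lra.
have mT : measurable [set x : RM | K < `|x|].
  by apply: measurable_strict_superlevel; exact: normr_measurable.
have near (d' : measure_display) (O' : measurableType d') (Q : probability O' R) (Z : O' -> RM) :
    measurable_fun setT Z -> fine (Q [set w | K < `|Z w|]) <= ep ->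
    `|\int[Q]_w f (Z w) - \int[Q]_w g (Z w)| <= (2 + 2 * M) * ep.
  move=> mZ QZ.
  have bfZ : bmf (fun w => f (Z w)) by exact: bmf_comp mZ bf.
  have bgZ : bmf (fun w => g (Z w)) by exact: bmf_comp mZ bg.
  have mTZ : measurable [set w | K < `|Z w|].
    by rewrite -[X in measurable X]setTI; exact: (mZ measurableT _ mT).
  rewrite -intB//; apply: (le_trans (int_norm _ _ _)) => //; first exact: bmfB.
  apply: (@le_trans _ _ (\int[Q]_w (2 * ep + 2 * M * \1_[set w | K < `|Z w|] w))).
    apply: int_le => //; first by apply: bmf_norm; exact: bmfB.
      by apply: bmfD; [exact: bmf_cst|apply: bmfZ; exact: bmf_indic].
  rewrite intD//; [|exact: bmf_cst|by apply: bmfZ; exact: bmf_indic].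
  rewrite int_prob_cst intZ//; last exact: bmf_indic.
  rewrite int_indic// [leRHS]mulrDl lerD2l; apply: ler_wpM2l => //; exact: mulr_ge0.
have e4 : 0 < e / 4 by exact: divr_gt0.
move/cvgrPdist_lt : cg => /(_ _ e4); apply: filterS => n hn.
have h1 := near _ _ P (Y n) (proj1 (bY n)) (PK n).
have h2 := near _ _ m id (@measurable_id _ _ _) mK.
have := ler_distD (\int[P]_w g (Y n w)) (\int[m]_x f x) (\int[P]_w f (Y n w)).
have := ler_distD (\int[m]_x g x) (\int[m]_x f x) (\int[P]_w g (Y n w)).
rewrite epE in h1 h2; rewrite distrC in h1; lra.
Qed.

End levy.

(** * The characteristic function of the normal law *)

Section gaussian.
Variables (R : realType) (s : R).
Hypothesis s_gt0 : 0 < s.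
Local Notation lam := (@lebesgue_measure R).

Let is_derive_val (f : R -> R) (x df df' : R) :
  is_derive x 1 f df -> df = df' -> is_derive x 1 f df'.
Proof. by move=> h <-. Qed.

Let is_derive_quad (c x : R) : is_derive x 1 (fun y : R => c * y ^+ 2) (c * (2 * x)).
Proof.
have h := is_deriveZ c (is_deriveX 2 (is_derive_id x (1 : R))).
apply: (is_derive_val h).
by rewrite /GRing.scale/= expr1 mulr1.
Qed.

Let is_derive_affine (a b x : R) : is_derive x 1 (fun y : R => a * y + b) a.
Proof.
have h := is_deriveD (is_deriveZ a (is_derive_id x (1 : R))) (is_derive_cst b x 1).
apply: (is_derive_val h).
by rewrite /GRing.scale/= mulr1 addr0.
Qed.

Let is_derive_exp (c x : R) :
  is_derive x 1 (fun y : R => expR (c * y ^+ 2)) (c * (2 * x) * expR (c * x ^+ 2)).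
Proof.
rewrite mulrC; exact: (is_derive1_comp (is_derive_expR _) (is_derive_quad c x)).
Qed.

Let is_derive_cont (f df : R -> R) : (forall x : R, is_derive x 1 f (df x)) -> continuous f.
Proof.
by move=> h x; apply/differentiable_continuous/derivable1_diffP; exact: ex_derive.
Qed.

Let is_deriveM' (f g : R -> R) (x df dg : R) : is_derive x 1 f df -> is_derive x 1 g dg ->
  is_derive x 1 (fun y => f y * g y) (f x * dg + g x * df).
Proof. by move=> hf hg; exact: (is_deriveM hf hg). Qed.

Let is_derive_sin_affine (a b x : R) :
  is_derive x 1 (fun y : R => sin (a * y + b)) (cos (a * x + b) * a).
Proof. exact: (is_derive1_comp (is_derive_sin _) (is_derive_affine a b x)). Qed.

Let is_derive_cos_affine (a b x : R) :
  is_derive x 1 (fun y : R => cos (a * y + b)) (- sin (a * x + b) * a).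
Proof. exact: (is_derive1_comp (is_derive_cos _) (is_derive_affine a b x)). Qed.

Let peak := normal_peak s.
Let c0 := - (2 * s ^+ 2)^-1.
Let w (x : R) := peak * expR (c0 * x ^+ 2).

Let wE : normal_pdf 0 s = w.
Proof.
rewrite normal_pdfE ?gt_eqF//; apply/funext => x; rewrite /w /peak; congr (_ * expR _).
by rewrite subr0 /c0 mulNr mulNr [in RHS]mulrC -mulr_natl.
Qed.

Let w_ge0 x : 0 <= w x.
Proof. by rewrite mulr_ge0 ?normal_peak_ge0 ?expR_ge0. Qed.

Let w_derive (x : R) : is_derive x 1 w (- (s ^+ 2)^-1 * x * w x).
Proof.
apply: (is_derive_val (is_deriveZ peak (is_derive_exp c0 x))).
by rewrite /GRing.scale/= /w /c0; field; rewrite gt_eqF.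
Qed.

Let integ (f : R -> R) := lam.-integrable setT (EFin \o f).

Let w_int : integ w.
Proof. by rewrite -wE; exact: integrable_normal_pdf. Qed.

Let cont_meas (f : R -> R) : continuous f -> measurable_fun setT (EFin \o f).
Proof. by move=> cf; apply/measurable_EFinP; exact: continuous_measurable_fun. Qed.

Let cont_id : continuous (@id R). Proof. by move=> x; exact: cvg_id. Qed.

Let contM (f g : R -> R) : continuous f -> continuous g -> continuous (fun x => f x * g x).
Proof. by move=> cf cg x; apply: cvgM; [exact: cf|exact: cg]. Qed.

Let cont_w := is_derive_cont w_derive.

(* a Gaussian absorbs linear factors at the price of a larger variance *)
Let xw_int : integ (fun x => x * w x).
Proof.
pose s' := Num.sqrt 2 * s.
have s'0 : s' != 0 by rewrite mulf_neq0 ?gt_eqF// sqrtr_gt0.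
have s'2 : s' ^+ 2 = 2 * s ^+ 2 by rewrite exprMn sqr_sqrtr.
have p'0 := normal_peak_gt0 s'0.
pose K := s * peak / normal_peak s'.
have K0 : 0 <= K by rewrite divr_ge0 ?mulr_ge0 ?normal_peak_ge0// ltW.
have ig : integ (fun x => K * normal_pdf 0 s' x).
  apply: (integrableZl measurableT K (integrable_normal_pdf 0 s')).
apply: (le_integrable _ _ _ ig) => //.
- by apply: cont_meas; exact: contM.
- move=> x _ /=; rewrite lee_fin [leRHS]ger0_norm; last by rewrite mulr_ge0// normal_pdf_ge0.
  rewrite normrM (ger0_norm (w_ge0 x)) normal_pdfE// /w /normal_fun s'2 subr0.
  set y := x ^+ 2 / (4 * s ^+ 2).
  have -> : - x ^+ 2 / ((2 * s ^+ 2) *+ 2) = - y by rewrite /y -mulr_natl; field; rewrite gt_eqF.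
  have -> : c0 * x ^+ 2 = - y + - y by rewrite /y /c0; field; rewrite gt_eqF.
  rewrite expRD /K.
  have -> : s * peak / normal_peak s' * (normal_peak s' * expR (- y)) = peak * (s * expR (- y)).
    by field; rewrite gt_eqF.
  rewrite mulrCA ler_wpM2l ?normal_peak_ge0// mulrA ler_wpM2r ?expR_ge0//.
  rewrite expRN ler_pdivrMr ?expR_gt0//.
  apply: (@le_trans _ _ (s * (1 + y))); last by apply: ler_wpM2l; [exact: ltW|exact: expR_ge1Dx].
  have h : 2 * (`|x| / (2 * s)) <= 1 + (`|x| / (2 * s)) ^+ 2.
    by have := sqr_ge0 (1 - `|x| / (2 * s)); nra.
  have -> : y = (`|x| / (2 * s)) ^+ 2.
    by rewrite /y expr_div_n real_normK ?num_real//; congr (_ / _); ring.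
  rewrite [leLHS](_ : _ = s * (2 * (`|x| / (2 * s)))); last by field; rewrite gt_eqF.
  by apply: ler_wpM2l => //; exact: ltW.
Qed.

Let osc_int (f g : R -> R) : continuous f -> continuous g -> (forall x, `|f x| <= 1) -> integ g ->
  integ (fun x => f x * g x).
Proof.
move=> cf cg f1 ig; apply: (le_integrable _ _ _ ig) => //; first by apply: cont_meas; exact: contM.
by move=> x _ /=; rewrite lee_fin normrM ler_piMl.
Qed.

Let cos_cont a b : continuous (fun x : R => cos (a * x + b)).
Proof. exact: is_derive_cont (is_derive_cos_affine a b). Qed.

Let sin_cont a b : continuous (fun x : R => sin (a * x + b)).
Proof. exact: is_derive_cont (is_derive_sin_affine a b). Qed.

Let w_small (n : nat) : w n.+1%:R <= peak * (2 * s ^+ 2) * n.+1%:R^-1.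
Proof.
rewrite /w -mulrA ler_wpM2l ?normal_peak_ge0//.
have s2 : 0 < 2 * s ^+ 2 by rewrite mulr_gt0// exprn_gt0.
have n1 : 1 <= n.+1%:R :> R by rewrite ler1n.
have -> : c0 * n.+1%:R ^+ 2 = - (n.+1%:R ^+ 2 / (2 * s ^+ 2)) by rewrite /c0 mulNr mulrC.
rewrite expRN -[leRHS]invrK lef_pV2 ?posrE ?expR_gt0 ?invr_gt0 ?mulr_gt0 ?invr_gt0//.
rewrite invfM invrK; apply: le_trans (expR_ge1Dx _).
rewrite -[leLHS]add0r lerD// [leRHS]mulrC ler_wpM2l ?invr_ge0 ?(ltW s2)//.
by rewrite expr2; apply: ler_peMl => //; exact: le_trans ler01 n1.
Qed.

(** Integration by parts, since [x * w x] is - s^2 times the derivative of [w]. *)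
Lemma gaussian_stein (a b : R) : \int[lam]_x (sin (a * x + b) * (x * w x)) =
  s ^+ 2 * a * \int[lam]_x (cos (a * x + b) * w x).
Proof.
pose F x := sin (a * x + b) * w x.
pose G x := a * (cos (a * x + b) * w x) + - (s ^+ 2)^-1 * (sin (a * x + b) * (x * w x)).
have FG (x : R) : is_derive x 1 F (G x).
  apply: (is_derive_val (is_deriveM' (is_derive_sin_affine a b x) (w_derive x))).
  by rewrite /G; ring.
have ic : integ (fun x => cos (a * x + b) * w x).
  by apply: osc_int => // x; exact: cos_max.
have is' : integ (fun x => sin (a * x + b) * (x * w x)).
  by apply: osc_int; [exact: sin_cont|exact: contM|move=> x; exact: sin_max|exact: xw_int].
have iG : integ G.
  exact: (integrableD measurableT (integrableZl measurableT a ic)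
    (integrableZl measurableT (- (s ^+ 2)^-1) is')).
have ccw : continuous (fun x => cos (a * x + b) * w x) by apply: contM => //; exact: cos_cont.
have csw : continuous (fun x => sin (a * x + b) * (x * w x)).
  by apply: contM; [exact: sin_cont|exact: contM].
have cG : continuous G.
  move=> x; apply: cvgD; apply: cvgM; try exact: cvg_cst.
    exact: ccw.
  exact: csw.
have IG : \int[lam]_x G x = a * (\int[lam]_x (cos (a * x + b) * w x)) -
    (s ^+ 2)^-1 * \int[lam]_x (sin (a * x + b) * (x * w x)).
  rewrite RintegralD//; [|exact: (integrableZl measurableT a ic)|];
    last exact: (integrableZl measurableT (- (s ^+ 2)^-1) is').
  by rewrite !RintegralZl// mulNr.
suff : \int[lam]_x G x = 0.
  rewrite IG => h; apply: (@mulfI _ ((s ^+ 2)^-1)); first by rewrite invr_neq0// gt_eqF// exprn_gt0.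
  have s2 : s ^+ 2 != 0 by rewrite gt_eqF// exprn_gt0.
  rewrite -[in RHS]mulrA [RHS]mulrA mulVf// mul1r.
  by move/eqP: h; rewrite subr_eq0 => /eqP.
pose I n : set R := `[- n.+1%:R, n.+1%:R]%classic.
have c1 : (\int[lam]_x (((EFin \o G) \_ (I n)) x))%E @[n --> \oo] --> (\int[lam]_x (G x)%:E)%E.
  apply: (@dominated_cvg _ _ _ lam setT measurableT _ _ (fun x => `|G x|%:E)) => //.
  - move=> n; apply/(measurable_restrict _ _ _) => //; first exact: measurable_itv.
    by apply: measurable_funTS; exact: cont_meas.
  - move=> x _; apply: cvg_near_cst; near=> n.
    rewrite patchE mem_set// /I/= in_itv/= -ler_norml.
    apply: ltW; apply: lt_trans (_ : n%:R < _); last by rewrite ltr_nat.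
    by near: n; exact: nbhs_infty_gtr.
  - have := integrable_abse iG; congr (integrable _ _ _).
  - move=> n x _; rewrite patchE; by case: ifP => _; rewrite /= ?normr0 lee_fin.
have c2 : (\int[lam]_x (((EFin \o G) \_ (I n)) x))%E @[n --> \oo] --> 0%E.
  have E n : (\int[lam]_x (((EFin \o G) \_ (I n)) x))%E = (F n.+1%:R - F (- n.+1%:R))%:E.
    rewrite -integral_mkcond EFinB; apply: continuous_FTC2.
    - by rewrite (@lt_trans _ _ 0)// ?oppr_lt0 ltr0n.
    - exact: continuous_subspaceT.
    - split.
      + by move=> x _; exact: ex_derive.
      + apply: cvg_at_right_filter; exact: is_derive_cont FG _.
      + apply: cvg_at_left_filter; exact: is_derive_cont FG _.
    - by move=> x _; rewrite derive1E; exact: derive_val.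
  under eq_fun do rewrite E.
  apply: cvg_EFin; first exact: nearW.
  pose B := peak * (2 * s ^+ 2).
  have FB n : `|F n.+1%:R - F (- n.+1%:R)| <= 2 * B * n.+1%:R^-1.
    have wN : w (- n.+1%:R) = w n.+1%:R by rewrite /w sqrrN.
    have h y : `|F y| <= w y.
      by rewrite /F normrM (ger0_norm (w_ge0 y)) ler_piMl// sin_max.
    rewrite (le_trans (ler_normB _ _))//; have := w_small n; rewrite -/B => hw.
    rewrite -mulrA mulr_natl mulr2n; apply: lerD; apply: le_trans (h _) _ => //.
    by rewrite wN.
  apply/norm_cvg0P; apply: (@squeeze_cvgr _ _ _ _ (fun=> 0) (fun n => 2 * B * n.+1%:R^-1)).
  - by apply: nearW => n; rewrite normr_ge0 FB.
  - exact: cvg_cst.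
  - rewrite -[X in _ --> X](mulr0 (2 * B)); apply: cvgM; first exact: cvg_cst.
    exact: cvg_harmonic.
have := cvg_unique _ c1 c2.
rewrite /Rintegral => ->//.
Unshelve. all: by end_near. Qed.

(** By [gaussian_stein] the left-hand side, as a function Phi of the frequency, satisfies the
   differential equation Phi' (t) = - s^2 t Phi (t). *)
Lemma gaussian_cos (a b : R) :
  \int[lam]_x (cos (a * x + b) * w x) = expR (- (a ^+ 2 / 2 * s ^+ 2)) * cos b.
Proof.
pose Phi t := \int[lam]_x (cos (t * x + b) * w x).
have dPhi (t : R) : is_derive t 1 Phi (- (s ^+ 2 * t * Phi t)).
  pose f (t y : R) := cos (t * y + b) * w y.
  have df (y t' : R) : is_derive t' 1 (f ^~ y) (- sin (t' * y + b) * y * w y).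
    have h : is_derive t' 1 (fun t => cos (y * t + b)) (- sin (y * t' + b) * y).
      exact: is_derive_cos_affine.
    have h' := is_deriveM' h (is_derive_cst (w y) t' 1).
    have -> : f ^~ y = (fun t => cos (y * t + b) * w y).
      by apply/funext => u; rewrite /f mulrC [u * y]mulrC mulrC.
    by apply: (is_derive_val h'); rewrite /cst [t' * y]mulrC; ring.
  have tI : `]t - 1, t + 1[%classic t by rewrite /= in_itv/=; apply/andP; split; lra.
  have fint t' : `]t - 1, t + 1[%classic t' -> integ (f t').
    by move=> _; apply: osc_int => // x; exact: cos_max.
  have fder t' y : `]t - 1, t + 1[%classic t' -> setT y -> derivable (f ^~ y) t' 1.
    by move=> _ _; exact: ex_derive.
  have Gint : integ (fun y => `|y * w y|) by exact: integrable_norm xw_int.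
  have Gub t' y : `]t - 1, t + 1[%classic t' -> setT y -> `|partial1of2 f t' y| <= `|y * w y|.
    move=> _ _; rewrite partial1of2E (@derive_val _ _ _ _ _ _ _ (df y t')).
    by rewrite -mulrA normrM normrN ler_piMl// sin_max.
  have D := derivable_under_integral measurableT tI fint fder (fun y => normr_ge0 (y * w y)) Gint Gub.
  have E := differentiation_under_integral measurableT tI fint fder (fun y => normr_ge0 (y * w y)) Gint Gub.
  apply: (is_derive_val (DeriveDef D erefl)).
  rewrite -derive1E E -(gaussian_stein t b).
  under eq_Rintegral => y _ do rewrite partial1of2E (@derive_val _ _ _ _ _ _ _ (df y t)).
  rewrite -mulN1r -RintegralZl//; last first.
    by apply: osc_int; [exact: sin_cont|exact: contM|move=> x; exact: sin_max|exact: xw_int].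
  by apply: eq_Rintegral => y _; ring.
pose psi t := Phi t * expR (s ^+ 2 / 2 * t ^+ 2).
have dpsi (t : R) : is_derive t 1 psi 0.
  apply: (is_derive_val (is_deriveM' (dPhi t) (is_derive_exp (s ^+ 2 / 2) t))).
  by field.
have Phi0 : Phi 0 = cos b.
  rewrite /Phi; under eq_Rintegral => x _ do rewrite mul0r add0r.
  rewrite RintegralZl// -[RHS]mulr1; congr (_ * _).
  by rewrite -wE /Rintegral integral_normal_pdf.
have := is_derive_0_is_cst a 0 dpsi.
rewrite /psi expr0n/= mulr0 expR0 mulr1 Phi0 => <-.
rewrite mulrCA -expRD -/(Phi a).
have -> : - (a ^+ 2 / 2 * s ^+ 2) + s ^+ 2 / 2 * a ^+ 2 = 0 by ring.
by rewrite expR0 mulr1.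
Qed.

Lemma normal_prob_cos (a b : R) :
  \int[(normal_prob 0 s : probability (measurableTypeR R) R)]_x cos (a * x + b) =
  expR (- (a ^+ 2 / 2 * s ^+ 2)) * cos b.
Proof.
rewrite -gaussian_cos.
pose L (f : measurableTypeR R -> R) := \int[lam]_x (f x * w x).
have iL (f : measurableTypeR R -> R) : bmf f -> integ (fun x => f x * w x).
  move=> [mf [M fM]]; apply: (le_integrable _ _ _ (integrableZl measurableT M w_int)) => //.
    apply/measurable_EFinP; apply: measurable_funM => //; exact: continuous_measurable_fun.
  move=> x _ /=; rewrite lee_fin !normrM; apply: ler_wpM2r => //.
  by rewrite (le_trans (fM x))// ler_norm.
rewrite -[RHS]/(L (fun x => cos (a * x + b))); apply/esym.
apply: (@int_unique _ _ R (normal_prob 0 s : probability (measurableTypeR R) R) L 1).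
- move=> f h bf bh; rewrite /L -RintegralD//; [|exact: iL|exact: iL].
  by apply: eq_Rintegral => x _; rewrite mulrDl.
- move=> c f bf; rewrite /L -RintegralZl//; last exact: iL.
  by apply: eq_Rintegral => x _; rewrite mulrA.
- move=> f e bf fe; rewrite /L.
  apply: (le_trans (le_normr_Rintegral _ _)) => //; first exact: iL.
  have -> : 1 * e = \int[lam]_x (e * w x).
    rewrite RintegralZl// mul1r -wE /Rintegral integral_normal_pdf/= mulr1//.
  apply: le_Rintegral => //.
  + exact: integrable_norm (iL f bf).
  + exact: (integrableZl measurableT e w_int).
  + by move=> x _; rewrite normrM (ger0_norm (w_ge0 x)) ler_wpM2r.
- move=> A mA; rewrite /L /Rintegral /normal_prob; congr fine.
  rewrite [RHS]integral_mkcond; apply: eq_integral => x _.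
  by rewrite patchE indicE -wE; case: (x \in A) => /=; rewrite ?mul1r ?mul0r.
- split; last by exists 1 => x; exact: cos_max.
  by apply: continuous_measurable_fun; exact: cos_cont.
Qed.

End gaussian.

(** * The corrector *)

Section corrector.
Variables (R : realType) (I : finType).
Local Notation C := (circle R).
Variables (p : I -> R) (g ginv : I -> C -> C) (mu : probability C R).
Hypothesis p_gt0 : forall i, 0 < p i.
Hypothesis p_sum1 : \sum_i p i = 1.
Hypothesis cg : forall i, continuous (g i).
Hypothesis cginv : forall i, continuous (ginv i).
Hypothesis gK : forall i, cancel (g i) (ginv i).
Hypothesis ginvK : forall i, cancel (ginv i) (g i).
Hypothesis mu_inv : forall A, measurable A ->
  \sum_i p i * fine (mu (g i @^-1` A)) = fine (mu A).
Hypothesis mu_noinv : noinv (R := R) g.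
Hypothesis g_min : forall (O : set C) x, open O -> O !=set0 -> exists w, O (gw g w x).

Definition increment (h : C -> R) i x := h (g i x) - Uop p g h x.

Let p_ge0 i : 0 <= p i. Proof. exact: ltW. Qed.

Let mg i : measurable_fun setT (g i). Proof. exact: continuous_measurable_map. Qed.

Lemma increment_mean0 h x : \sum_i p i * increment h i x = 0.
Proof.
rewrite /increment; under eq_bigr do rewrite mulrBr.
by rewrite sumrB -mulr_suml p_sum1 mul1r subrr.
Qed.

Lemma bmf_increment h i : bmf h -> bmf (increment h i).
Proof. by move=> bh; apply: bmfB; [exact: bmf_comp (mg i) bh|exact: bmf_Uop]. Qed.

Lemma cond_var_increment h x :
  cond_var p (increment h) x = Uop p g (fun y => h y ^+ 2) x - Uop p g h x ^+ 2.
Proof.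
rewrite /cond_var /increment; set u := Uop p g h x.
have -> : \sum_i p i * (h (g i x) - u) ^+ 2 =
    \sum_i (p i * h (g i x) ^+ 2 + - (2 * u) * (p i * h (g i x)) + p i * u ^+ 2).
  by apply: eq_bigr => i _; ring.
rewrite !big_split/= -mulr_suml p_sum1 -mulr_sumr -/(Uop p g h x) -/u.
by rewrite /Uop; ring.
Qed.

(** Up to a coboundary and a small error, the conditional variance of the martingale increments
   is constant: it is cohomologous to [2 h f - f ^ 2], which the approximants [hk] of [h] replace
   by functions for which the Poisson equation is solvable. *)
Lemma poisson_corrector (f : C -> R) : lipschitz_continuous f -> \int[mu]_x f x = 0 ->
  exists h, [/\ bmf h, forall x, h x - Uop p g h x = f x &
    forall e : R, 0 < e -> exists2 q, bmf q &
      \int[mu]_x `|cond_var p (increment h) x + Uop p g q x - q x -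
        \int[mu]_y cond_var p (increment h) y| <= e].
Proof.
move=> Lf f0.
have [kappa [lip solve]] := poisson_minimal p_gt0 p_sum1 cg cginv gK ginvK mu_inv mu_noinv g_min.
have lf := lip f Lf; have bf : bmf f by case: lf.
have [h [hk [B [lhk hkB hkh hU]]]] := solve f lf f0.
have bhk n : bmf (hk n) by case: (lhk n).
have [bh hB] := bmf_lim bhk hkB hkh.
exists h; split=> // e e0.
pose w n x := 2 * hk n x * f x - f x ^+ 2.
pose w' x := 2 * h x * f x - f x ^+ 2.
have lw n : arc_lip kappa (w n).
  have -> : w n = (fun x => 2 * (hk n x * f x) + - 1 * (f x * f x)).
    by apply/funext => x; rewrite /w; ring.
  by apply: arc_lipD; apply: arc_lipZ; exact: arc_lipM.
have bw n : bmf (w n) by case: (lw n).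
have bw' : bmf w'.
  by apply: bmfB; [apply: bmfM => //; exact: bmfZ|exact: bmfM].
have bh2 : bmf (fun x => h x ^+ 2) by exact: bmfM.
have bUh : bmf (Uop p g h) by exact: bmf_Uop.
have bUh2 : bmf (Uop p g (fun x => h x ^+ 2)) by exact: bmf_Uop.
have UhE x : Uop p g h x = h x - f x by rewrite -hU opprB addrC subrK.
have sgE : \int[mu]_y cond_var p (increment h) y = \int[mu]_y w' y.
  have -> : \int[mu]_y cond_var p (increment h) y =
      \int[mu]_y (Uop p g (fun x => h x ^+ 2) y - (h y - f y) ^+ 2).
    by apply: eq_Rintegral => y _; rewrite cond_var_increment UhE.
  have bhf : bmf (fun x => (h x - f x) ^+ 2) by apply: bmfM; exact: bmfB.
  rewrite intB// int_Uop// -intB//.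
  by apply: eq_Rintegral => y _; rewrite /w'; ring.
pose a n := \int[mu]_x (`|hk n x - h x| * `|f x|).
have ba n : bmf (fun x => `|hk n x - h x| * `|f x|).
  by apply: bmfM; apply: bmf_norm => //; exact: bmfB.
have a0 : a n @[n --> \oo] --> (0 : R).
  have [_ [M fM]] := bf.
  have -> : (0 : R) = \int[mu]_x (0 : R) by rewrite int_prob_cst.
  apply: (@int_lim _ _ _ _ _ _ (2 * B * M)) => //.
    move=> n x; rewrite normrM !normr_id ler_pM//.
    by rewrite (le_trans (ler_normB _ _))// mulrDl mul1r lerD.
  move=> x; rewrite -[X in _ --> X](mul0r `|f x|); apply: cvgM; last exact: cvg_cst.
  apply/norm_cvg0P; rewrite -(subrr (h x)); apply: cvgB; [exact: hkh|exact: cvg_cst].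
have e4 : 0 < e / 4 by exact: divr_gt0.
move/cvgrPdist_lt : a0 => /(_ _ e4)[n _ /(_ n (leqnn n))].
rewrite sub0r normrN ger0_norm; last by apply: int_ge0 => x _; exact: mulr_ge0.
move=> an.
pose c := \int[mu]_x w n x.
have [q [_ [_ [qk [Q [lqk qkQ qkq qU]]]]]] : exists q, bmf q /\ exists (q' : C -> R) qk (Q : R),
    [/\ forall n, arc_lip kappa (qk n), forall n x, `|qk n x| <= Q,
        forall x, qk n x @[n --> \oo] --> q x & forall x, q x - Uop p g q x = w n x - c].
  have lwc : arc_lip kappa (fun x => w n x + - c) by apply: arc_lipD => //; exact: arc_lip_cst.
  have wc0 : \int[mu]_x (w n x + - c) = 0.
    by rewrite intB ?int_prob_cst ?subrr//; exact: bmf_cst.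
  have [q [qk [Q [lqk qkQ qkq qU]]]] := solve _ lwc wc0.
  exists q; split; last by exists q, qk, Q.
  by have [] := bmf_lim (fun n => proj1 (lqk n)) qkQ qkq.
have bq : bmf q by have [] := bmf_lim (fun n => proj1 (lqk n)) qkQ qkq.
exists (fun x => q x - h x ^+ 2); first exact: bmfB.
rewrite sgE.
have E x : cond_var p (increment h) x + Uop p g (fun y => q y - h y ^+ 2) x - (q x - h x ^+ 2) -
    \int[mu]_y w' y = 2 * ((h x - hk n x) * f x) + (c - \int[mu]_y w' y).
  rewrite cond_var_increment UopB UhE.
  have -> : Uop p g q x = q x - (w n x - c) by rewrite -qU opprB addrC subrK.
  by rewrite /w; ring.
under eq_Rintegral => x _ do rewrite E.
have cw : `|c - \int[mu]_y w' y| <= 2 * a n.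
  rewrite /c -intB// /a -intZ//; apply: (le_trans (int_norm _ _ _)) => //; first exact: bmfB.
  apply: int_le => //; [by apply: bmf_norm; exact: bmfB|exact: bmfZ|].
  move=> x _; have -> : w n x - w' x = 2 * ((hk n x - h x) * f x) by rewrite /w /w'; ring.
  by rewrite !normrM ger0_norm.
apply: (@le_trans _ _ (\int[mu]_x (2 * (`|hk n x - h x| * `|f x|) + 2 * a n))).
  apply: int_le => //.
  - apply: bmf_norm; apply: bmfD; last exact: bmf_cst.
    by apply: bmfZ; apply: bmfM => //; exact: bmfB.
  - by apply: bmfD; [exact: bmfZ|exact: bmf_cst].
  - move=> x _; rewrite (le_trans (ler_normD _ _))// lerD//.
    by rewrite !normrM ger0_norm// distrC.
rewrite intD//; [|exact: bmfZ|exact: bmf_cst].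
by rewrite intZ// int_prob_cst -/(a n); lra.
Qed.

End corrector.

Lemma normal_law_cos (R : realType) (v a b : R) : 0 <= v ->
  \int[normal_law v]_x cos (a * x + b) = expR (- (a ^+ 2 / 2 * v)) * cos b.
Proof.
move=> v0; rewrite /normal_law; case: eqVneq => [->|vn].
  rewrite mulr0 oppr0 expR0 mul1r /Rintegral integral_dirac//.
    by rewrite diracT mul1e/= mulr0 add0r.
  by apply/measurable_EFinP; apply: continuous_measurable_fun; exact: continuous_cos_affine.
have s0 : 0 < Num.sqrt v by rewrite sqrtr_gt0 lt_neqAle eq_sym vn.
by rewrite (normal_prob_cos s0) sqr_sqrtr.
Qed.

(** * The central limit theorem *)

Section clt.
Variables (R : realType) (k : nat).
Local Notation C := (circle R).
Variables (p : 'I_k -> R) (g : 'I_k -> C -> C) (mu : probability C R).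
Hypothesis p_gt0 : forall i, 0 < p i.
Hypothesis p_sum1 : \sum_i p i = 1.
Hypothesis cg : forall i, continuous (g i).
Hypothesis mu_inv : forall A, measurable A ->
  \sum_i p i * fine (mu (g i @^-1` A)) = fine (mu A).
Variables (f h : C -> R).
Hypothesis bh : bmf h.
Hypothesis hU : forall x, h x - Uop p g h x = f x.
Local Notation D := (increment p g h).
Let sg := \int[mu]_x cond_var p D x.
Hypothesis corr : forall e : R, 0 < e -> exists2 q, bmf q &
  \int[mu]_x `|cond_var p D x + Uop p g q x - q x - sg| <= e.
Context {d : measure_display} {Omega : measurableType d}.
Variables (P : probability Omega R) (X : nat -> Omega -> C) (idx : nat -> Omega -> 'I_k).
Hypothesis mX0 : measurable_fun setT (X 0%N).
Hypothesis X0_law : forall A, measurable A -> P (X 0%N @^-1` A) = mu A.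
Hypothesis idx_driving : driving_sequence p P idx.
Hypothesis X0_indep : independent_systems P (preimage_set_system setT (X 0%N) measurable)
  <<s \bigcup_n index_sigma (idx n) >>.
Hypothesis X_rec : forall n w, X n.+1 w = g (idx n w) (X n w).

Let p_ge0 i : 0 <= p i. Proof. exact: ltW. Qed.

Let mg i : measurable_fun setT (g i). Proof. exact: continuous_measurable_map. Qed.

Let bD i : bmf (D i). Proof. by apply: bmf_increment. Qed.

Let sg_ge0 : 0 <= sg.
Proof.
by apply: int_ge0 => x _; apply: sumr_ge0 => i _; rewrite mulr_ge0// sqr_ge0.
Qed.

Let rt (n : nat) : R := (Num.sqrt n%:R)^-1.
Let rt_ge0 n : 0 <= rt n. Proof. by rewrite invr_ge0 sqrtr_ge0. Qed.
Let rt_le1 n : rt n <= 1.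
Proof.
case: n => [|n]; first by rewrite /rt sqrtr0 invr0.
rewrite /rt invf_le1 ?sqrtr_gt0 ?ltr0n// -[leLHS]sqrtr1 ler_sqrt ?ler1n// ltr0n.
Qed.
Let rt2 n : rt n ^+ 2 * n%:R <= 1.
Proof.
case: n => [|n]; first by rewrite mulr0.
by rewrite /rt exprVn sqr_sqrtr ?ler0n// mulVf.
Qed.

Let Y := normalized_sum f X.
Let M n (w : Omega) : R := rt n * mart g D (driving_word idx n w) (X 0%N w).

(** f (X_j) = h (X_j) - U h (X_j), and h (X_(j+1)) - U h (X_j) is an increment of the martingale. *)
Lemma sum_mart n w : \sum_(0 <= j < n.+1) f (X j w) =
  h (X 0%N w) + mart g D (driving_word idx n w) (X 0%N w) - Uop p g h (X n w).
Proof.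
elim: n => [|n IH]; first by rewrite big_nat1 -hU addr0.
rewrite driving_wordS mart_rcons -(chain_gw X_rec) /increment -X_rec big_nat_recr//= IH -hU.
by ring.
Qed.

Variable B : R.
Hypothesis hB : forall x, `|h x| <= B.

Let B0 : 0 <= B. Proof. exact: le_trans (hB point). Qed.

Let YM n w : `|Y n w - M n w| <= rt n * (2 * B).
Proof.
rewrite /Y /normalized_sum sum_mart /M -/(rt n) mulrC -mulrBr normrM (ger0_norm (rt_ge0 n)).
apply: ler_wpM2l => //; set a := mart _ _ _ _.
have -> : h (X 0%N w) + a - Uop p g h (X n w) - a = h (X 0%N w) - Uop p g h (X n w) by ring.
rewrite (le_trans (ler_normB _ _))// mulrDl mul1r lerD//.
by apply: (Uop_bound p_ge0 p_sum1).
Qed.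

Let bF (F : seq 'I_k -> C -> R) n : (forall v, bmf (F v)) ->
  bmf (fun w => F (driving_word idx n w) (X 0%N w)).
Proof. by move=> bF'; have [] := chain_law p_gt0 mX0 X0_law idx_driving X0_indep n bF'. Qed.

Let intF (F : seq 'I_k -> C -> R) n : (forall v, bmf (F v)) ->
  \int[P]_w F (driving_word idx n w) (X 0%N w) = \int[mu]_x Ew p n (fun v => F v x).
Proof. by move=> bF'; have [] := chain_law p_gt0 mX0 X0_law idx_driving X0_indep n bF'. Qed.

Let bmart v : bmf (mart g D v). Proof. exact: bmf_mart. Qed.

Let bM n : bmf (M n).
Proof. by apply: bmfZ; exact: bF bmart. Qed.

Let bY n : bmf (Y n).
Proof.
have -> : Y n = fun w => rt n * (h (X 0%N w) +
    mart g D (driving_word idx n w) (X 0%N w) -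
    Uop p g h (gw g (driving_word idx n w) (X 0%N w))).
  by apply/funext => w; rewrite /Y /normalized_sum sum_mart -(chain_gw X_rec) mulrC.
apply: bmfZ; apply: (bF (F := fun v x => h x + mart g D v x - Uop p g h (gw g v x))) => v.
apply: bmfB; first exact: bmfD.
by apply: bmf_comp (mgw mg v) _; exact: bmf_Uop.
Qed.

Let M2 n : \int[P]_w (M n w ^+ 2) = rt n ^+ 2 * (n%:R * sg).
Proof.
have b2 v : bmf (fun x => mart g D v x ^+ 2) by exact: bmfM.
rewrite -(mart_second_moment p_ge0 p_sum1 mg mu_inv bD (increment_mean0 g p_sum1 h)).
rewrite -(intF n b2) -intZ//; last exact: bF b2.
by apply: eq_Rintegral => w _; rewrite /M exprMn.
Qed.

Let M2_le n : \int[P]_w (M n w ^+ 2) <= sg.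
Proof. by rewrite M2 mulrA ler_piMl. Qed.

Let c := 2 * B.
Let c_ge0 : 0 <= c. Proof. by rewrite mulr_ge0. Qed.

Let Y2M2 n : `|\int[P]_w (Y n w ^+ 2) - \int[P]_w (M n w ^+ 2)| <=
  rt n * (c ^+ 2 + c * (1 + sg)).
Proof.
have bY2 : bmf (fun w => Y n w ^+ 2) by exact: bmfM.
have bM2 : bmf (fun w => M n w ^+ 2) by exact: bmfM.
rewrite -intB//; apply: (le_trans (int_norm _ _ _)) => //; first exact: bmfB.
apply: (@le_trans _ _ (\int[P]_w (rt n * (c ^+ 2 + c) + rt n * c * M n w ^+ 2))).
  apply: int_le => //; first by apply: bmf_norm; exact: bmfB.
    by apply: bmfD; [exact: bmf_cst|exact: bmfZ].
  move=> w _; set y := Y n w; set m := M n w.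
  have hy : `|y - m| <= rt n * c := YM n w.
  have -> : y ^+ 2 - m ^+ 2 = (y - m) * ((y - m) + 2 * m) by ring.
  have m2 : 2 * `|m| <= 1 + m ^+ 2.
    by rewrite -[m ^+ 2]real_normK ?num_real//; have := sqr_ge0 (1 - `|m|); nra.
  have h1 : `|(y - m) + 2 * m| <= c + (1 + m ^+ 2).
    rewrite (le_trans (ler_normD _ _))// normrM (ger0_norm (ler0n R 2)) lerD//.
    by rewrite (le_trans hy)// ler_piMl.
  rewrite normrM (@le_trans _ _ (rt n * c * (c + (1 + m ^+ 2))))//.
    exact: ler_pM.
  by rewrite le_eqVlt; apply/orP; left; apply/eqP; ring.
rewrite intD//; [|exact: bmf_cst|exact: bmfZ].
rewrite int_prob_cst intZ//.
have -> : rt n * (c ^+ 2 + c * (1 + sg)) = rt n * (c ^+ 2 + c) + rt n * c * sg by ring.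
by rewrite lerD2l; apply: ler_wpM2l => //; exact: mulr_ge0.
Qed.

Let second_moment : \int[P]_w (Y n w ^+ 2) @[n --> \oo] --> sg.
Proof.
apply/cvgrPdist_lt => e e0; near=> n.
have n0 : (0 < n)%N by near: n; exact: nbhs_infty_gt.
have M2E : \int[P]_w (M n w ^+ 2) = sg.
  by rewrite M2 mulrA /rt exprVn sqr_sqrtr ?ler0n// mulVf ?mul1r// pnatr_eq0 -lt0n.
have := Y2M2 n; rewrite M2E distrC => /le_lt_trans; apply.
by near: n; exact: invsqrt_small.
Unshelve. all: by end_near. Qed.

Let tight (e : R) : 0 < e -> exists2 K : R, 0 < K &
  (forall n, fine (P [set w | K < `|Y n w|]) <= e) /\
  fine (normal_law sg [set x | K < `|x|]) <= e.
Proof.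
move=> e0.
pose C2 := sg + (c ^+ 2 + c * (1 + sg)).
have C20 : 0 <= C2 by rewrite !addr_ge0// ?sqr_ge0// mulr_ge0// addr_ge0.
have Y2 n : \int[P]_w (Y n w ^+ 2) <= C2.
  have := Y2M2 n; rewrite ler_norml => /andP[_ h2].
  have h3 : rt n * (c ^+ 2 + c * (1 + sg)) <= c ^+ 2 + c * (1 + sg).
    by rewrite ler_piMl// addr_ge0 ?sqr_ge0// mulr_ge0// addr_ge0.
  by have := M2_le n; rewrite /C2; lra.
have mT (r : R) : measurable [set x : measurableTypeR R | r < `|x|].
  by apply: measurable_strict_superlevel; exact: normr_measurable.
have [n hn] : exists n : nat, fine (normal_law sg [set x | n%:R < `|x|]) <= e.
  have : fine (normal_law sg [set x | n%:R < `|x|]) @[n --> \oo] --> (0 : R).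
    apply: measure_decr_cvg => //.
    - by move=> n x /=; apply: lt_trans; rewrite ltr_nat.
    - rewrite -subset0 => x Hx; have := archi_boundP (normr_ge0 x).
      by have := Hx (Num.bound `|x|) Logic.I; rewrite /= => /lt_trans ht /ht; rewrite ltxx.
  move/cvgrPdist_lt => /(_ _ e0)[n _ /(_ n (leqnn n))].
  by rewrite sub0r normrN ger0_norm ?fine_ge0// => /ltW; exists n.
pose K := n%:R + 1 + C2 / e.
have Ce0 : 0 <= C2 / e by rewrite divr_ge0// ltW.
have K1 : 1 <= K by have := ler0n R n; rewrite /K; lra.
have K0 : 0 < K by lra.
exists K => //; split=> [j|].
  have mY : measurable [set w | K < `|Y j w|].
    by rewrite -[X in measurable X]setTI; exact: (proj1 (bY j) measurableT _ (mT K)).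
  have bY2 : bmf (fun w => Y j w ^+ 2) by exact: bmfM.
  have := @markov_ineq _ _ _ P (fun w => Y j w ^+ 2) [set w | K < `|Y j w|] (K ^+ 2) bY2 mY.
  move=> /(_ (fun w => sqr_ge0 _) (exprn_gt0 2 K0)).
  have hK w : K < `|Y j w| -> K ^+ 2 <= Y j w ^+ 2.
    move=> hw; rewrite -[leRHS]real_normK ?num_real//.
    by apply: lerXn2r; rewrite ?nnegrE ?(ltW K0) ?(ltW hw).
  move=> /(_ hK) hm; have {hm} := le_trans hm (Y2 j).
  rewrite -ler_pdivlMl ?exprn_gt0// => /le_trans; apply.
  rewrite ler_pdivrMl ?exprn_gt0//.
  have : C2 <= K * e by rewrite -ler_pdivrMr// /K; have := ler0n R n; lra.
  move/le_trans; apply; apply: ler_wpM2r; first exact: ltW.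
  by rewrite expr2 ler_peMl// ltW.
apply: le_trans hn; apply: fine_measure_le => //.
by move=> x /=; apply: le_lt_trans; rewrite /K; lra.
Qed.

(** The sum differs from the martingale by a bounded amount, so that after division by sqrt n both
   have the same limits of second moments and of characteristic functions. *)
Lemma chain_clt : [/\ forall n, bmf (Y n), \int[P]_w (Y n w ^+ 2) @[n --> \oo] --> sg &
  forall F : R -> R, continuous F -> (exists K, forall x, `|F x| <= K) ->
    \int[P]_w F (Y n w) @[n --> \oo] --> \int[normal_law sg]_x F x].
Proof.
split; [exact: bY|exact: second_moment|move=> F cF bF'].
apply: levy => //.
move=> a b; rewrite normal_law_cos//.
have bcosA (a' : R) := bmf_cos_affine a' b.
have bcos (v : Omega -> R) : bmf v -> bmf (fun w => cos (a * v w + b)).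
  by move=> [mv _]; exact: bmf_comp mv (bcosA a).
have cM : \int[P]_w cos (a * M n w + b) @[n --> \oo] --> expR (- (a ^+ 2 / 2 * sg)) * cos b.
  have E n : \int[P]_w cos (a * M n w + b) =
      \int[mu]_x Ew p n (fun v => cos (b + a / Num.sqrt n%:R * mart g D v x)).
    rewrite -(intF (F := fun v x => cos (b + a / Num.sqrt n%:R * mart g D v x))).
      by apply: eq_Rintegral => w _; congr cos; rewrite /M /rt; ring.
    move=> v; have := bmf_comp (proj1 (bmart v)) (bcosA (a / Num.sqrt n%:R)).
    by under eq_fun do rewrite addrC.
  under eq_fun do rewrite E.
  exact: (mart_cos_cvg p_ge0 p_sum1 mg mu_inv bD (increment_mean0 g p_sum1 h) sg_ge0 corr).
apply/cvgrPdist_lt => e e0.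
have e2 : 0 < e / 2 by exact: divr_gt0.
move/cvgrPdist_lt : cM => /(_ _ e2) cM; near=> n.
have h1 : `|expR (- (a ^+ 2 / 2 * sg)) * cos b - \int[P]_w cos (a * M n w + b)| < e / 2.
  by near: n.
have h2 : `|\int[P]_w cos (a * M n w + b) - \int[P]_w cos (a * Y n w + b)| <= rt n * (`|a| * c).
  rewrite -intB//; [|exact: bcos|exact: bcos].
  apply: (le_trans (int_norm _ _ _)) => //; first by apply: bmfB; exact: bcos.
  rewrite -[leRHS](int_prob_cst P); apply: int_le => //.
  - by apply: bmf_norm; apply: bmfB; exact: bcos.
  - exact: bmf_cst.
  - move=> w _; apply: (le_trans (cos_lip _ _)).
    have -> : a * M n w + b - (a * Y n w + b) = a * (M n w - Y n w) by ring.
    by rewrite normrM mulrCA ler_wpM2l// distrC; exact: YM.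
have h3 : rt n * (`|a| * c) < e / 2 by near: n; exact: invsqrt_small.
have := ler_distD (\int[P]_w cos (a * M n w + b)) (expR (- (a ^+ 2 / 2 * sg)) * cos b)
  (\int[P]_w cos (a * Y n w + b)).
lra.
Unshelve. all: by end_near. Qed.

End clt.

Theorem theorem9 (R : realType) (k : nat) (g : 'I_k -> circle R -> circle R)
    (g_homeo : forall i, homeomorphism (g i))
    (g_minimal : acts_minimally g)
    (g_noinv : ~ exists mu : probability (circle R) R, invariant_by_family g mu)
    (p : 'I_k -> R) (p_gt0 : forall i, 0 < p i) (p_sum1 : \sum_(i < k) p i = 1)
    (mu : probability (circle R) R) (mu_inv : invariant_for_ifs g p mu)
    (phi : circle R -> R) (phi_lip : lipschitz_continuous phi)
    (phi_mean0 : (\int[mu]_x (phi x)%:E = 0)%E)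
    (d : measure_display) (Omega : measurableType d) (P : probability Omega R)
    (X : nat -> Omega -> circle R) (X_chain : stationary_chain g p mu P X) :
  exists sigma2 : R,
    ('E_P[fun w => (normalized_sum phi X n w ^+ 2)%R]%E @[n --> \oo] --> sigma2%:E)
    /\ cvg_in_distribution P (normalized_sum phi X) (normal_law sigma2).
Proof.
have /choice[ginv gV] : forall i, exists h, [/\ continuous h, cancel (g i) h & cancel h (g i)].
  by move=> i; have [_] := g_homeo i.
have cg i : continuous (g i) by have [] := g_homeo i.
have cginv i : continuous (ginv i) by have [] := gV i.
have gK i : cancel (g i) (ginv i) by have [] := gV i.
have ginvK i : cancel (ginv i) (g i) by have [] := gV i.
have mg i : measurable_fun setT (g i) by exact: continuous_measurable_map.
have mu_fine A : measurable A -> \sum_i p i * fine (mu (g i @^-1` A)) = fine (mu A).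
  move=> mA; rewrite -(mu_inv A mA) /markov_operator /pushforward.
  have -> : (\sum_(i < k) (p i)%:E * mu (g i @^-1` A))%E =
      (\sum_i p i * fine (mu (g i @^-1` A)))%:E.
    rewrite -sumEFin; apply: eq_bigr => i _; rewrite EFinM fineK// fin_num_measure//.
    by rewrite -[X in measurable X]setTI; exact: mg.
  by [].
have g_min (O : set (circle R)) x : open O -> O !=set0 -> exists w, O (gw g w x).
  by move=> oO O0; have [y [Oy [w [_ yw]]]] := g_minimal x O O0 oO; exists w; rewrite -[gw g w x]yw.
have f0 : \int[mu]_x phi x = 0 by rewrite /Rintegral phi_mean0.
have [h [bh hU corr]] := poisson_corrector p_gt0 p_sum1 cg cginv gK ginvK mu_fine g_noinv g_min
  phi_lip f0.
have [mX0 X0_law [idx [idx_driving X0_indep X_rec]]] := X_chain.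
have [_ [B hB]] := bh.
have [bY m2 weak] := chain_clt p_gt0 p_sum1 cg mu_fine bh hU corr mX0 X0_law idx_driving X0_indep X_rec hB.
exists (\int[mu]_x cond_var p (increment p g h) x).
have E_int (F : measurableTypeR R -> R) n : bmf F ->
    'E_P[fun w => F (normalized_sum phi X n w)]%E = (\int[P]_w F (normalized_sum phi X n w))%:E.
  by move=> bF; rewrite unlock EFin_int//; exact: bmf_comp (proj1 (bY n)) bF.
split.
  have E n : 'E_P[fun w => (normalized_sum phi X n w ^+ 2)%R]%E =
      (\int[P]_w (normalized_sum phi X n w ^+ 2))%:E.
    by rewrite unlock EFin_int//; apply: bmfM.
  under eq_fun do rewrite E.
  by apply: cvg_EFin; [exact: nearW|exact: m2].
move=> F cF bF.
have bF' : bmf (F : measurableTypeR R -> R) by split=> //; exact: continuous_measurable_fun.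
under eq_fun do rewrite (E_int _ _ bF').
rewrite -EFin_int//.
by apply: cvg_EFin; [exact: nearW|exact: weak].
Qed.
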